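(* Let $\mu=\mu^{\beta,h}$ be an Ising model on $\mathbb{Z}^d$, and let $\mathfrak{L}$ be a collection of finite subsets of $\mathbb{Z}^d$ which is fillable and has the approximate neighborhood property. Suppose the corresponding FK model has uniform exponential decay of connectivity for the class $\{\mathcal{B}(\Lambda):\Lambda\in\mathfrak{L}\}$ with wired boundary conditions. Then there exist constants $c,c',\epsilon>0$ such that for all finite $\Delta\subset\mathbb{Z}^d$ the following hold. (i) For all $\Theta,\Lambda\in\mathfrak{L}$ with $\Theta\subset\Lambda$, $\Delta\subset\Lambda$ and $|\Theta|\ge2$, for all $r\ge c\log|\Theta|$ with $\Delta^r(\Lambda)\subset\Theta$, for all boundary conditions $\eta$, and for all events $A\in\mathcal{H}_\Lambda$, $B\in\mathcal{H}_\Delta$, each increasing or decreasing, $$\mu_{\Lambda,\eta}(A\circ_rB)\le(1+c'e^{-\epsilon r})\,\mu_{\Lambda,\eta}(A)\,\mu_{\Lambda,\eta}(B).$$ (ii) Assume $\mathfrak{L}$ contains an absorbing sequence. Then for all $\Theta\in\mathfrak{L}$ and all $r\ge c\log|\Theta|$ with $\Delta^r\subset\Theta$, and for all events $A,B$, each increasing or decreasing, with $B\in\mathcal{H}_\Delta$ and $A$ locally-occurring, $$\mu(A\circ_rB)\le(1+c'e^{-\epsilon r})\,\mu(A)\mu(B).$$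
   Context: **Lattice notation.** A bond is an unordered pair $\langle xy\rangle$ of sites of $\mathbb{Z}^d$ at Euclidean distance 1. For $\Lambda\subset\mathbb{Z}^d$: $\mathcal{B}(\Lambda)=\{\langle xy\rangle:x,y\in\Lambda\}$, $\overline{\mathcal{B}}(\Lambda)=\{\langle xy\rangle:x\in\Lambda\}$, $\partial\Lambda=\{x\notin\Lambda:x\text{ adjacent to some }y\in\Lambda\}$. For a set $\mathcal{R}$ of bonds, $V(\mathcal{R})$ is its set of endpoints, $\mathcal{R}^c$ its complement in the set of all bonds, and $d_{\mathcal{R}}(x,y)$ the minimum length of a path from $x$ to $y$ in $\mathcal{R}$ ($0$ if $x=y$, $\infty$ if none); the distance between sets is the infimum over pairs. For $\Delta\subset\Lambda$, $\Delta^r(\Lambda)=\{x\in\Lambda:d_{\mathcal{B}(\Lambda)}(x,\Delta)\le r\}$, and $\Delta^r=\Delta^r(\mathbb{Z}^d)$. An absorbing sequence is an increasing sequence of subsets whose union is $\mathbb{Z}^d$. **Ising model.** For $\Lambda$ finite and $\sigma,\eta\in\{-1,1\}^{\mathbb{Z}^d}$, $(\sigma\eta)_\Lambda$ equals $\sigma$ on $\Lambda$ and $\eta$ on $\Lambda^c$. The Hamiltonian is $H_{\Lambda,\eta}(\sigma_\Lambda)=-\sum_{\langle xy\rangle\in\overline{\mathcal{B}}(\Lambda)}\delta_{[(\sigma\eta)_\Lambda(x)=(\sigma\eta)_\Lambda(y)]}-h\sum_{x\in\Lambda}\sigma_x$, and $\mu_{\Lambda,\eta}=\mu^{\beta,h}_{\Lambda,\eta}$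 is the probability measure on $\{-1,1\}^\Lambda$ proportional to $e^{-\beta H_{\Lambda,\eta}}$. $\mu^{\beta,h}$ denotes the infinite-volume Gibbs distribution. $\mathcal{H}_\Lambda$ is the $\sigma$-algebra generated by $(\sigma_x)_{x\in\Lambda}$. **Events.** Increasing/decreasing refer to the coordinatewise order. $A$ occurs on a set $\Theta$ of sites in $\sigma$ if every $\sigma'$ agreeing with $\sigma$ on $\Theta$ is in $A$. Under $\mu_{\Lambda,\eta}$, $A\circ_rB$ is the event that there exist $E,F\subset\Lambda$ with $d_{\mathcal{B}(\Lambda)}(E,F)\ge r$ such that $A$ occurs on $E$ and $B$ occurs on $F$; under $\mu$, the same with $\Lambda=\mathbb{Z}^d$. $A\in\mathcal{H}_{\mathbb{Z}^d}$ is locally-occurring if $\sigma\in A$ implies that $A$ occurs in $\sigma$ on some finite set of sites. **Properties of $\mathfrak{L}$.** For $c>1$, $r\ge1$, a $c$-approximate $r$-neighborhood of $x\in\Lambda$ in $\Lambda$ is a set $N$ with $\{y\in\Lambda:d_{\mathcal{B}(\Lambda)}(x,y)\le r/c\}\subset N\subset\{y\in\Lambda:d_{\mathcal{B}(\Lambda)}(x,y)\le r\}$. $\mathfrak{L}$ has the approximate neighborhood property if for some $c>1$, for every $\Lambda\in\mathfrak{L}$, $x\in\Lambda$ and $r\ge1$, $\mathfrak{L}$ includes a $c$-approximate $r$-neighborhood of $x$ in $\Lambda$. $\mathfrak{L}$ is fillable if for every $\Lambda\in\mathfrak{L}$ there is an ordering $x_1,\dots,x_n$ of $\Lambda$ such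 that $\{x_1,\dots,x_k\}\in\mathfrak{L}$ for all $1\le k\le n$. **Corresponding FK model.** It has $p=1-e^{-\beta}$, $q=2$ and external fields $h_1=0$, $h_2=-2|h|$. For finite $\mathcal{R}$ and $\rho\in\{0,1\}^{\mathcal{R}^c}$, $(\omega\rho)$ equals $\omega$ on $\mathcal{R}$, $\rho$ on $\mathcal{R}^c$; a bond is open if its value is 1; clusters are components of the graph of open bonds, isolated sites included. The FK measure on $\omega\in\{0,1\}^{\mathcal{R}}$ with boundary condition $\rho$ is proportional to $p^{|\omega|}(1-p)^{|\mathcal{R}|-|\omega|}\prod_C\big(1+(1-p)^{2|h|s(C)}\big)$, with $|\omega|$ the number of open bonds, the product over finite clusters $C$ of $(\omega\rho)$ meeting $V(\mathcal{R})$, and $s(C)$ the number of sites of $C$. The wired measure $P_{\mathcal{R},w}$ has $\rho\equiv1$; when $h=0$, for the wired measure the product is instead $2^{K(\omega)}$ with $K(\omega)$ the number of clusters of $\omega$ in the graph $(V(\mathcal{R}),\mathcal{R})$ containing no site of $V(\mathcal{R}^c)$. Uniform exponential decay of connectivity for a class of sets $\mathcal{R}$ with wired boundary conditions means: there exist $C,\lambda>0$ such that for all $\mathcal{R}$ in the class and $x,y\in V(\mathcal{R})$, $P_{\mathcal{R},w}(x\text{ and }y\text{ joined by an open path in }\mathcal{R})\le Ce^{-\lambda d_{\mathcal{R}}(x,y)}$. *)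

(* Defs.v *)
From HB Require Import structures.
From mathcomp Require Import all_boot all_order all_algebra finmap.
From mathcomp Require Import all_classical all_reals all_analysis.

Set Implicit Arguments.
Unset Strict Implicit.
Unset Printing Implicit Defensive.
Import Order.TTheory GRing.Theory Num.Theory.
Import numFieldNormedType.Exports.

Local Open Scope classical_set_scope.
Local Open Scope ring_scope.

Definition site (d : nat) := 'rV[int]_d.

(* An unordered pair <xy> is the finite set [fset x; y]; values of this type
   that are not in [bonds d] are never used. *)
Definition bond (d : nat) := {fset (site d)}.

Definition nearest_neighbors (d : nat) (x y : site d) : Prop :=
  \sum_(i < d) (x 0 i - y 0 i) ^+ 2 = 1.

Definition bonds (d : nat) : set (bond d) :=
  [set e | exists x y : site d, nearest_neighbors x y /\ e = [fset x; y]%fset].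

(* [inner_bonds] is B(Lambda), [touching_bonds] is \overline{B}(Lambda). *)
Definition inner_bonds (d : nat) (Lam : set (site d)) : set (bond d) :=
  [set e | bonds e /\ forall x, x \in e -> Lam x].

Definition touching_bonds (d : nat) (Lam : set (site d)) : set (bond d) :=
  [set e | bonds e /\ exists2 x, x \in e & Lam x].

Definition endpoints (d : nat) (B : set (bond d)) : set (site d) :=
  [set x | exists2 e, B e & x \in e].

Definition walk (d : nat) (B : set (bond d)) (x : site d) (s : seq (site d))
    (y : site d) : Prop :=
  path (fun u v => `[< B [fset u; v]%fset >]) x s /\ last x s = y.

(* The infimum of the empty set is +oo. *)
Definition bdist (R : realType) (d : nat) (B : set (bond d)) (x y : site d) :
    \bar R :=
  ereal_inf [set (size s)%:R%:E | s in [set s | walk B x s y]].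

Definition set_bdist (R : realType) (d : nat) (B : set (bond d))
    (E F : set (site d)) : \bar R :=
  ereal_inf [set bdist R B xy.1 xy.2 | xy in E `*` F].

(* Delta^r(Lambda); Delta^r is the case Lambda = setT. *)
Definition nbhd_in (R : realType) (d : nat) (Del Lam : set (site d)) (r : R) :
    set (site d) :=
  [set x | Lam x /\ (set_bdist R (inner_bonds Lam) [set x] Del <= r%:E)%E].

Definition approx_nbhd (R : realType) (d : nat) (c r : R) (Lam : {fset (site d)})
    (x : site d) (N : {fset (site d)}) : Prop :=
  let dist := bdist R (inner_bonds [set` Lam]) x in
  [set y | y \in Lam /\ (dist y <= (r / c)%:E)%E] `<=` [set` N] /\
  [set` N] `<=` [set y | y \in Lam /\ (dist y <= r%:E)%E].

Definition approx_nbhd_property (R : realType) (d : nat)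
    (L : set {fset (site d)}) : Prop :=
  exists2 c : R, 1 < c & forall (Lam : {fset (site d)}) (x : site d) (r : R),
    L Lam -> x \in Lam -> 1 <= r -> exists2 N, L N & approx_nbhd c r Lam x N.

Definition fillable (d : nat) (L : set {fset (site d)}) : Prop :=
  forall Lam, L Lam -> exists s : seq (site d),
    [/\ uniq s, s =i Lam &
      forall k, (1 <= k <= size s)%N -> L [fset x in take k s]%fset].

Definition contains_absorbing_sequence (d : nat) (L : set {fset (site d)}) :
    Prop :=
  exists Lam : nat -> {fset (site d)},
    [/\ forall n, L (Lam n),
        forall n, (Lam n `<=` Lam n.+1)%fset &
        forall x, exists n, x \in Lam n].

(* The configuration equal to [s] on [S] and to [t] off [S]; it serves both as
   (sigma eta)_Lambda for spins and as (omega rho) for bonds. *)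
Definition override (T : choiceType) (S : {fset T}) (s : {ffun S -> bool})
    (t : T -> bool) : T -> bool :=
  fun x => if insub x is Some u then s u else t x.

(* The spin +1 is encoded by [true] and the spin -1 by [false]. *)
Definition config (d : nat) := site d -> bool.

Definition spin (R : realType) (b : bool) : R := if b then 1 else - 1.

Definition coordinate_events (d : nat) (Lam : set (site d)) :
    set (set (config d)) :=
  [set A | exists2 x, Lam x & exists b, A = [set s : config d | s x = b]].

(* The sigma-algebra H_Lambda, as a sigma-algebra on {-1,1}^{Z^d}. *)
Definition sigma_spins (d : nat) (Lam : set (site d)) : set (set (config d)) :=
  <<s coordinate_events Lam >>.

(* {-1,1}^{Z^d} with the product sigma-algebra H_{Z^d}. *)
Definition spin_space (d : nat) :=
  g_sigma_algebraType (coordinate_events [set: site d]).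

Definition increasing_event (d : nat) (A : set (config d)) : Prop :=
  forall s t : config d, (forall x, (s x <= t x)%O) -> A s -> A t.

Definition decreasing_event (d : nat) (A : set (config d)) : Prop :=
  forall s t : config d, (forall x, (s x <= t x)%O) -> A t -> A s.

Definition monotone_event (d : nat) (A : set (config d)) : Prop :=
  increasing_event A \/ decreasing_event A.

Definition occurs_on (d : nat) (A : set (config d)) (E : set (site d))
    (s : config d) : Prop :=
  forall t : config d, (forall x, E x -> t x = s x) -> A t.

(* A o_r B in the volume Lambda. *)
Definition occurs_apart (R : realType) (d : nat) (Lam : set (site d)) (r : R)
    (A B : set (config d)) : set (config d) :=
  [set s | exists E F : set (site d),
    [/\ E `<=` Lam, F `<=` Lam,
        (r%:E <= set_bdist R (inner_bonds Lam) E F)%E,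
        occurs_on A E s & occurs_on B F s]].

Definition locally_occurring (d : nat) (A : set (config d)) : Prop :=
  sigma_spins setT A /\
  forall s, A s -> exists E : {fset (site d)}, occurs_on A [set` E] s.

Definition spins_agree (R : realType) (d : nat) (t : config d) (e : bond d) : R :=
  (`[< forall x y, x \in e -> y \in e -> t x = t y >])%:R.

(* H_{Lambda,eta}(sigma_Lambda) as a function of t = (sigma eta)_Lambda. *)
Definition hamiltonian (R : realType) (d : nat) (h : R) (Lam : {fset (site d)})
    (t : config d) : R :=
  - (\sum_(e \in touching_bonds [set` Lam]) spins_agree R t e)
  - h * \sum_(x <- Lam) spin R (t x).

Definition ising_weight (R : realType) (d : nat) (beta h : R)
    (Lam : {fset (site d)}) (eta : config d) (s : {ffun Lam -> bool}) : R :=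
  expR (- (beta * hamiltonian h Lam (override s eta))).

(* mu_{Lambda,eta}(A): the law of (sigma eta)_Lambda, sigma being sampled on
   Lambda; for A in H_Lambda the values of eta off Lambda do not affect
   membership in A. *)
Definition ising (R : realType) (d : nat) (beta h : R) (Lam : {fset (site d)})
    (eta : config d) (A : set (config d)) : R :=
  (\sum_(s : {ffun Lam -> bool} | `[< A (override s eta) >])
     ising_weight beta h eta s) /
  \sum_(s : {ffun Lam -> bool}) ising_weight beta h eta s.

(* Infinite-volume Gibbs distributions, by the DLR equations. *)
Definition gibbs (R : realType) (d : nat) (beta h : R)
    (mu : probability (spin_space d) R) : Prop :=
  forall (Lam : {fset (site d)}) (A : set (spin_space d)), measurable A ->
    mu A = (\int[mu]_eta (ising beta h Lam eta A)%:E)%E.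

Definition open_bonds (d : nat) (w : bond d -> bool) : set (bond d) :=
  [set e | bonds e /\ w e].

Definition fk_cluster (d : nat) (w : bond d -> bool) (x : site d) : set (site d) :=
  [set y | exists s, walk (open_bonds w) x s y].

Definition fk_p (R : realType) (beta : R) : R := 1 - expR (- beta).

Definition bond_weight (R : realType) (d : nat) (p : R) (B : {fset (bond d)})
    (w : {ffun B -> bool}) : R :=
  let n := #|[pred e | w e]| in p ^+ n * (1 - p) ^+ (#|` B| - n).

Definition fk_weight (R : realType) (d : nat) (beta h : R) (B : {fset (bond d)})
    (rho : bond d -> bool) (w : {ffun B -> bool}) : R :=
  let p := fk_p beta in
  let clusters := fk_cluster (override w rho) @` endpoints [set` B] in
  bond_weight p w *
  \big[*%R/1]_(C \in clusters `&` [set C | finite_set C])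
     (1 + (1 - p) `^ (2 * `|h| * #|` fset_set C|%:R)).

(* Closing the bonds outside B leaves the clusters of the graph (V(B), B). *)
Definition inner_clusters (d : nat) (B : {fset (bond d)})
    (w : {ffun B -> bool}) : set (set (site d)) :=
  [set C | (exists2 x, endpoints [set` B] x & C = fk_cluster (override w xpred0) x) /\
           C `&` endpoints (bonds (d := d) `\` [set` B]) = set0].

(* For h = 0 every cluster with a site in V(B^c) belongs to the boundary and
   gets no factor; for h <> 0 only the infinite clusters get none. *)
Definition fk_wired_weight (R : realType) (d : nat) (beta h : R)
    (B : {fset (bond d)}) (w : {ffun B -> bool}) : R :=
  if h == 0 then bond_weight (fk_p beta) w * 2 ^+ #|` fset_set (inner_clusters w)|
  else fk_weight beta h xpredT w.

(* P_{B,w}(x and y are joined by an open path in B). *)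
Definition fk_wired_connection (R : realType) (d : nat) (beta h : R)
    (B : {fset (bond d)}) (x y : site d) : R :=
  (\sum_(w : {ffun B -> bool} | `[< fk_cluster (override w xpred0) x y >])
     fk_wired_weight beta h w) /
  \sum_(w : {ffun B -> bool}) fk_wired_weight beta h w.

Definition uniform_exp_decay_wired (R : realType) (d : nat) (beta h : R)
    (cls : set {fset (bond d)}) : Prop :=
  exists C lam : R, [/\ 0 < C, 0 < lam &
    forall (B : {fset (bond d)}) (x y : site d), cls B ->
      endpoints [set` B] x -> endpoints [set` B] y ->
      ((fk_wired_connection beta h B x y)%:E <=
         C%:E * expeR (- (lam%:E * bdist R [set` B] x y)))%E].

(* Main.v *)
(* The proof removes the sharing of randomness one spin at a time. For a prefix l of a filling
   order of Theta, let the spins of l be sampled twice, independently given all other spins, the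
   event A being read in the first sample and B in the second one. With l empty the probability
   that A and B occur at distance r is mu(A o_r B); with l = Theta it is at most mu(A) mu(B).
   Adding one site x to l increases it up to a factor close to 1: of the sets on which A and B
   occur at most one comes within r/2 of x, so near x the event is a union of an event of the
   first sample and one of the second, monotone in the same direction, and sharing the spin at x
   correlates them positively; the spins at distance more than r/2 from x hardly feel the spin
   at x. If A and B are monotone in opposite directions, FKG suffices.

   That influence is controlled through the hypothesis on the FK model. In an approximate
   neighborhood N of x, belonging to the class, far spins act only through fields at the boundary
   of N, and by the inequality of Ding, Song and Sun the effect on the spin at x of changing a
   field at u is at most the correlation of the spins at x and u in N without any field. That
   correlation is the connection probability in the free FK model on N, whose weights are
   dominated by those of the wired one, with or without external field, because the factor of a
   union of two clusters is at least half the product of their factors. *)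
Require Import Defs.
From HB Require Import structures.
From mathcomp Require Import all_boot all_order all_algebra finmap.
From mathcomp Require Import all_classical all_reals all_analysis.
From mathcomp Require Import measurable_realfun ring lra zify.
Set Implicit Arguments.
Unset Strict Implicit.
Unset Printing Implicit Defensive.
Import Order.TTheory GRing.Theory Num.Theory.
Import numFieldNormedType.Exports.
Local Open Scope ring_scope.

(** * One edge in the Ding-Song-Sun inequality *)

(** The chain of recouplings runs inside [Tht] with the spins outside frozen, so it bounds a
    conditional probability by the product of the conditional probabilities of A and B. These must
    then be averaged over the outside spins, on which A may depend as well. This is a second
    estimate: B has nearly the same conditional probability, in ratio, for all outside spins. It
    follows from the same one-site influence, the boundary bonds being changed one at a time, and it
    is here that the r-neighborhood of Delta has to lie in [Tht].

    Fillability enters because, when x is added to a prefix, the sites off the prefix are shared by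
    both samples; only spins of the prefix can differ, so the approximate neighborhood of x is taken
    in the prefix, which must belong to the class.

    The influence bound is additive. It becomes a factor because a spin takes either value with
    conditional probability bounded below (finite energy). There are |Theta| steps, and each has an
    error of order |Theta| times an exponential in -r; the condition on r lets half of the exponent
    absorb the square of |Theta|. *)

Lemma eq_ler (R : numDomainType) (a b : R) : a = b -> a <= b.
Proof. by move=> ->. Qed.

(** Here [T] is the inverse cost of an edge and [y] a field on its far end. The claim compares two
    products of factors, each relative to the square of its mean factor: the pair with the larger
    half-gap [lam * C] loses more, provided that the right tilt [y] is applied to both. *)
Lemma balancing_tilt (R : rcfType) (T u w C lam : R) :
  1 <= T -> 0 <= u -> u <= w -> w <= 1 -> 0 <= C -> 1 <= lam ->
  exists2 y : R, 0 < y &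
   (1 + u * (T - 1)) ^+ 2 * ((1 - (w + lam * C) + (w + lam * C) * T * y) *
                             (1 - (w - lam * C) + (w - lam * C) * T / y)) <=
   (1 + w * (T - 1)) ^+ 2 * ((1 - (u + C) + (u + C) * T * y) *
                             (1 - (u - C) + (u - C) * T / y)).
Proof.
move=> T1 u0 uw w1 C0 lam1.
set n0 := (1 + u * (T - 1)) ^+ 2; set d0 := (1 + w * (T - 1)) ^+ 2.
have T0 : 0 < T by lra.
have tau0 : 0 <= T - 1 by lra.
(* Without tilt, a product is the squared mean factor minus the squared half-gap times
   [(T - 1) ^+ 2]. In this first case the relative loss of the [w] pair is already the larger
   one. *)
have [dn|nd] := leP d0 (n0 * lam ^+ 2).
  exists 1 => //; rewrite !divr1 !mulr1.
  have -> : (1 - (w + lam * C) + (w + lam * C) * T) *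
    (1 - (w - lam * C) + (w - lam * C) * T) = d0 - lam ^+ 2 * (C * (T - 1)) ^+ 2.
    by rewrite /d0; ring.
  have -> : (1 - (u + C) + (u + C) * T) * (1 - (u - C) + (u - C) * T) =
    n0 - (C * (T - 1)) ^+ 2 by rewrite /n0; ring.
  have := sqr_ge0 (C * (T - 1)); set q := (_ * _) ^+ 2 => q0.
  rewrite !mulrBr [n0 * d0]mulrC lerD2l lerN2.
  rewrite [n0 * _]mulrA; exact: (ler_wpM2r q0 dn).
(* The tilt is [q + s], with inverse [q - s]. In the expansion [k2] the terms in the half-gap [a]
   are, up to the correction [e], [2 * a * C * (T - 1) ^+ 2 - a ^+ 2 * (T - 1) ^+ 2]. This [s] puts
   their maximum at [a = C], so that [lam * C] does worse. *)
pose s := C * (T - 1) ^+ 2 / T.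
have s0 : 0 <= s by rewrite /s !mulr_ge0 ?sqr_ge0 // invr_ge0 ltW.
pose q := Num.sqrt (1 + s ^+ 2).
have qE : q ^+ 2 = 1 + s ^+ 2 by rewrite sqr_sqrtr // addr_ge0 ?sqr_ge0.
have q1 : 1 <= q.
  by rewrite -(@ler_pXn2r _ 2) ?nnegrE ?sqrtr_ge0 // qE expr1n; have := sqr_ge0 s; lra.
have qs : 0 < q - s by rewrite subr_gt0 -(@ltr_pXn2r _ 2) ?nnegrE ?sqrtr_ge0 // qE; lra.
have yV : (q + s)^-1 = q - s.
  apply: (mulfI (_ : q + s != 0)); first by rewrite gt_eqF //; lra.
  by rewrite mulfV ?gt_eqF //; [move: qE; nra | lra].
exists (q + s); first by lra.
rewrite yV.
pose e := T * q - T.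
have e0 : 0 <= e by rewrite /e subr_ge0 ler_peMr // ltW.
have sT : T * s = C * (T - 1) ^+ 2.
  by rewrite /s mulrC mulfVK // gt_eqF.
have eE : 2 * T * e + e ^+ 2 = (C * (T - 1) ^+ 2) ^+ 2.
  rewrite -sT /e.
  have -> : 2 * T * (T * q - T) + (T * q - T) ^+ 2 = T ^+ 2 * (q ^+ 2 - 1) by ring.
  by rewrite qE; ring.
have k2 (x a : R) : (1 - (x + a) + (x + a) * T * (q + s)) *
   (1 - (x - a) + (x - a) * T * (q - s)) =
   (1 + x * (T - 1)) ^+ 2 + 2 * e * x * (1 - x)
     + 2 * a * (C * (T - 1) ^+ 2) - a ^+ 2 * ((T - 1) ^+ 2 - 2 * e).
  have -> : (1 - (x + a) + (x + a) * T * (q + s)) =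
     1 - (x + a) + (x + a) * (e + T + T * s) by rewrite /e; ring.
  have -> : (1 - (x - a) + (x - a) * T * (q - s)) =
     1 - (x - a) + (x - a) * (e + T - T * s) by rewrite /e; ring.
  rewrite sT.
  have {}eE : e ^+ 2 = (C * (T - 1) ^+ 2) ^+ 2 - 2 * T * e by rewrite -eE; ring.
  set k := C * _ in eE *.
  have -> : (1 - (x + a) + (x + a) * (e + T + k)) * (1 - (x - a) + (x - a) * (e + T - k))
    = (x ^+ 2 - a ^+ 2) * (e ^+ 2 - k ^+ 2) +
      ((x ^+ 2 - a ^+ 2) * (2 * e * (T - 1)) + (1 + x * (T - 1)) ^+ 2 - a ^+ 2 * (T - 1) ^+ 2
      + 2 * x * e + 2 * a * k) by ring.
  by rewrite eE; ring.
rewrite !k2 -/n0 -/d0.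
have tC : 2 * e <= C ^+ 2 * (T - 1) ^+ 3.
  have h1 : 2 * T * e <= C ^+ 2 * (T - 1) ^+ 4.
    by move: eE; have := sqr_ge0 e; set ee := e ^+ 2; rewrite exprMn -exprM /= => ? <-; lra.
  rewrite -(ler_pM2l T0) mulrA [T * 2]mulrC; apply: le_trans h1 _.
  have -> : C ^+ 2 * (T - 1) ^+ 4 = (T - 1) * (C ^+ 2 * (T - 1) ^+ 3) by ring.
  by apply: ler_wpM2r; [rewrite mulr_ge0 ?sqr_ge0 ?exprn_ge0 | lra].
have dn0 : 2 * (w - u) * (T - 1) <= d0 - n0.
  have -> : d0 - n0 = (w - u) * (T - 1) * (2 + (u + w) * (T - 1)) by rewrite /d0 /n0; ring.
  have -> : 2 * (w - u) * (T - 1) = (w - u) * (T - 1) * 2 by ring.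
  apply: ler_wpM2l; first by rewrite mulr_ge0 //; lra.
  by rewrite lerDl mulr_ge0 //; lra.
have B0 : n0 * (w * (1 - w)) - d0 * (u * (1 - u)) <= w - u.
  have -> : n0 * (w * (1 - w)) - d0 * (u * (1 - u)) =
    (w - u) - (w - u) * ((u + w) + u * w * (2 * (T - 1) + (T - 1) ^+ 2)).
    by rewrite /n0 /d0; ring.
  rewrite gerBl mulr_ge0 //; first by lra.
  by rewrite addr_ge0 ?mulr_ge0 ?addr_ge0 ?sqr_ge0 //; lra.
have n00 : 0 <= n0 by rewrite sqr_ge0.
have t1 : 2 * e * (n0 * (w * (1 - w)) - d0 * (u * (1 - u))) <= 2 * e * (w - u).
  by apply: ler_wpM2l => //; lra.
have t2 : 2 * e * (w - u) <= C ^+ 2 * (T - 1) ^+ 3 * (w - u).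
  by apply: ler_wpM2r => //; lra.
have t3 : C ^+ 2 * (T - 1) ^+ 3 * (w - u) <= C ^+ 2 * (T - 1) ^+ 2 * (d0 - n0).
  have -> : C ^+ 2 * (T - 1) ^+ 3 * (w - u) = C ^+ 2 * (T - 1) ^+ 2 * ((w - u) * (T - 1)).
    by ring.
  apply: ler_wpM2l; first by rewrite mulr_ge0 ?sqr_ge0.
  have p0 : 0 <= (w - u) * (T - 1) by rewrite mulr_ge0 //; lra.
  by apply: le_trans dn0; rewrite -mulrA; move: p0; set p := _ * _ => p0; lra.
have t4 : C ^+ 2 * (T - 1) ^+ 2 * (n0 * (2 * lam - lam ^+ 2)) <= C ^+ 2 * (T - 1) ^+ 2 * n0.
  apply: ler_wpM2l; first by rewrite mulr_ge0 ?sqr_ge0.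
  rewrite -[leRHS]mulr1; apply: ler_wpM2l => //.
  by have := sqr_ge0 (lam - 1); rewrite sqrrB; lra.
have t5 : 2 * e * C ^+ 2 * (n0 * lam ^+ 2) <= 2 * e * C ^+ 2 * d0.
  by apply: ler_wpM2l; rewrite ?mulr_ge0 ?sqr_ge0 // ltW.
rewrite -subr_ge0.
have -> : d0 * (n0 + 2 * e * u * (1 - u) + 2 * C * (C * (T - 1) ^+ 2)
      - C ^+ 2 * ((T - 1) ^+ 2 - 2 * e))
  - n0 * (d0 + 2 * e * w * (1 - w) + 2 * (lam * C) * (C * (T - 1) ^+ 2)
      - (lam * C) ^+ 2 * ((T - 1) ^+ 2 - 2 * e))
  = C ^+ 2 * (T - 1) ^+ 2 * (d0 - n0)
    + (C ^+ 2 * (T - 1) ^+ 2 * n0 - C ^+ 2 * (T - 1) ^+ 2 * (n0 * (2 * lam - lam ^+ 2)))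
    - 2 * e * (n0 * (w * (1 - w)) - d0 * (u * (1 - u)))
    + (2 * e * C ^+ 2 * d0 - 2 * e * C ^+ 2 * (n0 * lam ^+ 2)) by ring.
lra.
Qed.

Lemma balancing_tilt_pair (R : rcfType) (T u1 u2 w1 w2 lam : R) :
  1 <= T -> 1 <= lam -> 0 <= u1 -> 0 <= u2 -> u1 <= w1 -> u2 <= w2 ->
  w1 <= 1 -> w2 <= 1 -> w1 - w2 = lam * (u1 - u2) ->
  exists2 y : R, 0 < y &
   (1 + (u1 + u2) / 2 * (T - 1)) ^+ 2 *
     ((1 - w1 + w1 * T * y) * (1 - w2 + w2 * T / y)) <=
   (1 + (w1 + w2) / 2 * (T - 1)) ^+ 2 *
     ((1 - u1 + u1 * T * y) * (1 - u2 + u2 * T / y)).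
Proof.
move=> T1 lam1 u10 u20 uw1 uw2 w11 w21.
wlog u21 : u1 u2 w1 w2 u10 u20 uw1 uw2 w11 w21 / u2 <= u1.
  move=> th; have [u21|u12] := leP u2 u1; first exact: th.
  move=> wE; have [|y y0] := th u2 u1 w2 w1 u20 u10 uw2 uw1 w21 w11 (ltW u12).
    by move: wE; rewrite -[w1 - w2]opprB -[u1 - u2]opprB mulrN => /oppr_inj.
  move=> yP; exists y^-1; first by rewrite invr_gt0.
  rewrite invrK [u1 + _]addrC [w1 + _]addrC.
  by rewrite [X in _ * X <= _]mulrC [X in _ <= _ * X]mulrC.
move=> wE.
have [|||||y y0 yP] := @balancing_tilt R T ((u1 + u2) / 2) ((w1 + w2) / 2) ((u1 - u2) / 2) lam T1 => //; try lra.
exists y => //; move: yP.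
have -> : (w1 + w2) / 2 + lam * ((u1 - u2) / 2) = w1.
  by rewrite mulrA -wE; lra.
have -> : (w1 + w2) / 2 - lam * ((u1 - u2) / 2) = w2.
  by rewrite mulrA -wE; lra.
have -> : (u1 + u2) / 2 + (u1 - u2) / 2 = u1 by lra.
by have -> : (u1 + u2) / 2 - (u1 - u2) / 2 = u2 by lra.
Qed.

(** The small letters are conditional probabilities that the ends of an edge disagree: [u1], [u2]
    when the two marked spins agree, [w1], [w2] when they differ, [u0] and [w0] in the absence of
    fields. Removing the edge multiplies a sum by [1 + u * (T - 1)], contracting it by [1 - u]. The
    last three hypotheses are thus the inequality for smaller graphs, while [Z < X] denies it for
    the present one. *)
Lemma edge_step_normalized (R : rcfType) (T u1 u2 w1 w2 u0 w0 lam Z X : R) :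
  1 <= T -> 1 <= lam -> 0 < u1 -> 0 < u2 -> u1 <= w1 -> u2 <= w2 ->
  w1 < 1 -> w2 < 1 -> w1 - w2 = lam * (u1 - u2) ->
  0 < u0 -> u0 <= w0 -> w0 < 1 -> u1 + u2 <= 1 -> 0 < Z -> Z < X ->
  (forall y, 0 < y ->
    X * (1 + w0 * (T - 1)) ^+ 2 * ((1 - u1 + u1 * T * y) * (1 - u2 + u2 * T / y)) <=
    Z * (1 + u0 * (T - 1)) ^+ 2 * ((1 - w1 + w1 * T * y) * (1 - w2 + w2 * T / y))) ->
  X * (1 - w0) ^+ 2 * ((1 - u1) * (1 - u2)) <=
    Z * (1 - u0) ^+ 2 * ((1 - w1) * (1 - w2)) ->
  u0 ^+ 2 * ((1 - u1) * (1 - u2)) <= (1 - u0) ^+ 2 * (u1 * u2) ->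
  False.
Proof.
move=> T1 lam1 u10 u20 uw1 uw2 w11 w21 wE u00 uw0 w01 uu1 Z0 ZX hy h1 h2.
have [y y0 hyy] := balancing_tilt_pair T1 lam1 (ltW u10) (ltW u20) uw1 uw2 (ltW w11) (ltW w21) wE.
move: hyy (hy y y0) => {hy}.
set u := (u1 + u2) / 2; set w := (w1 + w2) / 2.
set Fu := (1 - u1 + _) * _; set Fw := (1 - w1 + _) * _ => hyy hy.
have tau0 : 0 <= T - 1 by lra.
have T0 : 0 < T by lra.
have Fu0 : 0 < Fu.
  by rewrite mulr_gt0 // ltr_wpDr ?mulr_ge0 ?invr_ge0 ?ltW // subr_gt0; lra.
have X0 : 0 < X by lra.
have pos (a : R) : 0 < a -> 0 < 1 + a * (T - 1).
  by move=> a0; rewrite ltr_pwDl // mulr_ge0 // ltW.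
have u_0 : 0 < u by rewrite /u; lra.
have w_0 : 0 < w by rewrite /w; lra.
have w0_0 : 0 < w0 by lra.
have sqr_lt (a b : R) : 0 < a -> 0 < b -> a ^+ 2 < b ^+ 2 -> a < b.
  by move=> a0 b0; rewrite ltr_pXn2r // nnegrE ltW.
have sqr_le (a b : R) : 0 < a -> 0 < b -> a ^+ 2 <= b ^+ 2 -> a <= b.
  by move=> a0 b0; rewrite ler_pXn2r // nnegrE ltW.
have ha : (1 + w0 * (T - 1)) * (1 + u * (T - 1)) < (1 + u0 * (T - 1)) * (1 + w * (T - 1)).
  apply: sqr_lt; [by rewrite mulr_gt0 ?pos| by rewrite mulr_gt0 ?pos|].
  have hle : X * (1 + w0 * (T - 1)) ^+ 2 * Fu * (1 + u * (T - 1)) ^+ 2 <=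
     Z * (1 + u0 * (T - 1)) ^+ 2 * ((1 + w * (T - 1)) ^+ 2 * Fu).
    apply: le_trans (_ : _ <= Z * (1 + u0 * (T - 1)) ^+ 2 * Fw * (1 + u * (T - 1)) ^+ 2) _.
      by apply: ler_wpM2r; rewrite ?sqr_ge0.
    rewrite -mulrA [Fw * _]mulrC; apply: ler_wpM2l => //.
    by rewrite mulr_ge0 ?sqr_ge0 // ltW.
  have {}hle : X * ((1 + w0 * (T - 1)) * (1 + u * (T - 1))) ^+ 2 <=
     Z * ((1 + u0 * (T - 1)) * (1 + w * (T - 1))) ^+ 2.
    rewrite -(ler_pM2r Fu0) -mulrA -[leRHS]mulrA.
    have -> : X * (((1 + w0 * (T - 1)) * (1 + u * (T - 1))) ^+ 2 * Fu) =
      X * (1 + w0 * (T - 1)) ^+ 2 * Fu * (1 + u * (T - 1)) ^+ 2 by ring.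
    by apply: le_trans hle _; rewrite exprMn !mulrA.
  rewrite -(ltr_pM2l X0); apply: le_lt_trans hle _.
  by rewrite ltr_pM2r // exprn_gt0 // mulr_gt0 ?pos.
have wlt1 : w < 1 by rewrite /w; lra.
have uw : u <= w by rewrite /u /w; lra.
have hb : (1 - w0) * (1 - u) < (1 - u0) * (1 - w).
  apply: sqr_lt; [by rewrite mulr_gt0 //; lra| by rewrite mulr_gt0 //; lra|].
  have W0 : 0 < (1 - w1) * (1 - w2) by rewrite mulr_gt0 //; lra.
  have hC : (1 - w1) * (1 - w2) * (1 - u) ^+ 2 <= (1 - u1) * (1 - u2) * (1 - w) ^+ 2.
    have -> : (1 - w1) * (1 - w2) = (1 - w) ^+ 2 - ((w1 - w2) / 2) ^+ 2.
      by rewrite /w; field.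
    have -> : (1 - u1) * (1 - u2) = (1 - u) ^+ 2 - ((u1 - u2) / 2) ^+ 2.
      by rewrite /u; field.
    have key : ((u1 - u2) / 2) ^+ 2 * (1 - w) ^+ 2 <= ((w1 - w2) / 2) ^+ 2 * (1 - u) ^+ 2.
      have -> : ((w1 - w2) / 2) ^+ 2 * (1 - u) ^+ 2 =
          ((u1 - u2) / 2) ^+ 2 * (lam * (1 - u)) ^+ 2 by rewrite wE; ring.
      apply: ler_wpM2l; first exact: sqr_ge0.
      rewrite ler_pXn2r ?nnegrE ?mulr_ge0 //; try lra.
      by apply: le_trans (_ : _ <= 1 * (1 - u)) _; [lra | apply: ler_wpM2r; lra].
    move: key; set p := ((w1 - w2) / 2) ^+ 2; set q := ((u1 - u2) / 2) ^+ 2.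
    by set W := (1 - w) ^+ 2; set U := (1 - u) ^+ 2 => key; rewrite !mulrBl [U * W]mulrC; lra.
  rewrite -(ltr_pM2l X0) -(ltr_pM2r W0).
  apply: le_lt_trans (_ : _ <= X * (1 - w0) ^+ 2 * ((1 - u1) * (1 - u2)) * (1 - w) ^+ 2) _.
    have -> : X * ((1 - w0) * (1 - u)) ^+ 2 * ((1 - w1) * (1 - w2)) =
       X * (1 - w0) ^+ 2 * ((1 - w1) * (1 - w2) * (1 - u) ^+ 2) by ring.
    rewrite -[leRHS]mulrA; apply: ler_wpM2l => //.
    by rewrite mulr_ge0 ?sqr_ge0 // ltW.
  apply: le_lt_trans (_ : _ <= Z * (1 - u0) ^+ 2 * ((1 - w1) * (1 - w2)) * (1 - w) ^+ 2) _.
    by apply: ler_wpM2r; rewrite ?sqr_ge0.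
  have -> : Z * (1 - u0) ^+ 2 * ((1 - w1) * (1 - w2)) * (1 - w) ^+ 2 =
     Z * (((1 - u0) * (1 - w)) ^+ 2 * ((1 - w1) * (1 - w2))) by ring.
  rewrite -[ltRHS]mulrA ltr_pM2r // mulr_gt0 // exprn_gt0 // mulr_gt0 //; lra.
have hc : u0 <= u.
  have : u0 * (1 - u) <= (1 - u0) * u.
    apply: sqr_le; [by rewrite mulr_gt0 //; lra| by rewrite mulr_gt0 //; lra|].
    have U0 : 0 < (1 - u1) * (1 - u2) by rewrite mulr_gt0 //; lra.
    have hC : (u1 * u2) * (1 - u) ^+ 2 <= (1 - u1) * (1 - u2) * u ^+ 2.
      have -> : (1 - u1) * (1 - u2) = (1 - u) ^+ 2 - ((u1 - u2) / 2) ^+ 2.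
        by rewrite /u; field.
      have -> : u1 * u2 = u ^+ 2 - ((u1 - u2) / 2) ^+ 2.
        by rewrite /u; field.
      have key : ((u1 - u2) / 2) ^+ 2 * u ^+ 2 <= ((u1 - u2) / 2) ^+ 2 * (1 - u) ^+ 2.
        apply: ler_wpM2l; first exact: sqr_ge0.
        by rewrite ler_pXn2r ?nnegrE /u //; lra.
      move: key; set q := ((u1 - u2) / 2) ^+ 2.
      by set W := u ^+ 2; set U := (1 - u) ^+ 2 => key; rewrite !mulrBl [U * W]mulrC; lra.
    rewrite -(ler_pM2r U0).
    apply: le_trans (_ : _ <= (1 - u0) ^+ 2 * (u1 * u2) * (1 - u) ^+ 2) _.
      have -> : (u0 * (1 - u)) ^+ 2 * ((1 - u1) * (1 - u2)) =
        u0 ^+ 2 * ((1 - u1) * (1 - u2)) * (1 - u) ^+ 2 by ring.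
      by apply: ler_wpM2r; rewrite ?sqr_ge0.
    have -> : ((1 - u0) * u) ^+ 2 * ((1 - u1) * (1 - u2)) =
       (1 - u0) ^+ 2 * ((1 - u1) * (1 - u2) * u ^+ 2) by ring.
    by rewrite -[leLHS]mulrA; apply: ler_wpM2l; rewrite ?sqr_ge0.
  lra.
(* By [u0 <= w0] and [u0 <= u], contraction gives [w - w0 < u - u0] while removal of the edge gives
   the opposite strict inequality. *)
have {}hb : (w - w0) * (1 - u0) < (u - u0) * (1 - w0).
  rewrite -subr_gt0; move: hb; rewrite -subr_gt0; congr (_ < _); ring.
have {}ha : (u - u0) * (1 + w0 * (T - 1)) < (w - w0) * (1 + u0 * (T - 1)).
  rewrite ltNge; apply/negP => hle.
  move: hle; rewrite -subr_le0 => /(mulr_ge0_le0 tau0).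
  move: ha; rewrite -subr_gt0.
  have -> : (1 + u0 * (T - 1)) * (1 + w * (T - 1)) - (1 + w0 * (T - 1)) * (1 + u * (T - 1)) =
    (T - 1) * ((w - w0) * (1 + u0 * (T - 1)) - (u - u0) * (1 + w0 * (T - 1))) by ring.
  by move=> ?; lra.
have x0 : 0 <= u - u0 by lra.
have [yle|ygt] := leP (w - w0) 0.
  have : 0 <= (u - u0) * (1 + w0 * (T - 1)) by rewrite mulr_ge0 // ltW // pos.
  have : (w - w0) * (1 + u0 * (T - 1)) <= 0.
    by rewrite mulr_le0_ge0 // ltW // pos.
  lra.
have : (w - w0) * (1 + u0 * (T - 1)) <= (w - w0) * (1 + w0 * (T - 1)).
  by apply: ler_wpM2l; [lra| rewrite lerD2l ler_wpM2r].
move=> h3; have : u - u0 < w - w0.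
  rewrite -(@ltr_pM2r _ (1 + w0 * (T - 1))) ?pos //; lra.
have : (u - u0) * (1 - w0) <= (u - u0) * (1 - u0) by apply: ler_wpM2l => //; lra.
move=> h4; have : w - w0 < u - u0.
  rewrite -(@ltr_pM2r _ (1 - u0)); lra.
lra.
Qed.

(** The limit [y -> 0], with an explicit small [y]. *)
Lemma inverse_dominated (R : realFieldType) (a b c : R) :
  (forall y, 0 < y -> a / y <= b + c * y) -> a <= 0.
Proof.
move=> h; rewrite leNgt; apply/negP => a0.
pose m := `|b| + `|c| + a.
have m0 : 0 < m by rewrite ltr_wpDl // addr_ge0.
have ym : 0 < a / m by rewrite divr_gt0.
have y1 : a / m <= 1 by rewrite ler_pdivrMr // mul1r /m lerDr addr_ge0.
have := h _ ym; rewrite invf_div mulrC divfK ?gt_eqF //; apply/negP; rewrite -ltNge.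
apply: le_lt_trans (_ : _ <= `|b| + `|c|) _; last by rewrite /m ltrDl.
apply: lerD; first exact: ler_norm.
apply: le_trans (ler_norm _) _; rewrite normrM.
by rewrite -[leRHS]mulr1; apply: ler_wpM2l => //; rewrite ger0_norm // ltW.
Qed.

(** Dividing by the sums with the edge present produces the conditional probabilities of
    [edge_step_normalized]. The balance identity, which says that [N - Zp * D] is stationary under a
    field on the third spin, becomes the proportionality of the gaps with ratio [N / (Zp * D)]. *)
Lemma edge_step_balanced (R : rcfType) (A1 A2 A3 A4 B1 B2 B3 B4 P0 Q0 R0 S0 t Zp : R) :
  0 < A1 -> 0 < A2 -> 0 < A3 -> 0 < A4 -> 0 < B1 -> 0 < B2 -> 0 < B3 -> 0 < B4 ->
  0 < P0 -> 0 < Q0 -> 0 < R0 -> 0 < S0 -> 0 < t <= 1 ->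
  (forall y, 0 < y -> (A1 + A2 * y) * (A3 / y + A4) * (S0 + R0) ^+ 2 <=
     (P0 + Q0) ^+ 2 * ((B1 / y + B2) * (B3 + B4 * y))) ->
  A1 * A4 * S0 ^+ 2 <= P0 ^+ 2 * (B2 * B3) ->
  A1 * A4 * Q0 ^+ 2 <= P0 ^+ 2 * (A2 * A3) ->
  A2 * A3 <= A1 * A4 -> A2 * B3 <= A1 * B4 -> A3 * B2 <= A4 * B1 ->
  Q0 * S0 <= P0 * R0 ->
  A1 * A3 - A2 * A4 = Zp * (B1 * B3 - B2 * B4) ->
  ((P0 + t * Q0) / (S0 + t * R0)) ^+ 2 < Zp ->
  Zp * ((t * B1 + B2) * (B3 + t * B4)) <= (A1 + t * A2) * (t * A3 + A4) ->
  False.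
Proof.
move=> a1 a2 a3 a4 b1 b2 b3 b4 p0 q0 r0 s0 /andP[t0 t1] h h1 h2 f1 f2 f3 f0 bal ZZp.
set D := (t * B1 + B2) * _; set N := (A1 + t * A2) * _ => ND.
have e1 : 0 < A1 + t * A2 by rewrite addr_gt0 // mulr_gt0.
have e2 : 0 < t * A3 + A4 by rewrite addr_gt0 // mulr_gt0.
have e3 : 0 < t * B1 + B2 by rewrite addr_gt0 // mulr_gt0.
have e4 : 0 < B3 + t * B4 by rewrite addr_gt0 // mulr_gt0.
have e5 : 0 < P0 + t * Q0 by rewrite addr_gt0 // mulr_gt0.
have e6 : 0 < S0 + t * R0 by rewrite addr_gt0 // mulr_gt0.
have N0 : 0 < N by rewrite mulr_gt0.
have D0 : 0 < D by rewrite mulr_gt0.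
set Z := (_ / _) ^+ 2 in ZZp.
have Z0 : 0 < Z by rewrite exprn_gt0 // divr_gt0.
have Zp0 : 0 < Zp by apply: lt_trans ZZp.
have n1 := gt_eqF e1; have n2 := gt_eqF e2; have n3 := gt_eqF e3.
have n4 := gt_eqF e4; have n5 := gt_eqF e5; have n6 := gt_eqF e6.
have nt := gt_eqF t0.
have nN := gt_eqF N0; have nD := gt_eqF D0; have nZp := gt_eqF Zp0.
apply: (@edge_step_normalized R t^-1 (t * A2 / (A1 + t * A2)) (t * A3 / (t * A3 + A4))
  (t * B4 / (B3 + t * B4)) (t * B1 / (t * B1 + B2)) (t * Q0 / (P0 + t * Q0))
  (t * R0 / (S0 + t * R0)) (N / (Zp * D)) Z (N / D)).
- by rewrite invf_ge1.
- by rewrite ler_pdivlMr ?mulr_gt0 // mul1r.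
- by rewrite divr_gt0 ?mulr_gt0.
- by rewrite divr_gt0 ?mulr_gt0.
- rewrite ler_pdivrMr // mulrAC ler_pdivlMr // -!mulrA ler_pM2l //.
  rewrite !mulrDr [B4 * (t * _)]mulrCA [A2 * (t * B4)]mulrCA [A2 * B4]mulrC.
  by rewrite lerD2r [B4 * _]mulrC.
- rewrite ler_pdivrMr // mulrAC ler_pdivlMr // -!mulrA ler_pM2l //.
  rewrite !mulrDr [B1 * (t * _)]mulrCA [A3 * (t * B1)]mulrCA [A3 * B1]mulrC.
  by rewrite lerD2l [B1 * _]mulrC.
- by rewrite ltr_pdivrMr // mul1r ltrDr.
- by rewrite ltr_pdivrMr // mul1r ltrDl.
- have -> : t * B4 / (B3 + t * B4) - t * B1 / (t * B1 + B2) = t * (B2 * B4 - B1 * B3) / D.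
    by rewrite /D; field; rewrite n3 n4.
  have -> : t * A2 / (A1 + t * A2) - t * A3 / (t * A3 + A4) = t * (A2 * A4 - A1 * A3) / N.
    by rewrite /N; field; rewrite n1 n2.
  have -> : A2 * A4 - A1 * A3 = Zp * (B2 * B4 - B1 * B3).
    by rewrite -opprB bal -mulrN opprB.
  by field; rewrite nN nD nZp.
- by rewrite divr_gt0 ?mulr_gt0.
- rewrite ler_pdivrMr // mulrAC ler_pdivlMr // -!mulrA ler_pM2l //.
  rewrite !mulrDr [R0 * (t * _)]mulrCA [Q0 * (t * R0)]mulrCA [Q0 * R0]mulrC.
  by rewrite lerD2r [R0 * _]mulrC.
- by rewrite ltr_pdivrMr // mul1r ltrDr.
- have -> : t * A2 / (A1 + t * A2) + t * A3 / (t * A3 + A4) =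
    1 - (A1 * A4 - t ^+ 2 * (A2 * A3)) / N.
    by rewrite /N; field; rewrite n1 n2.
  rewrite gerBl divr_ge0 ?(ltW N0) // subr_ge0; apply: le_trans f1.
  by rewrite ger_pMl ?mulr_gt0 // expr_le1 // ltW.
- exact: Z0.
- apply: lt_le_trans ZZp _; by rewrite ler_pdivlMr.
- move=> y y0; have ny := gt_eqF y0.
  have := h y y0.
  have -> : (A1 + A2 * y) * (A3 / y + A4) = N *
    ((1 - t * A2 / (A1 + t * A2) + t * A2 / (A1 + t * A2) * t^-1 * y) *
     (1 - t * A3 / (t * A3 + A4) + t * A3 / (t * A3 + A4) / t / y)).
    by rewrite /N; field; rewrite n1 n2 nt ny.
  have -> : (B1 / y + B2) * (B3 + B4 * y) = D *
    ((1 - t * B4 / (B3 + t * B4) + t * B4 / (B3 + t * B4) * t^-1 * y) *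
     (1 - t * B1 / (t * B1 + B2) + t * B1 / (t * B1 + B2) / t / y)).
    by rewrite /D; field; rewrite n3 n4 nt ny.
  set Fu := (1 - t * A2 / _ + _) * _; set Fw := (1 - t * B4 / _ + _) * _ => hy.
  have -> : N / D * (1 + t * R0 / (S0 + t * R0) * (t^-1 - 1)) ^+ 2 * Fu =
     (N * Fu * (S0 + R0) ^+ 2) / (D * (S0 + t * R0) ^+ 2).
    by field; rewrite nD n6 nt.
  have -> : Z * (1 + t * Q0 / (P0 + t * Q0) * (t^-1 - 1)) ^+ 2 * Fw =
     ((P0 + Q0) ^+ 2 * (D * Fw)) / (D * (S0 + t * R0) ^+ 2).
    by rewrite /Z; field; rewrite nD n5 n6 nt.
  by rewrite ler_pM2r // invr_gt0 mulr_gt0 // exprn_gt0.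
- have -> : N / D * (1 - t * R0 / (S0 + t * R0)) ^+ 2 *
    ((1 - t * A2 / (A1 + t * A2)) * (1 - t * A3 / (t * A3 + A4))) =
    (A1 * A4 * S0 ^+ 2) / (D * (S0 + t * R0) ^+ 2).
    by rewrite /N; field; rewrite nD n1 n2 n6.
  have -> : Z * (1 - t * Q0 / (P0 + t * Q0)) ^+ 2 *
    ((1 - t * B4 / (B3 + t * B4)) * (1 - t * B1 / (t * B1 + B2))) =
    (P0 ^+ 2 * (B2 * B3)) / (D * (S0 + t * R0) ^+ 2).
    by rewrite /Z /D; field; rewrite n3 n4 n5 n6.
  by rewrite ler_pM2r // invr_gt0 mulr_gt0 // exprn_gt0.
have -> : (t * Q0 / (P0 + t * Q0)) ^+ 2 *
    ((1 - t * A2 / (A1 + t * A2)) * (1 - t * A3 / (t * A3 + A4))) =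
    (A1 * A4 * Q0 ^+ 2) * (t ^+ 2 / (N * (P0 + t * Q0) ^+ 2)).
  by rewrite /N; field; rewrite n1 n2 n5.
have -> : (1 - t * Q0 / (P0 + t * Q0)) ^+ 2 *
    (t * A2 / (A1 + t * A2) * (t * A3 / (t * A3 + A4))) =
    (P0 ^+ 2 * (A2 * A3)) * (t ^+ 2 / (N * (P0 + t * Q0) ^+ 2)).
  by rewrite /N; field; rewrite n1 n2 n5.
by rewrite ler_pM2r // divr_gt0 ?mulr_gt0 ?exprn_gt0.
Qed.

(** Deletion and contraction of an edge of cost [t] from the second marked spin to a third one. [A]
    collects the sums in which the marked spins agree, [B] those in which they differ, [P0] to [S0]
    the field-free ones. The hypotheses are the case [t = 1] under every field on the third spin,
    the case [t = 0], the identification of the two marked spins, and lattice inequalities. *)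
Lemma edge_step (R : rcfType) (A1 A2 A3 A4 B1 B2 B3 B4 P0 Q0 R0 S0 t : R) :
  0 < A1 -> 0 < A2 -> 0 < A3 -> 0 < A4 -> 0 < B1 -> 0 < B2 -> 0 < B3 -> 0 < B4 ->
  0 < P0 -> 0 < Q0 -> 0 < R0 -> 0 < S0 -> 0 < t <= 1 ->
  (forall y, 0 < y -> (A1 + A2 * y) * (A3 / y + A4) * (S0 + R0) ^+ 2 <=
     (P0 + Q0) ^+ 2 * ((B1 / y + B2) * (B3 + B4 * y))) ->
  A1 * A4 * S0 ^+ 2 <= P0 ^+ 2 * (B2 * B3) ->
  A1 * A4 * Q0 ^+ 2 <= P0 ^+ 2 * (A2 * A3) ->
  A2 * A3 <= A1 * A4 -> A2 * B3 <= A1 * B4 -> A3 * B2 <= A4 * B1 ->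
  Q0 * S0 <= P0 * R0 ->
  (A1 + t * A2) * (t * A3 + A4) * (S0 + t * R0) ^+ 2 <=
    (P0 + t * Q0) ^+ 2 * ((t * B1 + B2) * (B3 + t * B4)).
Proof.
move=> a1 a2 a3 a4 b1 b2 b3 b4 p0 q0 r0 s0 t01 h h1 h2 f1 f2 f3 f0.
have /andP[t0 t1] := t01.
have e3 : 0 < t * B1 + B2 by rewrite addr_gt0 // mulr_gt0.
have e4 : 0 < B3 + t * B4 by rewrite addr_gt0 // mulr_gt0.
have e5 : 0 < P0 + t * Q0 by rewrite addr_gt0 // mulr_gt0.
have e6 : 0 < S0 + t * R0 by rewrite addr_gt0 // mulr_gt0.
set N := (A1 + t * A2) * _; set D := (t * B1 + B2) * _.
have D0 : 0 < D by rewrite mulr_gt0.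
rewrite leNgt; apply/negP => viol.
pose Z := ((P0 + t * Q0) / (S0 + t * R0)) ^+ 2.
have ZX : Z < N / D.
  rewrite ltr_pdivlMr // /Z exprMn exprVn mulrAC ltr_pdivrMr //.
  by rewrite exprn_gt0.
(* A value strictly between the two ratios: [Z < Zp] makes [V1] and [V2] positive, and the violation
   persists with [Zp] in place of [Z]. *)
pose Zp := (Z + N / D) / 2.
have [ZZp ZpX] : Z < Zp /\ Zp < N / D by rewrite /Zp; split; lra.
have e7 : 0 < S0 + R0 by rewrite addr_gt0.
have e8 : 0 < P0 + Q0 by rewrite addr_gt0.
have Z1Z : ((P0 + Q0) / (S0 + R0)) ^+ 2 <= Z.
  rewrite ler_pXn2r ?nnegrE ?divr_ge0 ?(ltW e5) ?(ltW e6) ?(ltW e7) ?(ltW e8) //.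
  rewrite ler_pdivrMr // mulrAC ler_pdivlMr // -subr_ge0.
  have -> : (P0 + t * Q0) * (S0 + R0) - (P0 + Q0) * (S0 + t * R0) =
    (1 - t) * (P0 * R0 - Q0 * S0) by ring.
  by rewrite mulr_ge0 // subr_ge0.
(* Leading coefficients of the inequality without the edge when the field forces the third spin.
   [U1] is the limit [y -> 0], and [U2] the limit at infinity, obtained by exchanging the two values
   of that spin. *)
have U a1' a2' a3' a4' b1' b2' b3' b4' : 0 < b1' * b3' ->
    (forall y, 0 < y -> (a1' + a2' * y) * (a3' / y + a4') * (S0 + R0) ^+ 2 <=
       (P0 + Q0) ^+ 2 * ((b1' / y + b2') * (b3' + b4' * y))) -> a1' * a3' < Zp * (b1' * b3').
  move=> bb h'.
  have : a1' * a3' * (S0 + R0) ^+ 2 - (P0 + Q0) ^+ 2 * (b1' * b3') <= 0.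
    apply: (@inverse_dominated _ _
     ((P0 + Q0) ^+ 2 * (b1' * b4' + b2' * b3') - (a1' * a4' + a2' * a3') * (S0 + R0) ^+ 2)
     ((P0 + Q0) ^+ 2 * (b2' * b4') - a2' * a4' * (S0 + R0) ^+ 2)) => y y0.
    have ny := gt_eqF y0.
    have := h' y y0; rewrite -subr_ge0 => hy; rewrite -subr_ge0.
    by apply: le_trans hy _; apply: eq_ler; field; rewrite ny.
  rewrite subr_le0 => u1; apply: le_lt_trans (_ : _ <= Z * (b1' * b3')) _; last first.
    by rewrite ltr_pM2r.
  apply: le_trans (_ : _ <= ((P0 + Q0) / (S0 + R0)) ^+ 2 * (b1' * b3')) _.
    by rewrite exprMn exprVn mulrAC ler_pdivlMr // exprn_gt0.
  by rewrite ler_pM2r.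
have U1 : A1 * A3 < Zp * (B1 * B3) by apply: U h; rewrite mulr_gt0.
have U2 : A2 * A4 < Zp * (B2 * B4).
  apply: (U A2 A1 A4 A3 B2 B1 B4 B3) => [|y y0]; first by rewrite mulr_gt0.
  have y0' : 0 < y^-1 by rewrite invr_gt0.
  have ny := gt_eqF y0; have := h _ y0'; rewrite invrK => hy.
  have -> : (A2 + A1 * y) * (A4 / y + A3) = (A1 + A2 / y) * (A3 * y + A4) by field; rewrite ny.
  by have -> : (B2 / y + B1) * (B4 + B3 * y) = (B1 * y + B2) * (B3 + B4 / y) by field; rewrite ny.
pose V1 := Zp * (B1 * B3) - A1 * A3; pose V2 := Zp * (B2 * B4) - A2 * A4.
have V10 : 0 < V1 by rewrite subr_gt0.
have V20 : 0 < V2 by rewrite subr_gt0.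
(* The field on the third spin maximizing N - Zp D. *)
pose y := Num.sqrt (V1 / V2).
have y0 : 0 < y by rewrite sqrtr_gt0 divr_gt0.
have ny := gt_eqF y0.
have yE : V2 * y ^+ 2 = V1 by rewrite sqr_sqrtr ?divr_ge0 ?ltW // mulrC divfK ?gt_eqF.
apply: (@edge_step_balanced R A1 (A2 * y) (A3 / y) A4 (B1 / y) B2 B3 (B4 * y) P0 Q0 R0 S0 t Zp);
  rewrite ?mulr_gt0 ?divr_gt0 ?invr_gt0 //.
- move=> z z0; have := h (y * z) (mulr_gt0 y0 z0).
  by rewrite !mulrA invfM !mulrA.
- have -> : A2 * y * (A3 / y) = A2 * A3 by field; rewrite ny.
  exact: h2.
- have -> : A2 * y * (A3 / y) = A2 * A3 by field; rewrite ny.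
  exact: f1.
- by rewrite mulrAC mulrA ler_pM2r.
- by rewrite mulrAC mulrA ler_pM2r // invr_gt0.
- apply/eqP; rewrite -subr_eq0; apply/eqP.
  have -> : A1 * (A3 / y) - A2 * y * A4 - Zp * (B1 / y * B3 - B2 * (B4 * y)) =
    (V2 * y ^+ 2 - V1) / y by rewrite /V1 /V2; field; rewrite ny.
  by rewrite yE subrr mul0r.
have ND : Zp * D <= N by rewrite -ler_pdivlMr // ltW.
rewrite -subr_ge0; move: ND; rewrite -subr_ge0 => ND.
have -> : (A1 + t * (A2 * y)) * (t * (A3 / y) + A4) -
   Zp * ((t * (B1 / y) + B2) * (B3 + t * (B4 * y))) =
   (N - Zp * D) + t * (V1 + V2 - V1 / y - V2 * y).
  by rewrite /N /D /V1 /V2; field; rewrite ny.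
rewrite addr_ge0 // mulr_ge0 // ?(ltW t0) // -yE.
have -> : V2 * y ^+ 2 + V2 - V2 * y ^+ 2 / y - V2 * y = V2 * (y - 1) ^+ 2.
  by field; rewrite ny.
by rewrite mulr_ge0 ?sqr_ge0 ?(ltW V20).
Qed.

(** * Sums over configurations *)

Section Configurations.
Variables (R : realFieldType) (T : eqType).
Implicit Types (s t : T -> bool) (l : seq T) (F G : (T -> bool) -> R).

Definition upd s x b : T -> bool := fun y => if y == x then b else s y.

(* The sum of F over the configurations that agree with s off l. *)
Fixpoint sumc l F s : R :=
  if l is x :: l' then sumc l' F (upd s x true) + sumc l' F (upd s x false) else F s.

Lemma updxx s x b : upd s x b x = b.
Proof. by rewrite /upd eqxx. Qed.

Lemma upd_id s x : upd s x (s x) = s.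
Proof. by apply/funext => y; rewrite /upd; case: eqP => [->|]. Qed.

Lemma updC s x y b c : x != y -> upd (upd s x b) y c = upd (upd s y c) x b.
Proof.
move=> xy; apply/funext => z; rewrite /upd.
by case: eqP => // ->; rewrite eq_sym (negbTE xy).
Qed.

Definition agree_off l s t := forall y, y \notin l -> t y = s y.

Lemma agree_off_sym l s t : agree_off l s t -> agree_off l t s.
Proof. by move=> h y yl; rewrite h. Qed.

Lemma agree_off_trans l s t u : agree_off l s t -> agree_off l t u -> agree_off l s u.
Proof. by move=> st tu y yl; rewrite tu // st. Qed.

Lemma agree_offS l1 l2 s t : {subset l1 <= l2} -> agree_off l1 s t -> agree_off l2 s t.
Proof. by move=> sub h y yl; apply: h; apply: contra yl; exact: sub. Qed.

Lemma agree_off_upd l x s t b : agree_off l (upd s x b) t -> agree_off (x :: l) s t.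
Proof.
move=> h y; rewrite inE negb_or => /andP[yx yl].
by rewrite (h _ yl) /upd (negbTE yx).
Qed.

Lemma agree_off_upd2 l x s t b : agree_off (x :: l) s t ->
  agree_off l (upd s x b) (upd t x b).
Proof.
move=> h y yl; rewrite /upd; case: eqP => // yx; apply: h.
by rewrite inE negb_or yl andbT; apply/eqP.
Qed.

Lemma sumc_agree l F s t : agree_off l s t -> sumc l F t = sumc l F s.
Proof.
elim: l s t => [|x l IH] s t h /=; first by congr F; apply/funext => y; exact: h.
by congr (_ + _); apply: IH; exact: agree_off_upd2.
Qed.

Lemma eq_sumc l F G s : (forall t, agree_off l s t -> F t = G t) -> sumc l F s = sumc l G s.
Proof.
elim: l s => [|x l IH] s h /=; first exact: h.
by congr (_ + _); apply: IH => t /agree_off_upd /h.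
Qed.

Lemma ler_sumc l F G s : (forall t, agree_off l s t -> F t <= G t) ->
  sumc l F s <= sumc l G s.
Proof.
elim: l s => [|x l IH] s h /=; first exact: h.
by apply: lerD; apply: IH => t /agree_off_upd /h.
Qed.

Lemma sumc_ge0 l F s : (forall t, 0 <= F t) -> 0 <= sumc l F s.
Proof. by move=> h; elim: l s => //= x l IH s; rewrite addr_ge0. Qed.

Lemma sumc_gt0 l F s : (forall t, 0 < F t) -> 0 < sumc l F s.
Proof. by move=> h; elim: l s => //= x l IH s; rewrite addr_gt0. Qed.

Lemma sumcZ l c F s : sumc l (fun t => c * F t) s = c * sumc l F s.
Proof. by elim: l s => //= x l IH s; rewrite !IH mulrDr. Qed.

Lemma sumcZr l c F s : sumc l (fun t => F t * c) s = sumc l F s * c.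
Proof. by elim: l s => //= x l IH s; rewrite !IH mulrDl. Qed.

Lemma sumcD l F G s : sumc l (fun t => F t + G t) s = sumc l F s + sumc l G s.
Proof. by elim: l s => //= x l IH s; rewrite !IH addrACA. Qed.

Lemma sumc0 l s : sumc l (fun=> 0) s = 0.
Proof. by elim: l s => //= x l IH s; rewrite !IH addr0. Qed.

Lemma sumcN l F s : sumc l (fun t => - F t) s = - sumc l F s.
Proof. by elim: l s => //= x l IH s; rewrite !IH opprD. Qed.

Lemma sumc_cat l1 l2 F s : sumc (l1 ++ l2) F s = sumc l1 (sumc l2 F) s.
Proof. by elim: l1 s => //= x l IH s; rewrite !IH. Qed.

Lemma sumc_swap x y l F s : sumc [:: x, y & l] F s = sumc [:: y, x & l] F s.
Proof.
rewrite /=; have [->//|xy] := eqVneq x y.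
by rewrite !(updC _ _ _ xy) !addrA; congr (_ + _); rewrite addrAC.
Qed.

Lemma sumc_perm l1 l2 F s : perm_eq l1 l2 -> sumc l1 F s = sumc l2 F s.
Proof.
elim: l1 l2 s => [|x l IH] l2 s; first by move=> /perm_size; case: l2.
move=> p; have xl2 : x \in l2 by rewrite -(perm_mem p) mem_head.
have /splitPr sp := xl2.
case: sp p => r1 r2 p.
have {}p : perm_eq l (r1 ++ r2).
  by rewrite -(perm_cons x) (perm_trans p) // perm_sym -cat1s perm_catCA.
have -> : sumc (r1 ++ x :: r2) F s = sumc (x :: r1 ++ r2) F s.
  elim: r1 s {xl2 p} => [//|y r1 IHr] s; rewrite -[RHS]sumc_swap /= !IHr //=.
by rewrite /= !(IH (r1 ++ r2)).
Qed.

Lemma sumc_addb l F s (a : T -> bool) :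
  sumc l (fun t => F (fun y => t y (+) a y)) s = sumc l F (fun y => s y (+) a y).
Proof.
have updE s' x b : (fun y => upd s' x b y (+) a y) =
    upd (fun y => s' y (+) a y) x (b (+) a x).
  by apply/funext => y; rewrite /upd; case: eqP => // ->.
elim: l s => //= x l IH s; rewrite !IH !updE.
by case: (a x) => /=; rewrite // addrC.
Qed.

(** Both contracting a vertex and freezing a spin are substitutions that commute with the updates
    made by the sum. *)
Lemma sumc_substitute l F s (f : (T -> bool) -> (T -> bool)) :
  (forall t x b, x \in l -> f (upd t x b) = upd (f t) x b) ->
  sumc l (fun t => F (f t)) s = sumc l F (f s).
Proof.
elim: l s => //= x l IH s h.
rewrite !IH ?h ?mem_head // => t y b yl; apply: h; by rewrite inE yl orbT.
Qed.

Definition jn s t : T -> bool := fun x => s x || t x.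
Definition mt s t : T -> bool := fun x => s x && t x.

(** The case of one coordinate. With [p], [q] the mixed products on the left and [r], [w] those on
    the right, [(r - p) * (r - q) >= 0] and [p * q <= r * w] give [p + q <= r + w]. *)
Lemma four_numbers (a0 a1 b0 b1 c0 c1 d0 d1 : R) :
  0 <= a0 -> 0 <= a1 -> 0 <= b0 -> 0 <= b1 -> 0 <= c0 -> 0 <= c1 -> 0 <= d0 -> 0 <= d1 ->
  a0 * b0 <= c0 * d0 -> a0 * b1 <= c1 * d0 -> a1 * b0 <= c1 * d0 -> a1 * b1 <= c1 * d1 ->
  (a1 + a0) * (b1 + b0) <= (c1 + c0) * (d1 + d0).
Proof.
move=> a00 a10 b00 b10 c00 c10 d00 d10 h00 h01 h10 h11.
suff : a0 * b1 + a1 * b0 <= c1 * d0 + c0 * d1 by lra.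
have c0d1 : 0 <= c0 * d1 by rewrite mulr_ge0.
have [r0|r0] := leP (c1 * d0) 0; first by lra.
have key : (a0 * b1) * (a1 * b0) <= (c1 * d0) * (c0 * d1).
  have -> : (a0 * b1) * (a1 * b0) = (a0 * b0) * (a1 * b1) by ring.
  have -> : (c1 * d0) * (c0 * d1) = (c0 * d0) * (c1 * d1) by ring.
  by apply: ler_pM; rewrite ?mulr_ge0.
rewrite -(ler_pM2l r0).
have : 0 <= (c1 * d0 - a0 * b1) * (c1 * d0 - a1 * b0) by rewrite mulr_ge0 // subr_ge0.
move: key; set p := a0 * b1; set q := a1 * b0; set r := c1 * d0; set w := c0 * d1.
by rewrite mulrBl !mulrBr !mulrDr [p * r]mulrC; lra.
Qed.

Lemma jn_upd s t x b c : jn (upd s x b) (upd t x c) = upd (jn s t) x (b || c).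
Proof. by apply/funext => y; rewrite /jn /upd; case: eqP. Qed.

Lemma mt_upd s t x b c : mt (upd s x b) (upd t x c) = upd (mt s t) x (b && c).
Proof. by apply/funext => y; rewrite /mt /upd; case: eqP. Qed.

(** The Ahlswede-Daykin inequality with boundary configurations, by induction on the sites. *)
Theorem four_functions (A B C D : (T -> bool) -> R) l s t :
  (forall u, 0 <= A u) -> (forall u, 0 <= B u) -> (forall u, 0 <= C u) ->
  (forall u, 0 <= D u) -> (forall u v, A u * B v <= C (jn u v) * D (mt u v)) ->
  sumc l A s * sumc l B t <= sumc l C (jn s t) * sumc l D (mt s t).
Proof.
move=> A0 B0 C0 D0 h; elim: l s t => [|x l IH] s t /=; first exact: h.
have IHx b c := IH (upd s x b) (upd t x c).
apply: four_numbers; rewrite ?sumc_ge0 //; have := IHx false false; have := IHx false true;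
  have := IHx true false; have := IHx true true; by rewrite !jn_upd !mt_upd.
Qed.

Definition lattice_weight (W : (T -> bool) -> R) :=
  forall s t, W s * W t <= W (jn s t) * W (mt s t).

Definition le_conf s t := forall x, s x -> t x.

Lemma jn_le s t : le_conf s t -> jn s t = t.
Proof. by move=> st; apply/funext => x; rewrite /jn; case: (s x) (st x) => //= ->. Qed.

Lemma mt_le s t : le_conf s t -> mt s t = s.
Proof. by move=> st; apply/funext => x; rewrite /mt; case: (s x) (st x) => //= ->. Qed.

Definition isotone F := forall s t, le_conf s t -> F s <= F t.

(** Four functions with the observable placed on the join: conditional expectations increase with
    the boundary configuration. *)
Lemma fkg_boundary (W F : (T -> bool) -> R) l s t :
  (forall u, 0 <= W u) -> (forall u, 0 <= F u) -> lattice_weight W -> isotone F ->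
  le_conf s t ->
  sumc l (fun u => W u * F u) s * sumc l W t <=
  sumc l (fun u => W u * F u) t * sumc l W s.
Proof.
move=> W0 F0 lw iF st.
have := @four_functions (fun u => W u * F u) W (fun u => W u * F u) W l s t.
rewrite jn_le // mt_le //; apply => // [u|u|u v]; rewrite ?mulr_ge0 //.
rewrite mulrAC [leRHS]mulrAC; apply: ler_pM; rewrite ?mulr_ge0 //.
by apply: iF => x ux; rewrite /jn ux.
Qed.

Lemma fkg (W F G : (T -> bool) -> R) l s :
  (forall u, 0 <= W u) -> (forall u, 0 <= F u) -> (forall u, 0 <= G u) ->
  lattice_weight W -> isotone F -> isotone G ->
  sumc l (fun u => W u * F u) s * sumc l (fun u => W u * G u) s <=
  sumc l (fun u => W u * F u * G u) s * sumc l W s.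
Proof.
move=> W0 F0 G0 lw iF iG.
have := @four_functions (fun u => W u * F u) (fun u => W u * G u)
   (fun u => W u * F u * G u) W l s s.
rewrite jn_le // mt_le //; apply => // [u|u|u|u v]; rewrite ?mulr_ge0 //.
rewrite mulrACA [leRHS]mulrAC.
have -> : W (jn u v) * F (jn u v) * W (mt u v) * G (jn u v) =
   W (jn u v) * W (mt u v) * (F (jn u v) * G (jn u v)) by ring.
apply: ler_pM; rewrite ?mulr_ge0 //.
by apply: ler_pM => //; [apply: iF|apply: iG] => x xx; rewrite /jn xx // orbT.
Qed.

End Configurations.

Lemma sumc_exchange (R : realFieldType) (T U : eqType) (l1 : seq T) (l2 : seq U)
    (F : (T -> bool) -> (U -> bool) -> R) s t :
  sumc l1 (fun u => sumc l2 (F u) t) s = sumc l2 (fun v => sumc l1 (F^~ v) s) t.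
Proof.
elim: l2 F t => //= x l IH F t.
by rewrite sumcD !IH.
Qed.

(** * Cross ratios of two spins *)

Section EdgeWeights.
Variables (R : realFieldType) (T : eqType).
Implicit Types (s t : T -> bool) (el : seq (T * T * R)) (gl : seq (T * R)) (l : seq T).

(* An edge (x, y, a) costs a factor a when its ends disagree, a field (x, a) gives a
   factor a when the spin at x is +. *)
Definition edge_weight (e : T * T * R) s : R := if s e.1.1 == s e.1.2 then 1 else e.2.
Definition field_weight (f : T * R) s : R := if s f.1 then f.2 else 1.
Definition edges_weight el s := \prod_(e <- el) edge_weight e s.
Definition fields_weight gl s := \prod_(f <- gl) field_weight f s.
Definition weight el gl s := edges_weight el s * fields_weight gl s.

Definition ferromagnetic el := all (fun e => 0 < e.2 <= 1) el.
Definition pos_fields gl := all (fun f : T * R => 0 < f.2) gl.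

Lemma edges_weight_gt0 el s : ferromagnetic el -> 0 < edges_weight el s.
Proof.
move=> /allP h; rewrite /edges_weight big_seq; apply: prodr_gt0 => e /h.
by rewrite /edge_weight; case: eqP => // _ /andP[].
Qed.

Lemma fields_weight_gt0 gl s : pos_fields gl -> 0 < fields_weight gl s.
Proof.
move=> /allP h; rewrite /fields_weight big_seq; apply: prodr_gt0 => e /h.
by rewrite /field_weight; case: (s _).
Qed.

Lemma weight_gt0 el gl s : ferromagnetic el -> pos_fields gl -> 0 < weight el gl s.
Proof. by move=> h1 h2; rewrite mulr_gt0 ?edges_weight_gt0 ?fields_weight_gt0. Qed.

Lemma edges_weight_lattice el : ferromagnetic el -> lattice_weight (edges_weight el).
Proof.
move=> h s t; rewrite /edges_weight; elim: el h => [|e el IH] /= => [_|/andP[/andP[e0 e1] h]].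
  by rewrite !big_nil.
rewrite !big_cons mulrACA [leRHS]mulrACA; apply: ler_pM; last exact: IH.
- by rewrite mulr_ge0 // /edge_weight; case: eqP => // _; exact: ltW.
- by rewrite mulr_ge0 // ltW // edges_weight_gt0.
rewrite /edge_weight /jn /mt; have e2 : e.2 * e.2 <= 1 by rewrite mulr_ile1 // ltW.
by case: (s _) (s _) (t _) (t _) => [] [] [] [] /=; rewrite ?mulr1 ?mul1r //.
Qed.

Lemma fields_weight_lattice gl s t :
  fields_weight gl s * fields_weight gl t = fields_weight gl (jn s t) * fields_weight gl (mt s t).
Proof.
rewrite /fields_weight -!big_split; apply: eq_bigr => f _; rewrite /field_weight /jn /mt.
by case: (s _) (t _) => [] [] /=; rewrite ?mulr1 ?mul1r.
Qed.

Lemma weight_lattice el gl : ferromagnetic el -> pos_fields gl -> lattice_weight (weight el gl).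
Proof.
move=> h hg s t; rewrite /weight mulrACA [leRHS]mulrACA fields_weight_lattice ler_pM2r.
  exact: edges_weight_lattice.
by rewrite mulr_gt0 // fields_weight_gt0.
Qed.

Lemma weight_perm el el' gl s : perm_eq el el' -> weight el gl s = weight el' gl s.
Proof. by move=> p; rewrite /weight /edges_weight (perm_big _ p). Qed.

Lemma weight_cons e el gl s : weight (e :: el) gl s = edge_weight e s * weight el gl s.
Proof. by rewrite /weight /edges_weight big_cons mulrA. Qed.

Lemma weight_cons_field f el gl s : weight el (f :: gl) s = field_weight f s * weight el gl s.
Proof. by rewrite /weight /fields_weight big_cons mulrCA. Qed.

(** Contraction creates loops and parallel edges. Both are harmless: a loop has weight 1, and the
    factors of parallel edges multiply. *)
Definition map_edges (f : T -> T) el := [seq (f e.1.1, f e.1.2, e.2) | e <- el].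
Definition map_fields (f : T -> T) gl := [seq (f e.1, e.2) | e <- gl].

Lemma weight_map f el gl s : weight (map_edges f el) (map_fields f gl) s =
  weight el gl (fun x => s (f x)).
Proof.
by rewrite /weight /edges_weight /fields_weight !big_map.
Qed.

Definition edges_in l el := all (fun e : T * T * R => (e.1.1 \in l) && (e.1.2 \in l)) el.

Lemma edges_weight_addb el s l a : edges_in l el -> (forall x, x \in l -> a x = true) ->
  edges_weight el (fun x => s x (+) a x) = edges_weight el s.
Proof.
move=> /allP h al; rewrite /edges_weight [LHS]big_seq [RHS]big_seq.
apply: eq_bigr => e /h /andP[e1 e2]; rewrite /edge_weight !al // !addbT.
by case: (s _) (s _) => [] [].
Qed.

Definition pair_sum el gl l x y a b : R :=
  sumc l (weight el gl) (upd (upd (fun=> false) x a) y b).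

Definition triple_sum el gl l x y z a b c : R :=
  sumc l (weight el gl) (upd (upd (upd (fun=> false) x a) y b) z c).

Lemma pair_sum_gt0 el gl l x y a b : ferromagnetic el -> pos_fields gl ->
  0 < pair_sum el gl l x y a b.
Proof. by move=> h hg; apply: sumc_gt0 => s; exact: weight_gt0. Qed.

Lemma triple_sum_gt0 el gl l x y z a b c : ferromagnetic el -> pos_fields gl ->
  0 < triple_sum el gl l x y z a b c.
Proof. by move=> h hg; apply: sumc_gt0 => s; exact: weight_gt0. Qed.

Lemma sumc_flip el l l' s : edges_in l' el -> {subset l <= l'} ->
  sumc l (weight el [::]) (fun z => s z (+) (z \in l')) = sumc l (weight el [::]) s.
Proof.
move=> h sub; rewrite -sumc_addb; apply: eq_sumc => t _.
by rewrite /weight (edges_weight_addb _ h) // /fields_weight !big_nil.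
Qed.

Lemma pair_sum_flip el l x y a b : edges_in [:: x, y & l] el ->
  pair_sum el [::] l x y (~~ a) (~~ b) = pair_sum el [::] l x y a b.
Proof.
move=> h; rewrite /pair_sum -[RHS](sumc_flip _ h) => [|z zl]; last by rewrite !inE zl !orbT.
apply: sumc_agree => z zl; rewrite /upd !inE (negbTE zl) orbF.
by case: (z == y); rewrite ?orbT ?addbT //; case: (z == x); rewrite ?orbT ?addbT.
Qed.

Lemma triple_sum_flip el l x y z a b c : edges_in [:: x, y, z & l] el ->
  triple_sum el [::] l x y z (~~ a) (~~ b) (~~ c) = triple_sum el [::] l x y z a b c.
Proof.
move=> h; rewrite /triple_sum -[RHS](sumc_flip _ h) => [|w wl]; last by rewrite !inE wl !orbT.
apply: sumc_agree => w wl; rewrite /upd !inE (negbTE wl) orbF.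
case: (w == z); rewrite ?orbT ?addbT //; case: (w == y); rewrite ?orbT ?addbT //.
by case: (w == x); rewrite ?orbT ?addbT.
Qed.

Lemma triple_sum_lattice el gl l x y z a b c a' b' c' :
  ferromagnetic el -> pos_fields gl ->
  triple_sum el gl l x y z a b c * triple_sum el gl l x y z a' b' c' <=
  triple_sum el gl l x y z (a || a') (b || b') (c || c') *
  triple_sum el gl l x y z (a && a') (b && b') (c && c').
Proof.
move=> h hg; have w0 s : 0 <= weight el gl s by rewrite ltW // weight_gt0.
apply: le_trans (four_functions _ _ _ w0 w0 w0 w0 (weight_lattice h hg)) _.
by rewrite !jn_upd !mt_upd.
Qed.

Lemma pair_sum_lattice el gl l x y a b a' b' :
  ferromagnetic el -> pos_fields gl ->
  pair_sum el gl l x y a b * pair_sum el gl l x y a' b' <=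
  pair_sum el gl l x y (a || a') (b || b') * pair_sum el gl l x y (a && a') (b && b').
Proof.
move=> h hg; have w0 s : 0 <= weight el gl s by rewrite ltW // weight_gt0.
apply: le_trans (four_functions _ _ _ w0 w0 w0 w0 (weight_lattice h hg)) _.
by rewrite !jn_upd !mt_upd.
Qed.

(* Identifying the vertex y with x amounts to conditioning on equal spins. *)
Lemma pair_sum_contract_second el gl l x y z a b :
  x != y -> x != z -> y != z -> x \notin l -> y \notin l -> z \notin l ->
  let f w := if w == z then y else w in
  pair_sum (map_edges f el) (map_fields f gl) l x y a b = triple_sum el gl l x y z a b b.
Proof.
move=> xy xz yz xl yl zl f; rewrite /pair_sum /triple_sum.
under eq_sumc do rewrite weight_map.
rewrite (sumc_substitute (weight el gl) _ (f := fun s w => s (f w))).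
  congr (sumc l _ _); apply/funext => w; rewrite /upd /f.
  by case: (eqVneq w z) => [_|//]; rewrite eqxx.
move=> t w c wl; apply/funext => u; rewrite /upd /f.
case: (eqVneq u z) => [->|//].
have yw : y == w = false by apply/negbTE/eqP => yw; rewrite yw wl in yl.
have zw : z == w = false by apply/negbTE/eqP => zw; rewrite zw wl in zl.
by rewrite yw zw.
Qed.

Lemma pair_sum_contract_first el gl l x y z a b :
  x != y -> x != z -> y != z -> x \notin l -> y \notin l -> z \notin l ->
  let f w := if w == y then x else w in
  pair_sum (map_edges f el) (map_fields f gl) l x z a b = triple_sum el gl l x y z a a b.
Proof.
move=> xy xz yz xl yl zl f; rewrite /pair_sum /triple_sum.
under eq_sumc do rewrite weight_map.
rewrite (sumc_substitute (weight el gl) _ (f := fun s w => s (f w))).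
  congr (sumc l _ _); apply/funext => w; rewrite /upd /f.
  have [wy|wy] := eqVneq w y; last by [].
  by rewrite (negbTE xz) eqxx wy (negbTE yz).
move=> t w c wl; apply/funext => u; rewrite /upd /f.
case: (eqVneq u y) => [->|//].
have yw : y == w = false by apply/negbTE/eqP => yw; rewrite yw wl in yl.
have xw : x == w = false by apply/negbTE/eqP => xw; rewrite xw wl in xl.
by rewrite yw xw.
Qed.

Lemma edges_in_contract el l (y z : T) : edges_in (z :: l) el -> y \in l ->
  edges_in l (map_edges (fun w => if w == z then y else w) el).
Proof.
move=> /allP h yl; apply/allP => _ /mapP[e /h /andP[e1 e2] ->] /=.
move: e1 e2; rewrite !inE.
by case: (eqVneq e.1.1 z) => _ /=; case: (eqVneq e.1.2 z) => _ /= *; apply/andP.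
Qed.

Lemma ferromagnetic_map el f : ferromagnetic el -> ferromagnetic (map_edges f el).
Proof. by rewrite /ferromagnetic all_map. Qed.

Lemma pos_fields_map gl f : pos_fields gl -> pos_fields (map_fields f gl).
Proof. by rewrite /pos_fields all_map. Qed.

Lemma edges_in_sub l l' el : {subset l <= l'} -> edges_in l el -> edges_in l' el.
Proof. by move=> sub; apply: sub_all => e /andP[/sub -> /sub ->]. Qed.

Lemma pair_sum_perm el el' gl l l' x y a b : perm_eq el el' -> perm_eq l l' ->
  pair_sum el gl l x y a b = pair_sum el' gl l' x y a b.
Proof.
move=> p p'; rewrite /pair_sum (sumc_perm _ _ p').
by apply: eq_sumc => t _; exact: weight_perm.
Qed.

End EdgeWeights.

(** Loops at [y] are allowed, since contraction produces them and their weight is constant. *)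
Definition no_edge_at (R : realFieldType) (T : eqType) (el : seq (T * T * R)) y :=
  all (fun e : T * T * R => (e.1.1 == y) == (e.1.2 == y)) el.

(** The spin at [y] meets nothing but its own fields, so the sum is a product of a function of [b]
    and a function of [a]; its cross ratio is then 1. *)
Lemma pair_sum_no_edge (R : realFieldType) (T : eqType) (el : seq (T * T * R)) gl l x y a b :
  no_edge_at el y -> x != y -> y \notin l ->
  pair_sum el gl l x y a b =
  fields_weight gl (fun z => (z == y) && b) *
    sumc l (fun s => edges_weight el s * fields_weight gl (fun z => (z != y) && s z))
         (upd (fun=> false) x a).
Proof.
move=> /allP h xy yl; rewrite /pair_sum.
rewrite -(@sumc_substitute _ _ _ _ _ (fun s => upd s y b)); last first.
  move=> t z c zl; rewrite updC //; apply/eqP => zy; by rewrite -zy zl in yl.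
rewrite -sumcZ; apply: eq_sumc => t _; rewrite /weight mulrCA; congr (_ * _).
  rewrite /edges_weight [LHS]big_seq [RHS]big_seq; apply: eq_bigr => e /h.
  rewrite /edge_weight /upd.
  by case: (eqVneq e.1.1 y) => [->|_] /=; case: (eqVneq e.1.2 y) => [->|_] //=; rewrite ?eqxx.
rewrite /fields_weight -big_split; apply: eq_bigr => f _ /=.
rewrite /field_weight /upd; case: (eqVneq f.1 y) => _ /=; rewrite ?mulr1 ?mul1r //.
Qed.

(* Ding, Song and Sun: the coupling between two spins that results from integrating out
   the other spins is largest in the absence of fields. *)
Theorem cross_ratio_le (R : rcfType) (T : eqType) (el : seq (T * T * R)) gl l x y :
  ferromagnetic el -> pos_fields gl -> uniq [:: x, y & l] -> edges_in [:: x, y & l] el ->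
  pair_sum el gl l x y true true * pair_sum el gl l x y false false *
    pair_sum el [::] l x y true false ^+ 2 <=
  pair_sum el [::] l x y true true ^+ 2 *
    (pair_sum el gl l x y true false * pair_sum el gl l x y false true).
Proof.
move En : (size el) => n; elim: n el gl l x y En => [|n IH] el gl l x y En h hg un ein.
all: have [noe|] := boolP (no_edge_at el y).
1,3: move: un => /= /andP[xyl /andP[yl _]];
  have xy : x != y by move: xyl; rewrite inE negb_or => /andP[].
1,2: by rewrite !(pair_sum_no_edge _ _ _ noe xy yl) /fields_weight !big_nil !mul1r; apply: eq_ler; ring.
  by move/size0nil: En => ->.
move=> /allPn[e eel ey].
pose z := if e.1.1 == y then e.1.2 else e.1.1.
have zy : z != y by move: ey; rewrite /z; case: (eqVneq e.1.1 y).
have eE s : edge_weight e s = if s y == s z then 1 else e.2.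
  move: ey; rewrite /edge_weight /z; case: (eqVneq e.1.1 y) => [->//|_].
  by case: (eqVneq e.1.2 y) => [-> _|//]; rewrite [s y == _]eq_sym.
have /andP[t0 t1] := allP h _ eel.
have zin : z \in [:: x, y & l].
  by have /andP[] := allP ein _ eel; rewrite /z; case: ifP.
pose el' := rem e el; have pel : perm_eq el (e :: el') by exact: perm_to_rem.
have sel : size el' = n by rewrite size_rem // En.
have h' : ferromagnetic el' by apply/allP => f /mem_rem; exact: allP h f.
have ein' : edges_in [:: x, y & l] el' by apply/allP => f /mem_rem; exact: allP ein f.
(* An edge joining [x] and [y] puts the same power of its cost on both sides. *)
have [zx|zx] := eqVneq z x.
  have cE gl' a b : pair_sum el gl' l x y a b =
      (if a == b then 1 else e.2) * pair_sum el' gl' l x y a b.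
    rewrite (pair_sum_perm _ _ _ _ _ pel (perm_refl l)) /pair_sum -sumcZ.
    apply: eq_sumc => s sl; rewrite weight_cons eE zx; congr (_ * _).
    move: un => /= /andP[xyl /andP[yl _]].
    move: (xyl); rewrite inE negb_or => /andP[xy xl].
    by rewrite !sl // updxx /upd (negbTE xy) eqxx eq_sym.
  rewrite !cE /= !mul1r.
  have -> : pair_sum el' gl l x y true true * pair_sum el' gl l x y false false *
     (e.2 * pair_sum el' [::] l x y true false) ^+ 2 =
     e.2 ^+ 2 * (pair_sum el' gl l x y true true * pair_sum el' gl l x y false false *
       pair_sum el' [::] l x y true false ^+ 2) by ring.
  have -> : pair_sum el' [::] l x y true true ^+ 2 *
     (e.2 * pair_sum el' gl l x y true false * (e.2 * pair_sum el' gl l x y false true)) =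
     e.2 ^+ 2 * (pair_sum el' [::] l x y true true ^+ 2 *
       (pair_sum el' gl l x y true false * pair_sum el' gl l x y false true)) by ring.
  by apply: ler_wpM2l; [exact: sqr_ge0 | exact: IH].
have zl : z \in l by move: zin; rewrite !inE (negbTE zx) (negbTE zy).
pose l' := rem z l; have pl : perm_eq l (z :: l') by exact: perm_to_rem.
have pxyl : perm_eq [:: x, y & l] [:: x, y, z & l'] by rewrite !perm_cons.
have un' : uniq [:: x, y, z & l'] by rewrite -(perm_uniq pxyl).
have ein3 : edges_in [:: x, y, z & l'] el'.
  by apply: edges_in_sub ein' => w; rewrite (perm_mem pxyl).
move: (un') => /= /and4P[]; rewrite !inE !negb_or => /and3P[xy xz xl'] /andP[yz yl'] zl' ul'.
pose A gl' a b c := triple_sum el' gl' l' x y z a b c.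
have cE gl' a b : pair_sum el gl' l x y a b =
   (if b then 1 else e.2) * A gl' a b true + (if b then e.2 else 1) * A gl' a b false.
  rewrite (pair_sum_perm _ _ _ _ _ pel pl) /pair_sum /= /A /triple_sum -!sumcZ.
  by congr (_ + _); apply: eq_sumc => s sl; rewrite weight_cons eE !sl // updxx /upd
    (negbTE yz) eqxx; case: b {sl}.
have cE' gl' a b : pair_sum el' gl' l x y a b = A gl' a b true + A gl' a b false.
  by rewrite (pair_sum_perm _ _ _ _ _ (perm_refl el') pl).
have A0 gl' a b c : pos_fields gl' -> 0 < A gl' a b c by move=> hg'; exact: triple_sum_gt0.
have Af a b c : A [::] (~~ a) (~~ b) (~~ c) = A [::] a b c by exact: triple_sum_flip.
have Al gl' a b c a' b' c' : pos_fields gl' -> A gl' a b c * A gl' a' b' c' <=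
    A gl' (a || a') (b || b') (c || c') * A gl' (a && a') (b && b') (c && c').
  by move=> hg'; exact: triple_sum_lattice.
rewrite !cE !mul1r [_ * A [::] true false true + _]addrC.
(* The third spin [z] has been made explicit. Induction is used three times: with the edge removed
   and an arbitrary field at [z], with [z] identified with [y], and with [y] identified with [x]. *)
have := @edge_step R (A gl true true true) (A gl true true false)
  (A gl false false true) (A gl false false false)
  (A gl true false true) (A gl true false false)
  (A gl false true true) (A gl false true false)
  (A [::] true true true) (A [::] true true false) (A [::] true false true)
  (A [::] true false false) e.2.
apply; rewrite ?A0 ?t0 //.
- move=> w w0.
  (* A weight [w^-1] on the plus spin at [z] is the tilt by [w] in [edge_step], up to a factor
     [w^-1] common to both sides. *)
  have hw : pos_fields ((z, w^-1) :: gl) by rewrite /= invr_gt0 w0.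
  have Aw a b c : A ((z, w^-1) :: gl) a b c = (if c then w^-1 else 1) * A gl a b c.
    rewrite /A /triple_sum -sumcZ; apply: eq_sumc => s sl.
    by rewrite weight_cons_field /field_weight /= !sl // updxx.
  have := IH el' _ l x y sel h' hw un ein'; rewrite !cE' !Aw !mul1r => hle.
  rewrite -(ler_pM2l (_ : 0 < w^-1)) ?invr_gt0 //.
  have nw := gt_eqF w0.
  apply: le_trans (le_trans _ hle) _; apply: eq_ler;
    field; by rewrite nw.
- have := IH _ (map_fields (fun w => if w == z then y else w) gl) l' x y _ _ _ _ _.
  have := @pair_sum_contract_second R T el' gl l' x y z _ _ xy xz yz xl' yl' zl'.
  have := @pair_sum_contract_second R T el' [::] l' x y z _ _ xy xz yz xl' yl' zl'.
  move=> /= e0 e1 /(_ (map_edges (fun w => if w == z then y else w) el')).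
  rewrite size_map sel => /(_ erefl (ferromagnetic_map _ h') (pos_fields_map _ hg)).
  rewrite !e0 !e1 -/(A _ _ _ _) -!/(A [::] _ _ _) -!/(A gl _ _ _); apply.
    by rewrite /= !inE !negb_or xy xl' yl' ul'.
  apply: edges_in_contract; last by rewrite !inE eqxx orbT.
  by apply: edges_in_sub ein3 => w; rewrite !inE => /or4P[] ->; rewrite ?orbT.
- have := IH _ (map_fields (fun w => if w == y then x else w) gl) l' x z _ _ _ _ _.
  have := @pair_sum_contract_first R T el' gl l' x y z _ _ xy xz yz xl' yl' zl'.
  have := @pair_sum_contract_first R T el' [::] l' x y z _ _ xy xz yz xl' yl' zl'.
  move=> /= e0 e1 /(_ (map_edges (fun w => if w == y then x else w) el')).
  rewrite size_map sel => /(_ erefl (ferromagnetic_map _ h') (pos_fields_map _ hg)).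
  rewrite !e0 !e1 -!/(A [::] _ _ _) -!/(A gl _ _ _); apply.
    by rewrite /= !inE !negb_or xz xl' zl' ul'.
  apply: edges_in_contract; last by rewrite !inE eqxx.
  by apply: edges_in_sub ein3 => w; rewrite !inE => /or4P[] ->; rewrite ?orbT.
- exact: Al.
- by rewrite (le_trans (Al _ _ _ _ _ _ _ hg)).
- by rewrite (le_trans (Al _ _ _ _ _ _ _ hg)) // mulrC.
(* The field-free sums are invariant under a global flip, which brings this inequality into lattice
   form. *)
- rewrite -(Af true false false) -(Af true false true).
  exact: (Al [::] true true false false true true isT).
Qed.

(** * Conditional means and the influence of a field *)

Section Mean.
Variables (R : realFieldType) (T : eqType).
Implicit Types (s t : T -> bool) (l : seq T) (W F G : (T -> bool) -> R).

(** The conditional expectation under the weight [W] given the spins of [s] off [l]; as a function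
    of [s] it can be averaged again. *)
Definition mean l W F s : R := sumc l (fun t => W t * F t) s / sumc l W s.

Lemma mean_agree l W F s t : agree_off l s t -> mean l W F t = mean l W F s.
Proof. by move=> st; rewrite /mean !(sumc_agree _ st). Qed.

Lemma eq_mean l W F G s : (forall t, agree_off l s t -> F t = G t) ->
  mean l W F s = mean l W G s.
Proof. by move=> h; rewrite /mean (eq_sumc (fun t st => congr1 _ (h t st))). Qed.

Lemma mean_perm l1 l2 W F s : perm_eq l1 l2 -> mean l1 W F s = mean l2 W F s.
Proof. by move=> p; rewrite /mean !(sumc_perm _ _ p). Qed.

Lemma eq_mean_weight l W W' F s c : c != 0 ->
  (forall t, agree_off l s t -> W t = c * W' t) -> mean l W F s = mean l W' F s.
Proof.
move=> c0 h; rewrite /mean (eq_sumc h) sumcZ.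
rewrite (@eq_sumc _ _ _ _ (fun t => c * (W' t * F t))); last by move=> t /h ->; rewrite mulrA.
by rewrite sumcZ invfM mulrACA mulfV // mul1r.
Qed.

Section Positive.
Variable W : (T -> bool) -> R.
Hypothesis W0 : forall t, 0 < W t.

Let S0 l s : 0 < sumc l W s := sumc_gt0 l s W0.

Lemma ler_mean l F G s : (forall t, agree_off l s t -> F t <= G t) ->
  mean l W F s <= mean l W G s.
Proof.
move=> h; rewrite /mean ler_pM2r ?invr_gt0 //; apply: ler_sumc => t st.
by rewrite ler_pM2l // h.
Qed.

Lemma mean_ge0 l F s : (forall t, 0 <= F t) -> 0 <= mean l W F s.
Proof.
by move=> h; rewrite divr_ge0 ?(ltW (S0 _ _)) // sumc_ge0 // => t; rewrite mulr_ge0 // ltW.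
Qed.

Lemma mean_cst l c s : mean l W (fun=> c) s = c.
Proof. by rewrite /mean sumcZr mulrAC mulfV ?mul1r // gt_eqF. Qed.

Lemma meanZ l c F s : mean l W (fun t => c * F t) s = c * mean l W F s.
Proof.
rewrite /mean (@eq_sumc _ _ _ _ (fun t => c * (W t * F t))) ?sumcZ ?mulrA //.
by move=> t _; rewrite mulrCA.
Qed.

Lemma meanD l F G s : mean l W (fun t => F t + G t) s = mean l W F s + mean l W G s.
Proof.
rewrite /mean -mulrDl -sumcD; congr (_ / _).
by apply: eq_sumc => t _; rewrite mulrDr.
Qed.

Lemma sumc_mean l F s : sumc l (fun t => W t * F t) s = sumc l W s * mean l W F s.
Proof. by rewrite /mean mulrC divfK // gt_eqF. Qed.

Lemma mean_cat l1 l2 F s :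
  mean (l1 ++ l2) W F s =
  sumc l1 (fun t => sumc l2 W t * mean l2 W F t) s / sumc (l1 ++ l2) W s.
Proof.
rewrite /mean !sumc_cat; congr (_ / _); apply: eq_sumc => t _.
by rewrite -sumc_mean.
Qed.

Lemma mean_tower l1 l2 F s :
  mean (l1 ++ l2) W F s = mean (l1 ++ l2) W (fun t => mean l2 W F t) s.
Proof.
rewrite [RHS]mean_cat mean_cat; congr (_ / _); apply: eq_sumc => t _; congr (_ * _).
rewrite -[LHS](mean_cst l2 _ t); apply: eq_mean => u tu.
by rewrite (mean_agree _ _ tu).
Qed.

Lemma mean_cons x l F s :
  mean (x :: l) W F s =
  (sumc l W (upd s x true) * mean l W F (upd s x true) +
   sumc l W (upd s x false) * mean l W F (upd s x false)) / sumc (x :: l) W s.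
Proof. by rewrite -cat1s mean_cat. Qed.

(** Both sides average values of the inner mean, and any two of these values differ by at most
    [d]. *)
Lemma mean_cat_dist l1 l2 F s s' d l :
  {subset l1 <= l} -> {subset l2 <= l} -> agree_off l s s' ->
  (forall t t', agree_off l s t -> agree_off l s t' -> mean l2 W F t - mean l2 W F t' <= d) ->
  mean (l1 ++ l2) W F s - mean (l1 ++ l2) W F s' <= d.
Proof.
move=> sub1 sub2 ss' h.
have sub : {subset l1 ++ l2 <= l} by move=> x; rewrite mem_cat => /orP[/sub1|/sub2].
rewrite mean_tower [X in _ - X]mean_tower lerBlDr.
apply: le_trans (_ : mean (l1 ++ l2) W (fun=> d + mean (l1 ++ l2) W (mean l2 W F) s') s <= _).
  apply: ler_mean => t st; rewrite -lerBlDr.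
  rewrite -[X in X - _](mean_cst (l1 ++ l2) _ s').
  have -> : mean (l1 ++ l2) W (fun=> mean l2 W F t) s' - mean (l1 ++ l2) W (mean l2 W F) s' =
    mean (l1 ++ l2) W (fun t' => mean l2 W F t + (-1) * mean l2 W F t') s'.
    by rewrite meanD (meanZ _ (-1)) mulN1r.
  rewrite -[leRHS](mean_cst (l1 ++ l2) _ s'); apply: ler_mean => t' st'.
  rewrite mulN1r; apply: h; first exact: agree_offS st.
  by apply: agree_off_trans ss' _; exact: agree_offS st'.
by rewrite mean_cst.
Qed.

End Positive.
End Mean.

Section Influence.
Variables (R : rcfType) (T : eqType).
Implicit Types (s t : T -> bool) (el : seq (T * T * R)) (gl : seq (T * R)) (l : seq T).

Definition sgn (b : bool) : R := if b then 1 else -1.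

Definition correlation el l x y : R :=
  mean l (edges_weight el) (fun s => sgn (s x) * sgn (s y)) (fun=> false).

Lemma le_of_sqr (a b : R) : 0 <= a -> 0 <= b -> a ^+ 2 <= b ^+ 2 -> a <= b.
Proof. by move=> a0 b0; rewrite ler_pXn2r. Qed.

(** With [p ^+ 2 = a * d] and [q ^+ 2 = c * b], Cauchy-Schwarz gives
    [(p + q) ^+ 2 <= (a + b) * (c + d)]. What remains is [(p - q) / (p + q) <= (P - S) / (P + S)],
    that is [p / q <= P / S]. *)
Lemma odds_ratio_bound (a b c d P S : R) : 0 < a -> 0 < b -> 0 < c -> 0 < d ->
  0 < S -> S <= P -> a * d * S ^+ 2 <= P ^+ 2 * (c * b) ->
  (a * d - c * b) * (P + S) <= (P - S) * ((a + b) * (c + d)).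
Proof.
move=> a0 b0 c0 d0 S0 SP h.
pose p := Num.sqrt (a * d); pose q := Num.sqrt (c * b).
have p0 : 0 < p by rewrite sqrtr_gt0 mulr_gt0.
have q0 : 0 < q by rewrite sqrtr_gt0 mulr_gt0.
have pE : p ^+ 2 = a * d by rewrite sqr_sqrtr // mulr_ge0 // ltW.
have qE : q ^+ 2 = c * b by rewrite sqr_sqrtr // mulr_ge0 // ltW.
have P0 : 0 < P by apply: lt_le_trans SP.
have pq : p * S <= P * q.
  by apply: le_of_sqr; rewrite ?mulr_ge0 ?(ltW p0) ?(ltW q0) ?(ltW P0) ?(ltW S0) // !exprMn pE qE.
have hs : (p + q) ^+ 2 <= (a + b) * (c + d).
  have pq2 : 2 * (p * q) <= a * c + b * d.
    have [[[a1 b1] c1] d1] := (ltW a0, ltW b0, ltW c0, ltW d0).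
    apply: le_of_sqr; rewrite ?mulr_ge0 ?addr_ge0 ?mulr_ge0 ?(ltW p0) ?(ltW q0) //.
    have -> : (2 * (p * q)) ^+ 2 = 4 * (a * d * (c * b)) by rewrite -pE -qE; ring.
    rewrite -subr_ge0.
    have -> : (a * c + b * d) ^+ 2 - 4 * (a * d * (c * b)) = (a * c - b * d) ^+ 2 by ring.
    exact: sqr_ge0.
  have -> : (p + q) ^+ 2 = p ^+ 2 + q ^+ 2 + 2 * (p * q) by ring.
  by rewrite pE qE; lra.
rewrite -pE -qE; apply: le_trans (_ : (P - S) * (p + q) ^+ 2 <= _); last first.
  by apply: ler_wpM2l => //; rewrite subr_ge0.
have -> : (p ^+ 2 - q ^+ 2) * (P + S) = (p + q) * ((p - q) * (P + S)) by ring.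
have -> : (P - S) * (p + q) ^+ 2 = (p + q) * ((P - S) * (p + q)) by ring.
rewrite ler_pM2l ?addr_gt0 //; move: pq; set A := p * S; set B := P * q => pq.
have -> : (p - q) * (P + S) = p * P + A - B - q * S by rewrite /A /B; ring.
have -> : (P - S) * (p + q) = p * P + B - A - q * S by rewrite /A /B; ring.
lra.
Qed.

Definition fields_in l gl := all (fun f : T * R => f.1 \in l) gl.

Lemma weight_local el gl l s t : edges_in l el -> fields_in l gl ->
  (forall x, x \in l -> s x = t x) -> weight el gl s = weight el gl t.
Proof.
move=> /allP h /allP hg st; rewrite /weight /edges_weight /fields_weight; congr (_ * _).
  rewrite [LHS]big_seq [RHS]big_seq; apply: eq_bigr => e /h /andP[e1 e2].
  by rewrite /edge_weight !st.
rewrite [LHS]big_seq [RHS]big_seq; apply: eq_bigr => e /hg e1.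
by rewrite /field_weight !st.
Qed.

Lemma sumc_local l F s t :
  (forall s t, (forall x, x \in l -> s x = t x) -> F s = F t) -> sumc l F s = sumc l F t :> R.
Proof.
move=> h; pose f (u : T -> bool) x := if x \in l then u x else t x.
transitivity (sumc l (fun u => F (f u)) s).
  by apply: eq_sumc => u _; apply: h => x xl; rewrite /f xl.
rewrite sumc_substitute => [|u x b xl].
  by apply: sumc_agree => x xl; rewrite /f (negbTE xl).
by apply/funext => y; rewrite /f /upd; case: eqP => // ->; rewrite xl.
Qed.

Lemma pair_sums_correlation el l x y : uniq [:: x, y & l] -> edges_in [:: x, y & l] el ->
  ferromagnetic el ->
  correlation el [:: x, y & l] x y =
  (pair_sum el [::] l x y true true - pair_sum el [::] l x y true false) /
  (pair_sum el [::] l x y true true + pair_sum el [::] l x y true false).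
Proof.
move=> un ein h.
have nz a b : sumc l (edges_weight el) (upd (upd (fun=> false) x a) y b) =
   pair_sum el [::] l x y a b.
  by apply: eq_sumc => t _; rewrite /weight /fields_weight big_nil mulr1.
move: un => /= /andP[xyl /andP[yl _]].
move: (xyl); rewrite inE negb_or => /andP[xy xl].
have wz a b : sumc l (fun t => edges_weight el t * (sgn (t x) * sgn (t y)))
    (upd (upd (fun=> false) x a) y b) = pair_sum el [::] l x y a b * (sgn a * sgn b).
  rewrite -nz -sumcZr; apply: eq_sumc => t st.
  by rewrite !st // updxx /upd (negbTE xy) eqxx.
rewrite /correlation /mean /= !wz !nz /sgn.
rewrite -(pair_sum_flip true false ein) -(pair_sum_flip true true ein) /=.
set P := pair_sum _ _ _ _ _ false false; set S := pair_sum _ _ _ _ _ false true.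
have P0 : 0 < P by apply: pair_sum_gt0.
have S0 : 0 < S by apply: pair_sum_gt0.
have PS : P + S != 0 by rewrite gt_eqF // addr_gt0.
have PS' : P + S + (S + P) != 0 by rewrite gt_eqF // !addr_gt0.
by field; rewrite PS PS'.
Qed.

Lemma correlation_id el l x : ferromagnetic el -> correlation el l x x = 1.
Proof.
move=> h; rewrite /correlation -[RHS](@mean_cst _ _ (edges_weight el) _ l 1 (fun=> false)).
  by apply: eq_mean => t _; case: (t x); rewrite /sgn ?mulr1 // mulN1r opprK.
by move=> t; exact: edges_weight_gt0.
Qed.

(** The extreme change of the field at [u] amounts to conditioning on the spin there. By
    [cross_ratio_le] the resulting difference is at most the one without fields, which by flip
    symmetry is the correlation. *)
Lemma field_influence el gl l x u a a' s : uniq l -> edges_in l el -> fields_in l gl ->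
  ferromagnetic el -> pos_fields gl -> x \in l -> u \in l -> 0 < a -> 0 < a' ->
  mean l (weight el ((u, a) :: gl)) (fun t => (t x)%:R) s -
  mean l (weight el ((u, a') :: gl)) (fun t => (t x)%:R) s <= correlation el l x u.
Proof.
move=> ul ein fin h hg xl uil a0 a'0.
have hg' : pos_fields ((u, a) :: gl) by rewrite /= a0.
have hg'' : pos_fields ((u, a') :: gl) by rewrite /= a'0.
have [xu|xu] := eqVneq x u.
  rewrite xu correlation_id //; apply: le_trans (_ : 1 - 0 <= _); last by rewrite subr0.
  apply: lerB; last by apply: mean_ge0 => t; [exact: weight_gt0 | exact: ler0n].
  rewrite -[leRHS](@mean_cst _ _ (weight el ((u, a) :: gl)) _ l 1 s); last first.
    by move=> t; exact: weight_gt0.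
  by apply: ler_mean => t *; [exact: weight_gt0 | case: (t u)].
pose l' := rem u (rem x l).
have pl : perm_eq l [:: x, u & l'].
  apply: perm_trans (perm_to_rem xl) _; rewrite perm_cons; apply: perm_to_rem.
  by rewrite (mem_rem_uniq x ul) !inE eq_sym xu.
have un : uniq [:: x, u & l'] by rewrite -(perm_uniq pl).
have ein' : edges_in [:: x, u & l'] el.
  by apply: edges_in_sub ein => w; rewrite (perm_mem pl).
have -> : correlation el l x u = correlation el [:: x, u & l'] x u by exact: mean_perm.
rewrite pair_sums_correlation // !(mean_perm _ _ _ pl).
pose c b b' := pair_sum el gl l' x u b b'.
have c0 b b' : 0 < c b b' by apply: pair_sum_gt0.
have mE a1 : 0 < a1 -> mean [:: x, u & l'] (weight el ((u, a1) :: gl)) (fun t => (t x)%:R) s =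
   (a1 * c true true + c true false) /
   (a1 * (c true true + c false true) + (c true false + c false false)).
  move=> a10.
  have wl : forall s t, (forall y, y \in [:: x, u & l'] -> s y = t y) ->
     weight el ((u, a1) :: gl) s = weight el ((u, a1) :: gl) t.
    move=> s1 s2; apply: weight_local => //=; rewrite !inE eqxx orbT /=.
    by apply: sub_all fin => f; rewrite (perm_mem pl).
  rewrite /mean (sumc_local _ (fun=> false) wl).
  rewrite (@sumc_local _ _ s (fun=> false)); last first.
    by move=> s1 s2 h12; rewrite (wl _ _ h12) h12 // mem_head.
  move: un => /= /andP[xyl /andP[yl _]].
  move: (xyl); rewrite inE negb_or => /andP[xy xl'].
  have zE b b' : sumc l' (weight el ((u, a1) :: gl)) (upd (upd (fun=> false) x b) u b') =
     (if b' then a1 else 1) * c b b'.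
    rewrite -sumcZ; apply: eq_sumc => t st.
    by rewrite weight_cons_field /field_weight /= st // updxx.
  have nE b b' : sumc l' (fun t => weight el ((u, a1) :: gl) t * (t x)%:R)
     (upd (upd (fun=> false) x b) u b') = (if b' then a1 else 1) * c b b' * b%:R.
    rewrite -zE -sumcZr; apply: eq_sumc => t st.
    by rewrite !st // /upd (negbTE xy) eqxx.
  rewrite /= !zE !nE /= !mulr1 !mulr0 !mul1r !addr0; congr (_ / _); ring.
rewrite !mE //.
have DSS := @cross_ratio_le R T el gl l' x u h hg un ein'.
have lat := @pair_sum_lattice R T el gl l' x u true false false true h hg.
have lat0 := @pair_sum_lattice R T el [::] l' x u true false false true h isT.
move: DSS lat lat0; rewrite /= -!/(c _ _).
rewrite -(pair_sum_flip true false ein') -(pair_sum_flip true true ein') /=.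
set P := pair_sum _ _ _ _ _ false false; set S := pair_sum _ _ _ _ _ false true.
have P0 : 0 < P by apply: pair_sum_gt0.
have S0 : 0 < S by apply: pair_sum_gt0.
move=> DSS lat lat0.
have SP : S <= P.
  by apply: le_of_sqr; [exact: ltW | exact: ltW |].
have := odds_ratio_bound (c0 true true) (c0 false true) (c0 true false) (c0 false false) S0 SP DSS.
move: (c0 true true) (c0 false true) (c0 true false) (c0 false false) lat.
set p := c true true; set q := c false true; set r := c true false; set w := c false false.
move=> p0 q0 r0 w0 lat bound.
set al := p + q; set ga := r + w.
have al0 : 0 < al by rewrite addr_gt0.
have ga0 : 0 < ga by rewrite addr_gt0.
have d0 : 0 < a * al + ga by rewrite addr_gt0 // mulr_gt0.
have d0' : 0 < a' * al + ga by rewrite addr_gt0 // mulr_gt0.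
have -> : (a * p + r) / (a * al + ga) - (a' * p + r) / (a' * al + ga) =
   (p * w - r * q) * ((a - a') / ((a * al + ga) * (a' * al + ga))).
  by rewrite /al /ga; field; rewrite -/al -/ga !gt_eqF.
(* The value in the limit [a -> +oo], [a' -> 0]. *)
apply: le_trans (_ : (p * w - r * q) * (al * ga)^-1 <= _).
  apply: ler_wpM2l; first by rewrite subr_ge0.
  rewrite ler_pdivrMr ?mulr_gt0 // mulrC ler_pdivlMr ?mulr_gt0 //.
  rewrite -subr_ge0.
  have -> : (a * al + ga) * (a' * al + ga) - (a - a') * (al * ga) =
     a * a' * al ^+ 2 + 2 * a' * al * ga + ga ^+ 2 by ring.
  by rewrite !addr_ge0 ?mulr_ge0 ?sqr_ge0 // ltW.
rewrite ler_pdivrMr ?mulr_gt0 // mulrAC ler_pdivlMr ?addr_gt0 //.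
Qed.

End Influence.

(** * Recoupling one spin *)

(** On the left the two samples share a spin with law [p1], [p0]; on the right each has its own. The
    densities [m], [n] of the far configurations are constant up to [k] each, which costs [k ^+ 2]
    in either direction; with constant densities the claim is [F11 + F00 <= F10 + F01] times
    [p1 * p0]. *)
Lemma decoupling_inequality (R : realFieldType) (k p1 p0 m1 m0 n1 n0 F11 F10 F01 F00 : R) :
  0 <= p1 -> 0 <= p0 -> p1 + p0 = 1 -> 0 < m0 -> 0 < n0 -> 0 <= m1 -> 0 <= n1 -> 1 <= k ->
  m1 <= k * m0 -> m0 <= k * m1 -> n1 <= k * n0 -> n0 <= k * n1 ->
  0 <= F11 -> 0 <= F10 -> 0 <= F01 -> 0 <= F00 -> F11 + F00 <= F10 + F01 ->
  p1 * (m1 * n1 * F11) + p0 * (m0 * n0 * F00) <=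
  k ^+ 4 * (p1 * p1 * (m1 * n1 * F11) + p1 * p0 * (m1 * n0 * F10) +
            p0 * p1 * (m0 * n1 * F01) + p0 * p0 * (m0 * n0 * F00)).
Proof.
move=> p10 p00 ps m0p n0p m10 n10 k1 hm1 hm0 hn1 hn0 f11 f10 f01 f00 hF.
have k0 : 0 <= k by lra.
have [c cE] : exists c, c = m0 * n0 by exists (m0 * n0).
have c0 : 0 < c by rewrite cE mulr_gt0.
have km : m0 <= k * m0 by rewrite ler_peMl // ltW.
have kn : n0 <= k * n0 by rewrite ler_peMl // ltW.
have kk0 : 0 <= k * m0 by lra.
have up m n : 0 <= m -> 0 <= n -> m <= k * m0 -> n <= k * n0 -> m * n <= k ^+ 2 * c.
  move=> m' n' hm hn; have -> : k ^+ 2 * c = (k * m0) * (k * n0) by rewrite cE; ring.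
  exact: ler_pM.
have dn m n : m0 <= k * m -> n0 <= k * n -> c <= k ^+ 2 * (m * n).
  move=> hm hn; have -> : k ^+ 2 * (m * n) = (k * m) * (k * n) by ring.
  rewrite cE.
  by apply: ler_pM => //; exact: ltW.
have mid : p1 * F11 + p0 * F00 <=
    p1 * p1 * F11 + p1 * p0 * F10 + p0 * p1 * F01 + p0 * p0 * F00.
  have -> : p1 * F11 + p0 * F00 = p1 * (p1 + p0) * F11 + p0 * (p1 + p0) * F00.
    by rewrite ps !mulr1.
  have : 0 <= (p1 * p0) * (F10 + F01 - (F11 + F00)) by rewrite !mulr_ge0 // subr_ge0.
  move=> q; rewrite -subr_ge0; apply: le_trans q _; apply: eq_ler; ring.
have A : p1 * (m1 * n1 * F11) + p0 * (m0 * n0 * F00) <= k ^+ 2 * c * (p1 * F11 + p0 * F00).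
  rewrite mulrDr; apply: lerD; rewrite mulrCA; apply: ler_wpM2r; rewrite ?mulr_ge0 //;
    by apply: up => //; exact: ltW.
apply: le_trans A _; apply: le_trans (ler_wpM2l _ mid) _; first by rewrite mulr_ge0 ?exprn_ge0 // ltW.
have -> : k ^+ 4 = k ^+ 2 * k ^+ 2 by rewrite -exprD.
have k20 : 0 <= k ^+ 2 by rewrite exprn_ge0.
move: k20 dn; move: (k ^+ 2) => q q0 dn; rewrite -!mulrA; apply: (ler_wpM2l q0).
have term p p' m n F : 0 <= p -> 0 <= p' -> 0 <= F -> m0 <= k * m -> n0 <= k * n ->
    c * (p * (p' * F)) <= q * (p * (p' * (m * (n * F)))).
  move=> hp hp' hF' hm hn.
  have -> : q * (p * (p' * (m * (n * F)))) = q * (m * n) * (p * (p' * F)) by ring.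
  by apply: ler_wpM2r; [rewrite !mulr_ge0 | exact: dn].
rewrite !mulrDr.
by apply: lerD; [apply: lerD; [apply: lerD|]|]; apply: term.
Qed.

(** Adding [dl] to a probability that is at least [p0] multiplies it by at most [1 + dl / p0]; this
    is used for one value of the spin in one law and for the other value in the other law, whence
    the square. *)
Lemma odds_close (R : realFieldType) (p0 dl m1 m0 n1 n0 : R) :
  0 < p0 -> 0 <= dl -> 0 < m1 -> 0 < m0 -> 0 < n1 -> 0 < n0 ->
  p0 <= n1 / (n1 + n0) -> p0 <= m0 / (m1 + m0) ->
  m1 / (m1 + m0) - n1 / (n1 + n0) <= dl ->
  m1 * n0 <= (1 + dl / p0) ^+ 2 * (n1 * m0).
Proof.
move=> p00 dl0 m10 m00 n10 n00.
have ms : 0 < m1 + m0 by rewrite addr_gt0.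
have ns : 0 < n1 + n0 by rewrite addr_gt0.
set a := m1 / _; set b := n1 / _; set a' := m0 / _ => hb ha' hab.
pose b' := n0 / (n1 + n0).
have aa' : a + a' = 1 by rewrite /a /a' -mulrDl mulfV // gt_eqF.
have bb' : b + b' = 1 by rewrite /b /b' -mulrDl mulfV // gt_eqF.
have a0 : 0 < a by rewrite divr_gt0.
have b'0 : 0 < b' by rewrite divr_gt0.
have grow y : p0 <= y -> y + dl <= (1 + dl / p0) * y.
  move=> hy; rewrite mulrDl mul1r lerD2l mulrAC ler_pdivlMr //; exact: ler_wpM2l.
have key : a * b' <= (1 + dl / p0) ^+ 2 * (b * a').
  have -> : (1 + dl / p0) ^+ 2 * (b * a') = ((1 + dl / p0) * b) * ((1 + dl / p0) * a') by ring.
  apply: ler_pM; rewrite ?(ltW a0) ?(ltW b'0) //.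
    by apply: le_trans (grow _ hb); lra.
  by apply: le_trans (grow _ ha'); lra.
have e1 : m1 * n0 = (a * b') * ((m1 + m0) * (n1 + n0)).
  by rewrite /a /b'; field; rewrite !gt_eqF.
have e2 : n1 * m0 = (b * a') * ((m1 + m0) * (n1 + n0)).
  by rewrite /b /a'; field; rewrite !gt_eqF.
by rewrite e1 e2 [leRHS]mulrA; apply: ler_wpM2r => //; rewrite mulr_ge0 // ltW.
Qed.

Section Step.
Variables (R : realFieldType) (T : eqType) (W : (T -> bool) -> R).
Implicit Types (s t u v : T -> bool) (l : seq T) (F U V : (T -> bool) -> R).
Hypotheses (W0 : forall t, 0 < W t) (W_lat : lattice_weight W).

Lemma mean_isotone l F s t : (forall u, 0 <= F u) -> isotone F -> le_conf s t ->
  mean l W F s <= mean l W F t.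
Proof.
move=> F0 iF st; have S u := sumc_gt0 l u W0.
rewrite /mean ler_pdivrMr // mulrAC ler_pdivlMr //.
by apply: fkg_boundary => // u; exact: ltW.
Qed.

Variable G : (T -> bool) -> (T -> bool) -> R.

(** Two samples on [l], independent given the outside configurations [s] and [t]. Taking [s = t]
    expresses that the spins off [l] are shared. *)
Definition pair_mean l s t : R := mean l W (fun u => mean l W (G u) t) s.

Definition pair_total l s t : R := sumc l (fun u => sumc l (fun v => W u * W v * G u v) t) s.

Lemma pair_meanE l s t : pair_mean l s t = pair_total l s t / (sumc l W s * sumc l W t).
Proof.
rewrite /pair_mean {1}/mean invfM mulrA mulrAC; congr (_ / _).
rewrite -sumcZr; apply: eq_sumc => u _; rewrite /mean mulrA; congr (_ / _).
by rewrite -sumcZ; apply: eq_sumc => v _; rewrite mulrA.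
Qed.

Lemma pair_mean_agree l s s' t t' : agree_off l s s' -> agree_off l t t' ->
  pair_mean l s' t' = pair_mean l s t.
Proof.
move=> ss' tt'; rewrite /pair_mean (mean_agree _ _ ss').
by apply: eq_mean => u _; exact: mean_agree.
Qed.

Lemma mean_id l F s : (forall t, agree_off l s t -> F t = F s) -> mean l W F s = F s.
Proof. by move=> h; rewrite (eq_mean W h) mean_cst. Qed.

Lemma pair_total_perm l l' s t : perm_eq l l' -> pair_total l s t = pair_total l' s t.
Proof.
move=> p; rewrite /pair_total (sumc_perm _ _ p); apply: eq_sumc => u _; exact: sumc_perm.
Qed.

Lemma sumc_upd_out l F x b s : x \notin l -> sumc l F (upd s x b) = sumc l (fun u => F (upd u x b)) s.
Proof.
move=> xl; rewrite (@sumc_substitute _ _ l F s (fun u => upd u x b)) // => t y c yl.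
by apply: updC; apply: contraNneq xl => <-.
Qed.

Lemma pair_total_ge0 l s t : (forall u v, 0 <= G u v) -> 0 <= pair_total l s t.
Proof.
move=> G0; apply: sumc_ge0 => u; apply: sumc_ge0 => v; rewrite mulr_ge0 ?G0 //.
by rewrite mulr_ge0 // ltW.
Qed.

Lemma mean_pair_mean_cons l x s : mean (x :: l) W (fun t => pair_mean l t t) s =
  (pair_total l (upd s x true) (upd s x true) / sumc l W (upd s x true) +
   pair_total l (upd s x false) (upd s x false) / sumc l W (upd s x false)) / sumc (x :: l) W s.
Proof.
have Z_gt0 b : 0 < sumc l W (upd s x b) by exact: sumc_gt0.
rewrite mean_cons // !(@mean_id l) /= => [|t st|t st]; try exact: pair_mean_agree.
by rewrite !pair_meanE; congr (_ / _); field; rewrite !gt_eqF.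
Qed.

Lemma pair_total_cons l x s : pair_total (x :: l) s s =
  pair_total l (upd s x true) (upd s x true) + pair_total l (upd s x true) (upd s x false) +
  pair_total l (upd s x false) (upd s x true) + pair_total l (upd s x false) (upd s x false).
Proof. by rewrite /pair_total /= !sumcD; ring. Qed.

(** Among the four pairs of independent spins at [x], the two equal ones already account for the
    shared spin, up to the inverse of the smallest probability of a value. This serves for [r <= 0],
    where the finer step has no content. *)
Lemma coupling_step_crude l x s p : (forall u v, 0 <= G u v) -> 0 < p ->
  (forall b, p <= sumc l W (upd s x b) / sumc (x :: l) W s) ->
  mean (x :: l) W (fun t => pair_mean l t t) s <= p^-1 * pair_mean (x :: l) s s.
Proof.
move=> G0 p0 hp; rewrite mean_pair_mean_cons pair_meanE pair_total_cons.
have Z_gt0 b : 0 < sumc l W (upd s x b) by exact: sumc_gt0.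
have S0 : 0 < sumc (x :: l) W s by exact: sumc_gt0.
have T0 b c := @pair_total_ge0 l (upd s x b) (upd s x c) G0.
have one b : pair_total l (upd s x b) (upd s x b) / sumc l W (upd s x b) <=
    p^-1 * (pair_total l (upd s x b) (upd s x b) / sumc (x :: l) W s).
  rewrite mulrCA; apply: ler_wpM2l => //; rewrite -invfM lef_pV2 ?posrE ?mulr_gt0 //.
  by rewrite -ler_pdivlMr.
set Q := _ + _ + _ + _; set Z := sumc (x :: l) W s.
have -> : p^-1 * (Q / (Z * Z)) = p^-1 * (Q / Z) / Z by rewrite invfM !mulrA.
apply: ler_wpM2r; first by rewrite invr_ge0 ltW.
apply: le_trans (lerD (one true) (one false)) _; rewrite -mulrDr.
apply: ler_wpM2l; first by rewrite invr_ge0 ltW.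
rewrite -mulrDl; apply: ler_wpM2r; first by rewrite invr_ge0 ltW.
by rewrite /Q; have := T0 true false; have := T0 false true; lra.
Qed.

(* I carries the sites near x, K the other ones; u and v are configurations of K. *)
Variables (x : T) (I K : seq T) (s : T -> bool) (k : R).
Hypotheses (xK : x \notin K) (xI : x \notin I) (k1 : 1 <= k).
Hypothesis G01 : forall u v, 0 <= G u v.

Hypothesis factor : forall u v, agree_off K s u -> agree_off K s v ->
  exists U V, [/\ forall t, 0 <= U t <= 1, forall t, 0 <= V t <= 1,
    (isotone U /\ isotone V) \/ (isotone (fun t => 1 - U t) /\ isotone (fun t => 1 - V t)) &
    forall t t', agree_off (x :: I) u t -> agree_off (x :: I) v t' -> G t t' = 1 - U t * V t'].

Hypothesis odds : forall u v, agree_off K s u -> agree_off K s v ->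
  sumc I W (upd u x true) * sumc I W (upd v x false) <=
  k * (sumc I W (upd v x true) * sumc I W (upd u x false)).

Let m (b : bool) u := sumc I W (upd u x b).
Let Z (b : bool) := sumc (K ++ I) W (upd s x b).

Let ZE b : Z b = sumc K (m b) s.
Proof. by rewrite /Z sumc_cat sumc_upd_out. Qed.

Let m_gt0 b u : 0 < m b u. Proof. exact: sumc_gt0. Qed.
Let Z_gt0 b : 0 < Z b. Proof. exact: sumc_gt0. Qed.

(** The hypothesis [odds] averaged over the second far configuration. *)
Let m_le b u : agree_off K s u -> m b u * Z (~~ b) <= k * (m (~~ b) u * Z b).
Proof.
move=> su; rewrite !ZE -!sumcZ; case: b => /=; apply: ler_sumc => v sv.
  by rewrite [X in k * X]mulrC; exact: odds.
by rewrite mulrC [X in k * X]mulrC; have := odds sv su; rewrite [X in k * X]mulrC.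
Qed.

Let pair_totalE b c : pair_total (K ++ I) (upd s x b) (upd s x c) =
  sumc K (fun u => sumc K (fun v => pair_total I (upd u x b) (upd v x c)) s) s.
Proof.
rewrite /pair_total sumc_cat sumc_upd_out //; apply: eq_sumc => u _.
rewrite (@eq_sumc _ _ _ _ (fun t => sumc K (fun v => sumc I (fun t' => W t * W t' * G t t')
  (upd v x c)) s)); first by rewrite -sumc_exchange.
by move=> t _; rewrite sumc_cat sumc_upd_out.
Qed.

(** Given the far configurations, the conditional probability is [1 - a b * a' c], where [b] and [c]
    are the spins at [x]. The four-value condition of [decoupling_inequality] becomes [(a true - a
    false) * (a' true - a' false) >= 0], which holds because [U] and [V] are monotone in the same
    direction. *)
Let pointwise u v : agree_off K s u -> agree_off K s v ->
  (pair_total I (upd u x true) (upd v x true) / Z true +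
   pair_total I (upd u x false) (upd v x false) / Z false) * (Z true + Z false) <=
  k ^+ 4 * (pair_total I (upd u x true) (upd v x true) + pair_total I (upd u x true) (upd v x false) +
    pair_total I (upd u x false) (upd v x true) + pair_total I (upd u x false) (upd v x false)).
Proof.
move=> su sv; have [U [V [U01 V01 mono GE]]] := factor su sv.
pose a b := mean I W U (upd u x b); pose a' b := mean I W V (upd v x b).
pose Phi b c := pair_mean I (upd u x b) (upd v x c).
have tot b c : pair_total I (upd u x b) (upd v x c) = m b u * m c v * Phi b c.
  rewrite /Phi pair_meanE [RHS]mulrC divfK // gt_eqF //; apply: mulr_gt0; exact: m_gt0.
have PhiE b c : Phi b c = 1 - a b * a' c.
  rewrite /Phi /pair_mean (@eq_mean _ _ _ _ _ (fun t => 1 + (- a' c) * U t)).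
    by rewrite meanD // mean_cst // meanZ // mulNr mulrC.
  move=> t ut; rewrite (@eq_mean _ _ _ _ _ (fun t' => 1 + (- U t) * V t')).
    by rewrite meanD // mean_cst // meanZ // !mulNr mulrC.
  move=> t' vt'; rewrite (GE _ _ (agree_off_upd ut) (agree_off_upd vt')) mulNr //.
have Phi0 b c : 0 <= Phi b c.
  by apply: mean_ge0 => // t; apply: mean_ge0 => // t'; exact: G01.
have upd_le w : le_conf (upd w x false) (upd w x true).
  by move=> y; rewrite /upd; case: eqP.
have corr : Phi true true + Phi false false <= Phi true false + Phi false true.
  rewrite !PhiE -subr_ge0.
  have -> : 1 - a true * a' false + (1 - a false * a' true) -
     (1 - a true * a' true + (1 - a false * a' false)) =
     (a true - a false) * (a' true - a' false) by ring.
  have compl F w b : mean I W F (upd w x b) = 1 - mean I W (fun t => 1 - F t) (upd w x b).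
    rewrite (@eq_mean _ _ I W (fun t => 1 - F t) (fun t => 1 + (-1) * F t)).
      by rewrite meanD // mean_cst // meanZ //; ring.
    by move=> t _; rewrite mulN1r.
  case: mono => -[iU iV].
    apply: mulr_ge0; rewrite subr_ge0; apply: mean_isotone => // t.
      by case/andP: (U01 t).
    by case/andP: (V01 t).
  rewrite -mulrNN !opprB /a /a' !(compl U) !(compl V).
  apply: mulr_ge0; rewrite subr_ge0 lerD2l lerN2; apply: mean_isotone => // t; rewrite subr_ge0.
    by case/andP: (U01 t).
  by case/andP: (V01 t).
have Zs : 0 < Z true + Z false by rewrite addr_gt0.
rewrite !tot.
have div b w : agree_off K s w -> m b w / Z b <= k * (m (~~ b) w / Z (~~ b)).
  move=> sw; rewrite ler_pdivrMr // !mulrA mulrAC ler_pdivlMr //.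
  by rewrite -mulrA; exact: m_le.
have zz b : 0 <= Z b / (Z true + Z false) by rewrite divr_ge0 // ltW.
have pp : Z true / (Z true + Z false) + Z false / (Z true + Z false) = 1.
  by rewrite -mulrDl mulfV // gt_eqF.
have pos b w : 0 < m b w / Z b by rewrite divr_gt0.
have := decoupling_inequality (zz true) (zz false) pp (pos false u) (pos false v)
  (ltW (pos true u)) (ltW (pos true v)) k1 (div true u su) (div false u su) (div true v sv)
  (div false v sv) (Phi0 _ _) (Phi0 _ _) (Phi0 _ _) (Phi0 _ _) corr.
move: (m true u) (m false u) (m true v) (m false v) => mu1 mu0 mv1 mv0 h.
have q : 0 <= (Z true + Z false) ^+ 2 by rewrite sqr_ge0.
have := ler_wpM2r q h; set A := (X in X <= _ -> _); set B := (X in _ <= X -> _) => AB.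
apply: le_trans (_ : A <= _); last apply: le_trans AB _.
  rewrite /A; apply: eq_ler; field.
  by rewrite !gt_eqF.
rewrite /B; apply: eq_ler; field.
by rewrite !gt_eqF.
Qed.

Theorem coupling_step l : perm_eq l (I ++ K) ->
  mean (x :: l) W (fun t => pair_mean l t t) s <= k ^+ 4 * pair_mean (x :: l) s s.
Proof.
rewrite perm_sym perm_catC perm_sym => pl.
have ZE' b : sumc l W (upd s x b) = Z b by exact: sumc_perm.
have ptE b c : pair_total l (upd s x b) (upd s x c) = pair_total (K ++ I) (upd s x b) (upd s x c).
  exact: pair_total_perm.
rewrite mean_pair_mean_cons pair_meanE pair_total_cons /= !ZE'.
rewrite !ptE.
have Zs : 0 < Z true + Z false by rewrite addr_gt0.
rewrite ler_pdivrMr // -mulrA mulrAC invfM; set Q := _ + _ + _ + _.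
rewrite [leRHS](_ : _ = k ^+ 4 * Q / (Z true + Z false)); last by field; rewrite gt_eqF.
rewrite ler_pdivlMr //.
rewrite [leLHS](_ : _ = (pair_total (K ++ I) (upd s x true) (upd s x true) / Z true +
   pair_total (K ++ I) (upd s x false) (upd s x false) / Z false) * (Z true + Z false)); last first.
  by field; rewrite !gt_eqF.
rewrite /Q !pair_totalE -!sumcZr -!sumcD -!sumcZr -sumcZ; apply: ler_sumc => u su.
rewrite -!sumcZr -!sumcD -!sumcZr -sumcZ; apply: ler_sumc => v sv.
exact: pointwise.
Qed.

End Step.

(** * The random-cluster representation *)

Lemma ler_sumc_term (R : realFieldType) (T : eqType) (l : seq T) (F : (T -> bool) -> R) s t :
  (forall u, 0 <= F u) -> agree_off l s t -> F t <= sumc l F s.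
Proof.
move=> F0; elim: l s => [|x l IH] s st /=; first by have -> : t = s by apply/funext => y; exact: st.
have := IH (upd s x (t x)); rewrite -{2}[t](upd_id t x) => /(_ (agree_off_upd2 _ st)) h.
apply: le_trans h _; case: (t x); first by rewrite lerDl sumc_ge0.
by rewrite lerDr sumc_ge0.
Qed.

Lemma prod_sumc (R : realFieldType) (I : eqType) (B : seq I) (f : I -> bool -> R) w0 :
  uniq B -> \prod_(e <- B) (f e true + f e false) =
  sumc B (fun w => \prod_(e <- B) f e (w e)) w0.
Proof.
elim: B w0 => [|e B IH] w0 /=; first by rewrite !big_nil.
move=> /andP[eB uB]; rewrite big_cons mulrDl.
have tail b : f e b * sumc B (fun w => \prod_(e <- B) f e (w e)) (upd w0 e b) =
    sumc B (fun w => \prod_(e <- e :: B) f e (w e)) (upd w0 e b).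
  by rewrite -sumcZ; apply: eq_sumc => w ww; rewrite big_cons (ww _ eB) updxx.
by rewrite -!tail -(IH _ uB) -(IH _ uB).
Qed.

Section Connections.
Variables (T : eqType).
Implicit Types (r : rel T) (x y : T).

Definition joined r x y := exists p, path r x p /\ last x p = y.

Lemma joined_refl r x : joined r x x.
Proof. by exists [::]. Qed.

Lemma joined_trans r x y z : joined r x y -> joined r y z -> joined r x z.
Proof.
move=> [p [pp <-]] [q [pq <-]]; exists (p ++ q).
by rewrite cat_path pp pq last_cat.
Qed.

Lemma joined_step r x y : r x y -> joined r x y.
Proof. by move=> h; exists [:: y]; rewrite /= h. Qed.

Lemma joined_sym r x y : symmetric r -> joined r x y -> joined r y x.
Proof.
move=> sr [p [pp <-]]; elim: p x pp => [|z p IH] x /=; first by move=> _; exact: joined_refl.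
by move=> /andP[xz /IH h]; apply: joined_trans h _; apply: joined_step; rewrite sr.
Qed.

Lemma joined_sub r r' x y : subrel r r' -> joined r x y -> joined r' x y.
Proof. by move=> sub [p [pp <-]]; exists p; split=> //; exact: sub_path pp. Qed.

Lemma joined_invariant r x y (P : T -> Prop) : (forall u v, r u v -> P u -> P v) ->
  joined r x y -> P x -> P y.
Proof.
move=> h [p [pp <-]]; elim: p x pp => [//|z p IH] x /= /andP[xz pz] Px.
by apply: IH pz _; exact: h Px.
Qed.

Lemma joined_add_edge r r' a b x y : symmetric r ->
  (forall u v, r' u v -> [\/ r u v, u = a /\ v = b | u = b /\ v = a]) ->
  joined r' x y ->
  joined r x y \/ ((joined r x a \/ joined r x b) /\ (joined r y a \/ joined r y b)).
Proof.
move=> sr h jxy.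
pose P z := joined r x z \/ ((joined r x a \/ joined r x b) /\ (joined r z a \/ joined r z b)).
apply: (@joined_invariant r' x y P) jxy _; last by left; exact: joined_refl.
move=> u v /h[uv|[-> ->]|[-> ->]] [xu|[xab uab]].
- by left; apply: joined_trans xu _; exact: joined_step.
- right; split=> //; have vu : joined r v u by apply: joined_step; rewrite sr.
  by case: uab => ?; [left|right]; apply: joined_trans vu _.
- by right; split; [left | right; exact: joined_refl].
- by right; split=> //; right; exact: joined_refl.
- by right; split; [right | left; exact: joined_refl].
- by right; split=> //; left; exact: joined_refl.
Qed.

End Connections.

Section RandomCluster.
Variables (R : rcfType) (T I : eqType) (B : seq I) (ends : I -> T * T) (l : seq T) (t : R).
Hypotheses (uB : uniq B) (t01 : 0 < t <= 1).
Hypothesis Bl : forall e, e \in B -> ((ends e).1 \in l) && ((ends e).2 \in l).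
Implicit Types (w : I -> bool) (s : T -> bool).

Definition edge_list : seq (T * T * R) := [seq (ends e, t) | e <- B].

Definition open_rel w : rel T := fun u v =>
  has (fun e => w e && ((ends e == (u, v)) || (ends e == (v, u)))) B.

Definition compatible w s := all (fun e => w e ==> (s (ends e).1 == s (ends e).2)) B.

(** For a duplicate-free [l] this is 2 to the number of open clusters. Counting spin configurations
    instead of components gives its lattice property by algebra. *)
Definition compatible_count w : R := sumc l (fun s => (compatible w s)%:R) (fun=> false).

Definition open_prob w : R := \prod_(e <- B) (if w e then 1 - t else t).

Lemma open_rel_sym w : symmetric (open_rel w).
Proof. by move=> u v; apply: eq_has => e; rewrite orbC. Qed.

Lemma compatibleP w s : reflect (forall u v, open_rel w u v -> s u = s v) (compatible w s).
Proof.
apply: (iffP allP) => [h u v /hasP[e eB /andP[we]]|h e eB].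
  by move=> /orP[] /eqP ee; have := h e eB; rewrite we ee /= => /eqP // ->.
apply/implyP => we; apply/eqP; apply: h; apply/hasP; exists e => //.
by rewrite we -surjective_pairing eqxx.
Qed.

Lemma compatible_joined w s x y : compatible w s -> joined (open_rel w) x y -> s x = s y.
Proof.
move=> /compatibleP h j; apply: (joined_invariant (P := fun z => s x = s z)) j _ => //.
by move=> u v /h -> ->.
Qed.

Lemma open_rel_in w u v : open_rel w u v -> (u \in l) && (v \in l).
Proof. by move=> /hasP[e /Bl + /andP[_ /orP[] /eqP ee]]; rewrite ee => /andP[/= -> ->]. Qed.

Lemma joined_in w x y : x \in l -> joined (open_rel w) x y -> y \in l.
Proof.
by move=> xl j; apply: (joined_invariant (P := fun z => z \in l)) j xl => u v /open_rel_in /andP[].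
Qed.

Lemma compatible_addb w s a : (forall u v, open_rel w u v -> a u = a v) ->
  compatible w (fun x => s x (+) a x) = compatible w s.
Proof.
move=> ha; apply/compatibleP/compatibleP => h u v uv; last by rewrite (h _ _ uv) (ha _ _ uv).
by have := h _ _ uv; rewrite (ha _ _ uv) => /addIb.
Qed.

Lemma sumc_shift (F : (T -> bool) -> R) a : (forall x, x \notin l -> a x = false) ->
  sumc l (fun s => F (fun x => s x (+) a x)) (fun=> false) = sumc l F (fun=> false).
Proof. by move=> ha; rewrite sumc_addb; apply: sumc_agree => x /ha ->. Qed.

(** If [x] and [y] are not joined, flipping the cluster of [x] preserves compatibility and changes
    the sign of the product. *)
Lemma compatible_correlation w x y : x \in l ->
  sumc l (fun s => (compatible w s)%:R * (sgn R (s x) * sgn R (s y))) (fun=> false) =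
  `[< joined (open_rel w) x y >]%:R * compatible_count w.
Proof.
move=> xl; case: asboolP => j.
  rewrite mul1r; apply: eq_sumc => s _; case: (boolP (compatible w s)) => [c|_]; last by rewrite mul0r.
  by rewrite (compatible_joined c j) mul1r; case: (s y); rewrite /sgn ?mulr1 // mulN1r opprK.
rewrite mul0r; set S := sumc _ _ _.
suff : S = - S by move=> /eqP; rewrite -addr_eq0 -mulr2n mulrn_eq0 => /eqP.
pose a z := `[< joined (open_rel w) x z >].
have ha z : z \notin l -> a z = false.
  by move=> zl; apply/negbTE/asboolPn => /(joined_in xl); apply/negP.
have hc u v : open_rel w u v -> a u = a v.
  move=> uv; apply/asboolP/asboolP => h; apply: joined_trans h _; apply: joined_step => //.
  by rewrite open_rel_sym.
have ax : a x by apply/asboolP; exact: joined_refl.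
have ay : a y = false by apply/asboolPn.
rewrite {1}/S -(sumc_shift _ ha) -sumcN; apply: eq_sumc => s _.
rewrite compatible_addb // ax ay addbT addbF.
by case: (s x); rewrite /sgn /= ?mulN1r ?mul1r mulrN ?opprK.
Qed.

Lemma compatible_upd w e s : e \in B -> ~~ w e ->
  compatible (upd w e true) s = compatible w s && (s (ends e).1 == s (ends e).2).
Proof.
move=> eB we; apply/allP/andP => [h|[/allP h h'] f fB].
  split; last by have := h e eB; rewrite updxx.
  apply/allP => f fB; have := h f fB; rewrite /upd; case: eqP => // ->.
  by rewrite (negbTE we).
by rewrite /upd; case: eqP => [->//|_]; exact: h.
Qed.

Lemma compatible_count_upd_le w e : e \in B -> ~~ w e ->
  compatible_count (upd w e true) <= compatible_count w.
Proof.
move=> eB we; apply: ler_sumc => s _; rewrite compatible_upd // ler_nat.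
by case: (compatible w s); case: eqP.
Qed.

(** The signed count of the ends of [e] vanishes, so adding it to the count leaves twice the
    configurations in which they agree. *)
Lemma compatible_count_halve w e : e \in B -> ~~ w e ->
  ~ joined (open_rel w) (ends e).1 (ends e).2 ->
  compatible_count w = 2 * compatible_count (upd w e true).
Proof.
move=> eB we nj; have /andP[e1 e2] := Bl eB.
have := compatible_correlation w (ends e).2 e1; case: asboolP => // _; rewrite mul0r => c0.
rewrite -[LHS]addr0 -[X in _ + X]c0 /compatible_count -sumcD -sumcZ; apply: eq_sumc => s _.
rewrite compatible_upd //; case: (compatible w s) => /=; last by rewrite !mul0r mulr0 addr0.
by case: (s (ends e).1) (s (ends e).2) => [] []; rewrite /sgn /=; lra.
Qed.

Lemma compatible_count_gt0 w : 0 < compatible_count w.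
Proof.
apply: lt_le_trans (ltr01) _.
have -> : 1 = (compatible w (fun=> false))%:R :> R.
  by have -> : compatible w (fun=> false) by apply/allP => e _; rewrite eqxx implybT.
by apply: (@ler_sumc_term R T l (fun s => (compatible w s)%:R)).
Qed.

Lemma compatible_jn w w' s : compatible (jn w w') s = compatible w s && compatible w' s.
Proof.
rewrite /compatible -all_predI; apply: eq_all => e /=; rewrite /jn.
by case: (w e) (w' e) => [] []; rewrite /= ?andbT ?andbb.
Qed.

Lemma open_rel_mono w w' : le_conf w w' -> subrel (open_rel w) (open_rel w').
Proof.
move=> h u v; apply: sub_has => e /andP[/h -> ->] //.
Qed.

(* Compatible configurations form a group under exclusive or. *)
Lemma compatible_count_lattice : lattice_weight compatible_count.
Proof.
move=> w w'.
have loc w1 (s : T -> bool) : compatible w1 s = compatible w1 (fun x => s x && (x \in l)).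
  apply: eq_in_all => e /Bl /andP[e1 e2]; by rewrite e1 e2 !andbT.
(* The outer variable [r] is the exclusive or of the two spin configurations. *)
have -> : compatible_count w * compatible_count w' =
    sumc l (fun r => sumc l (fun s => ((compatible w s && compatible w' (fun x => s x (+) r x)))%:R)
       (fun=> false)) (fun=> false).
  rewrite sumc_exchange /compatible_count -sumcZr; apply: eq_sumc => s sl.
  have sl' x : x \notin l -> s x = false by move/sl.
  rewrite -(sumc_shift _ sl') -sumcZ; apply: eq_sumc => r _.
  rewrite -natrM mulnb; congr (((_ && compatible _ _) : nat)%:R).
  by apply/funext => x; rewrite addbC.
rewrite [X in _ <= _ * X]/compatible_count -sumcZ; apply: ler_sumc => r rl.
(* For fixed [r] the admissible [s] are either none or the shift by some [s0] of configurations
   compatible with the join; in the second case [r] itself is compatible with the meet. *)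
have [[s0 [c0 c0' s0l]]|nex] := pselect (exists s0, [/\ compatible w s0,
    compatible w' (fun x => s0 x (+) r x) & forall x, x \notin l -> s0 x = false]).
  have -> : compatible (mt w w') r.
    apply/compatibleP => u v uv.
    have e1 : s0 u = s0 v.
      move/compatibleP: c0; apply; apply: open_rel_mono uv; by move=> e /andP[].
    have : s0 u (+) r u = s0 v (+) r v.
      move/compatibleP: c0' => /(_ u v); apply; apply: open_rel_mono uv; by move=> e /andP[].
    by rewrite e1 => /addbI.
  rewrite mulr1 -(sumc_shift _ s0l); apply: ler_sumc => s _.
  rewrite ler_nat compatible_jn compatible_addb; last by apply/compatibleP.
  have -> : (fun x => s x (+) s0 x (+) r x) = (fun x => s x (+) (s0 x (+) r x)).
    by apply/funext => x; rewrite addbA.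
  by rewrite (compatible_addb _ (a := fun x => s0 x (+) r x)) //; apply/compatibleP.
rewrite (@eq_sumc _ _ _ _ (fun=> 0)).
  by rewrite sumc0 mulr_ge0 ?ler0n // ltW // compatible_count_gt0.
move=> s sl; case: andP => // -[c c']; exfalso; apply: nex; exists s; split=> // x.
Qed.

Lemma open_prob_modular w w' :
  open_prob w * open_prob w' = open_prob (jn w w') * open_prob (mt w w').
Proof.
rewrite /open_prob -!big_split; apply: eq_bigr => e _; rewrite /jn /mt.
by case: (w e) (w' e) => [] [] //=; rewrite mulrC.
Qed.

Lemma open_prob_ge0 w : 0 <= open_prob w.
Proof.
have /andP[t0 t1] := t01; apply: prodr_ge0 => e _; case: (w e); first by rewrite subr_ge0.
exact: ltW.
Qed.

(** Each edge factor equals [t] plus [1 - t] times the indicator that the ends agree; the product is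
    expanded over the sets of open edges. *)
Lemma edwards_sokal (F : (T -> bool) -> R) :
  sumc l (fun s => edges_weight edge_list s * F s) (fun=> false) =
  sumc B (fun w => open_prob w * sumc l (fun s => (compatible w s)%:R * F s) (fun=> false))
     (fun=> false).
Proof.
rewrite (@eq_sumc _ _ _ _ (fun s => sumc B (fun w => open_prob w * ((compatible w s)%:R * F s))
   (fun=> false))).
  rewrite (sumc_exchange l B (fun s w => open_prob w * ((compatible w s)%:R * F s))).
  by apply: eq_sumc => w _; rewrite sumcZ.
move=> s _; rewrite (@eq_sumc _ _ B _ (fun w => open_prob w * (compatible w s)%:R * F s)); last first.
  by move=> w _; rewrite mulrA.
rewrite sumcZr; congr (_ * _).
rewrite /edges_weight big_map.
pose f e (b : bool) := if b then (1 - t) * (s (ends e).1 == s (ends e).2)%:R else t.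
rewrite (eq_bigr (fun e => f e true + f e false)).
  rewrite (prod_sumc _ (fun=> false) uB); apply: eq_sumc => w _.
  rewrite /open_prob /compatible; elim: (B) => [|e B' IH]; first by rewrite !big_nil mulr1.
  rewrite !big_cons /= IH -mulnb natrM mulrACA; congr (_ * _).
  by rewrite /f; case: (w e); rewrite //= mulr1.
move=> e _; rewrite /f /edge_weight /=; case: eqP => _; first by rewrite mulr1 subrK.
by rewrite mulr0 add0r.
Qed.

Variable V : (I -> bool) -> R.
Hypothesis V0 : forall w, 0 < V w.
Hypothesis Vloc : forall w w', (forall e, e \in B -> w e = w' e) -> V w = V w'.
Hypothesis Vadd : forall w e, e \in B -> ~~ w e ->
  V w * compatible_count (upd w e true) <= V (upd w e true) * compatible_count w.

Lemma compatible_count_local w w' : (forall e, e \in B -> w e = w' e) ->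
  compatible_count w = compatible_count w'.
Proof.
move=> h; apply: eq_sumc => s _; congr ((_ : bool)%:R).
by apply: eq_in_all => e /h ->.
Qed.

(** The bonds that differ are opened one at a time, each by [Vadd]. *)
Lemma density_isotone : isotone (fun w => V w / compatible_count w).
Proof.
move=> w w' ww'.
pose m (r : seq I) e := if e \in r then w' e else w e.
have key r : {subset r <= B} -> V w / compatible_count w <= V (m r) / compatible_count (m r).
  elim: r => [|e r IH] sub; first exact: le_refl.
  have eB : e \in B by apply: sub; rewrite mem_head.
  have mE : m (e :: r) = upd (m r) e (w' e).
    apply/funext => f; rewrite /m /upd inE; by case: eqP => [->|].
  apply: le_trans (IH _) _; first by move=> f fr; apply: sub; rewrite inE fr orbT.
  rewrite mE; have [mw|mw] := boolP (m r e == w' e).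
    by rewrite -(eqP mw) upd_id.
  have [we me] : w' e = true /\ m r e = false.
    move: mw; rewrite /m; case: ifP => _; first by rewrite eqxx.
    by case: (w e) (w' e) (ww' e) => [] [] // /(_ isT).
  rewrite we ler_pdivrMr ?compatible_count_gt0 // mulrAC ler_pdivlMr ?compatible_count_gt0 //.
  by apply: Vadd; rewrite ?me.
apply: le_trans (key B _) _ => //.
by rewrite (@Vloc (m B) w') ?(@compatible_count_local (m B) w') // => f fB; rewrite /m fB.
Qed.

(* The density V / compatible_count of the wired measure with respect to the free one is
   increasing, so that FKG applies. *)
Theorem correlation_le_connection x y : x \in l ->
  correlation edge_list l x y <=
  sumc B (fun w => open_prob w * V w * `[< joined (open_rel w) x y >]%:R) (fun=> false) /
  sumc B (fun w => open_prob w * V w) (fun=> false).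
Proof.
move=> xl; rewrite /correlation /mean edwards_sokal.
have -> : sumc l (edges_weight edge_list) (fun=> false) =
    sumc B (fun w => open_prob w * compatible_count w) (fun=> false).
  rewrite -[LHS](@eq_sumc _ _ _ (fun s => edges_weight edge_list s * 1)) ?edwards_sokal.
    apply: eq_sumc => w _; congr (_ * _); apply: eq_sumc => s _; exact: mulr1.
  by move=> s _; rewrite mulr1.
pose P w := open_prob w * compatible_count w.
pose f w := V w / compatible_count w.
pose g w : R := `[< joined (open_rel w) x y >]%:R.
have cn0 w : compatible_count w != 0 by rewrite gt_eqF // compatible_count_gt0.
have Pf w : P w * f w = open_prob w * V w by rewrite /P /f -mulrA [X in _ * X]mulrC divfK.
have P0 w : 0 <= P w by rewrite mulr_ge0 ?open_prob_ge0 // ltW // compatible_count_gt0.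
have f0 w : 0 <= f w by rewrite divr_ge0 // ltW // compatible_count_gt0.
have g0 w : 0 <= g w by exact: ler0n.
have latP : lattice_weight P.
  move=> w w'; rewrite /P mulrACA [leRHS]mulrACA -open_prob_modular.
  by apply: ler_wpM2l; rewrite ?mulr_ge0 ?open_prob_ge0 // compatible_count_lattice.
have isog : isotone g.
  move=> w w' ww'; rewrite /g ler_nat; case: asboolP => // j; case: asboolP => //.
  by case; apply: joined_sub j; exact: open_rel_mono.
have := fkg B (fun=> false) P0 f0 g0 latP density_isotone isog.
have tot : 0 < open_prob (fun=> false).
  rewrite /open_prob big_seq; apply: prodr_gt0 => e _ /=; by case/andP: t01.
have S1 : 0 < sumc B P (fun=> false).
  apply: lt_le_trans (ler_sumc_term (t := fun=> false) P0 _) => //.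
  by rewrite /P mulr_gt0 // compatible_count_gt0.
have S2 : 0 < sumc B (fun w => open_prob w * V w) (fun=> false).
  apply: lt_le_trans (ler_sumc_term (t := fun=> false) _ _) => //; last first.
    by move=> u; rewrite mulr_ge0 ?open_prob_ge0 // ltW.
  by rewrite mulr_gt0.
rewrite (eq_sumc (fun w _ => Pf w)).
rewrite (@eq_sumc _ _ _ (fun w => P w * f w * g w) (fun w => open_prob w * V w * g w)); last first.
  by move=> w _; rewrite Pf.
move=> h; rewrite ler_pdivrMr // mulrAC ler_pdivlMr //.
rewrite mulrC; apply: le_trans _ h; apply: ler_wpM2l; first exact: ltW.
by apply: ler_sumc => w _; rewrite compatible_correlation // /P /g [X in _ * X]mulrC mulrA.
Qed.

End RandomCluster.

Local Open Scope classical_set_scope.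
Local Open Scope ring_scope.

Lemma perm_filter_cat (T : eqType) (l l' : seq T) : uniq l -> uniq l' -> {subset l' <= l} ->
  perm_eq l ([seq x <- l | x \notin l'] ++ l').
Proof.
move=> ul ul' sub; rewrite perm_sym perm_catC perm_sym -(perm_filterC (mem l') l) perm_cat2r.
apply: uniq_perm; rewrite ?filter_uniq // => x; rewrite mem_filter.
by apply/andP/idP => [[]//|xl]; split=> //; exact: sub.
Qed.

(** * Sums over finite functions as recursive sums *)

Section Override.
Variables (R : realFieldType) (T : choiceType).
Implicit Types (s t : T -> bool).

Fixpoint extensions (l : seq T) s : seq (T -> bool) :=
  if l is x :: l' then extensions l' (upd s x true) ++ extensions l' (upd s x false)
  else [:: s].

Lemma sumc_extensions l (F : (T -> bool) -> R) s : sumc l F s = \sum_(t <- extensions l s) F t.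
Proof. by elim: l s => [|x l IH] s /=; rewrite ?big_seq1 // big_cat !IH. Qed.

Lemma mem_extensions l s t : (t \in extensions l s) = `[< agree_off l s t >].
Proof.
elim: l s => [|x l IH] s /=.
  rewrite inE; apply/eqP/asboolP => [->//|h]; apply/funext => y; exact: h.
rewrite mem_cat !IH; apply/orP/asboolP => [[] /asboolP h|h]; try exact: agree_off_upd h.
have := agree_off_upd2 (t x) h; rewrite upd_id.
by case: (t x) => h'; [left|right]; apply/asboolP.
Qed.

Lemma uniq_extensions l s : uniq l -> uniq (extensions l s).
Proof.
elim: l s => [//|x l IH] s /= /andP[xl ul]; rewrite cat_uniq !IH //= andbT.
apply/hasPn => t; rewrite !mem_extensions => /asboolP h; apply/asboolPn => h'.
by have := h _ xl; rewrite (h' _ xl) !updxx.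
Qed.

Lemma override_in (S : {fset T}) (w : {ffun S -> bool}) s (u : S) : override w s (val u) = w u.
Proof. by rewrite /override valK. Qed.

Lemma override_out (S : {fset T}) (w : {ffun S -> bool}) s x :
  x \notin S -> override w s x = s x.
Proof. by move=> xS; rewrite /override insubN. Qed.

Lemma sum_override (S : {fset T}) (F : (T -> bool) -> R) s :
  \sum_(w : {ffun S -> bool}) F (override w s) = sumc S F s.
Proof.
rewrite sumc_extensions -(big_map (fun w : {ffun S -> bool} => override w s) predT F).
apply: perm_big; apply: uniq_perm; last first.
- move=> t; rewrite mem_extensions; apply/mapP/asboolP => [[w _ ->] x xS|h].
    exact: override_out.
  exists [ffun u : S => t (val u)]; first by rewrite mem_index_enum.
  apply/funext => x; have [xS|xS] := boolP (x \in S); last by rewrite override_out // h.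
  by rewrite -[x]/(val [`xS]%fset) override_in ffunE.
- exact: uniq_extensions.
rewrite map_inj_uniq ?index_enum_uniq // => w w' ww'.
by apply/ffunP => u; rewrite -(override_in w s) ww' override_in.
Qed.

End Override.

(** * Open clusters of lattice bonds and products of cluster factors *)

Section Bonds.
Variable d : nat.
Implicit Types (x y a b : site d) (u w : bond d -> bool).

Lemma nearest_neighbors_sym x y : nearest_neighbors x y -> nearest_neighbors y x.
Proof.
by move=> h; rewrite /nearest_neighbors -h; apply: eq_bigr => i _; rewrite -sqrrN opprB.
Qed.

Lemma fset2_eq (T : choiceType) (x y a b : T) : [fset x; y]%fset = [fset a; b]%fset ->
  (x = a /\ y = b) \/ (x = b /\ y = a).
Proof.
move=> e; have : (x \in [fset a; b])%fset by rewrite -e fset21.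
have : (y \in [fset a; b])%fset by rewrite -e fset22.
have : (a \in [fset x; y])%fset by rewrite e fset21.
have : (b \in [fset x; y])%fset by rewrite e fset22.
move=> /fset2P h1 /fset2P h2 /fset2P h3 /fset2P h4; intuition congruence.
Qed.

Definition bond_rel (S : set (bond d)) : rel (site d) := fun x y => `[< S [fset x; y]%fset >].

Lemma bond_rel_sym S : symmetric (bond_rel S).
Proof. by move=> x y; rewrite /bond_rel fsetUC. Qed.

Lemma fk_cluster_refl u x : fk_cluster u x x.
Proof. by exists [::]. Qed.

Lemma fk_cluster_sym u x y : fk_cluster u x y -> fk_cluster u y x.
Proof. apply: joined_sym; exact: bond_rel_sym. Qed.

Lemma fk_cluster_eq u x y : fk_cluster u x y -> fk_cluster u x = fk_cluster u y.
Proof.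
move=> xy; apply/seteqP; split => z h; last exact: joined_trans xy h.
exact: joined_trans (fk_cluster_sym xy) h.
Qed.

Lemma fk_cluster_add_bond u a b x : bonds [fset a; b]%fset ->
  let D := fk_cluster u a `|` fk_cluster u b in
  fk_cluster (upd u [fset a; b]%fset true) x = if `[< D x >] then D else fk_cluster u x.
Proof.
move=> ab D; set e := [fset a; b]%fset; set u' := upd u e true.
have mono z : fk_cluster u z `<=` fk_cluster u' z.
  move=> y; apply: joined_sub => v1 v2 /asboolP[h1 h2]; apply/asboolP; split=> //.
  by rewrite /u' /upd; case: eqP.
have jab : fk_cluster u' a b.
  by apply: (@joined_step _ (bond_rel _)); apply/asboolP; split=> //; rewrite /u' updxx.
have back z y : fk_cluster u' z y -> fk_cluster u z y \/
    ((fk_cluster u z a \/ fk_cluster u z b) /\ (fk_cluster u y a \/ fk_cluster u y b)).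
  apply: (@joined_add_edge _ (bond_rel (open_bonds u))); first exact: bond_rel_sym.
  move=> v1 v2 /asboolP[h1]; rewrite /u' /upd; case: eqP => [/fset2_eq[]|_ h2].
  - by move=> [-> ->] _; constructor 2.
  - by move=> [-> ->] _; constructor 3.
  - by constructor 1; apply/asboolP.
case: asboolP => Dx; last first.
  apply/seteqP; split=> y; last exact: mono.
  move=> /back[//|[[]h _]]; exfalso; apply: Dx; [left|right]; exact: fk_cluster_sym.
have Dcl : D `<=` fk_cluster u' a.
  move=> y [/mono//|/mono h]; exact: joined_trans jab h.
have xa := Dcl _ Dx; rewrite -(fk_cluster_eq xa); apply/seteqP; split=> // y /back[h|].
  by left.
by move=> [_ []]h; [left|right]; exact: fk_cluster_sym.
Qed.

Variables (R : realType) (E : set (site d)) (phi : set (site d) -> R).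
Hypotheses (E_fin : finite_set E) (phi_gt0 : forall C, 0 < phi C).

Definition cluster_weight u : R := \big[*%R/1]_(C \in fk_cluster u @` E) phi C.

Lemma cluster_weight_gt0 u : 0 < cluster_weight u.
Proof.
rewrite /cluster_weight; by elim/big_ind: _ => // x y; exact: mulr_gt0.
Qed.

Lemma cluster_weight_joined u a b : bonds [fset a; b]%fset -> fk_cluster u a b ->
  cluster_weight (upd u [fset a; b]%fset true) = cluster_weight u.
Proof.
move=> ab jab; congr (\big[_/_]_(C \in _) _).
apply: eq_imagel => x _ /=; rewrite fk_cluster_add_bond // -(fk_cluster_eq jab) setUid.
by case: asboolP => // h; rewrite (fk_cluster_eq h).
Qed.

(** Opening the bond replaces the clusters of [a] and [b] by their union and leaves every other
    cluster unchanged. *)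
Lemma cluster_weight_merge u a b : bonds [fset a; b]%fset -> E a -> E b ->
  ~ fk_cluster u a b ->
  (forall C D, C `&` D = set0 -> phi C * phi D <= 2 * phi (C `|` D)) ->
  cluster_weight u <= 2 * cluster_weight (upd u [fset a; b]%fset true).
Proof.
move=> ab Ea Eb nab hphi; set u' := upd _ _ _.
set Ca := fk_cluster u a; set Cb := fk_cluster u b.
pose X := fk_cluster u @` E; pose X' := fk_cluster u' @` E.
have fX : finite_set X by apply: finite_image.
have fX' : finite_set X' by apply: finite_image.
have CaCb : Ca <> Cb by move=> h; apply: nab; rewrite -/Ca h; exact: fk_cluster_refl.
have E1 : X' `\ (Ca `|` Cb) = (X `\ Ca) `\ Cb.
  apply/seteqP; split=> C.
    move=> [[x Ex <-]] /=; rewrite fk_cluster_add_bond //; case: asboolP => // nD h.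
    split; last by move=> hC; apply: nD; right; rewrite -/Cb -hC; exact: fk_cluster_refl.
    split; first by exists x.
    by move=> hC; apply: nD; left; rewrite -/Ca -hC; exact: fk_cluster_refl.
  move=> [[[x Ex <-] na] nb].
  have nD : ~ (Ca `|` Cb) x.
    by move=> [] h; [apply: na | apply: nb]; rewrite /= -(fk_cluster_eq h).
  split; first by exists x => //; rewrite fk_cluster_add_bond //; case: asboolP.
  by move=> /= h; apply: nD; rewrite -h; exact: fk_cluster_refl.
rewrite /cluster_weight -/X -/X' (fsbigD1 Ca) //=; last by exists a.
rewrite (fsbigD1 Cb) /=; last first.
- by split; [exists b | exact: nesym].
- exact: finite_setD.
rewrite (fsbigD1 (Ca `|` Cb) X') //=; last first.
  by exists a => //; rewrite fk_cluster_add_bond //; case: asboolP => // -[]; left; exact: fk_cluster_refl.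
rewrite E1 !mulrA; apply: ler_wpM2r.
  by elim/big_ind: _ => // [x y|C _]; [exact: mulr_ge0 | exact: ltW].
apply: hphi; rewrite -subset0 => z [za zb]; apply: nab.
exact: joined_trans za (fk_cluster_sym zb).
Qed.

End Bonds.

Section BondEnds.
Variable d : nat.

(** An arbitrary orientation of the bond; the default [(0, 0)] occurs only off [bonds]. *)
Definition bond_ends (e : bond d) : site d * site d :=
  xget (0, 0) [set p | nearest_neighbors p.1 p.2 /\ e = [fset p.1; p.2]%fset].

Lemma bond_endsP e : bonds e ->
  nearest_neighbors (bond_ends e).1 (bond_ends e).2 /\
  e = [fset (bond_ends e).1; (bond_ends e).2]%fset.
Proof.
move=> [x [y [xy exy]]]; rewrite /bond_ends; case: xgetP => [p _ //|] /(_ (x, y)).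
by case.
Qed.

Lemma inner_bonds_finite (N : {fset (site d)}) : finite_set (inner_bonds [set` N]).
Proof.
pose f (p : site d * site d) : bond d := [fset p.1; p.2]%fset.
apply: (sub_finite_set _ (finite_image f (finite_setX (finite_fset N) (finite_fset N)))).
move=> e [[x [y [_ ->]]] h]; exists (x, y) => //; split; apply: h; rewrite ?fset21 ?fset22 //.
Qed.

Definition inner_bonds_fset (N : {fset (site d)}) : {fset (bond d)} :=
  fset_set (inner_bonds [set` N]).

Lemma mem_inner_bonds N e : e \in inner_bonds_fset N <-> inner_bonds [set` N] e.
Proof.
by rewrite /inner_bonds_fset in_fset_set ?inE //; exact: inner_bonds_finite.
Qed.

Lemma inner_bonds_ends N e : e \in inner_bonds_fset N ->
  ((bond_ends e).1 \in N) && ((bond_ends e).2 \in N).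
Proof.
move=> /mem_inner_bonds[/bond_endsP[_ ee] h].
by apply/andP; split; apply: h; rewrite [in X in _ \in X]ee ?fset21 ?fset22.
Qed.

End BondEnds.

(** * Domination of the free random-cluster measure by the wired one *)

Section WiredWeight.
Variables (R : realType) (d : nat) (beta h : R) (N : {fset (site d)}).
Hypothesis beta_ge0 : 0 <= beta.
Let B := inner_bonds_fset N.
Let t : R := expR (- beta).
Implicit Types (w : bond d -> bool) (C D : set (site d)).

Lemma expRN_itv : 0 < t <= 1.
Proof. by rewrite expR_gt0 /= expR_le1 oppr_le0. Qed.

(* The boundary of B is wired by opening every bond off B if h <> 0; if h = 0 its clusters
   simply get no factor. *)
Definition wired_config w : bond d -> bool := fun e => if e \in B then w e else h != 0.

(** Both conventions of the wired measure in one function: a cluster that belongs to the boundary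
    has factor 1. *)
Definition cluster_factor C : R :=
  if h == 0 then (if `[< C `&` endpoints (bonds (d := d) `\` [set` B]) = set0 >] then 2 else 1)
  else if `[< finite_set C >] then 1 + t `^ (2 * `|h| * #|` fset_set C|%:R) else 1.

Definition wired_weight w := cluster_weight (endpoints [set` B]) cluster_factor (wired_config w).

Lemma cluster_factor_ge1 C : 1 <= cluster_factor C.
Proof.
rewrite /cluster_factor; case: eqP => _; first by case: asboolP => _; lra.
by case: asboolP => _ //; rewrite lerDl powR_ge0.
Qed.

(** For [u], [v] between 0 and 1, [(1 + u) * (1 + v) <= 2 * (1 + u * v)] is
    [0 <= (1 - u) * (1 - v)]. If one of the sets belongs to the boundary, so does the union, and a
    single factor, at most 2, is left to bound. *)
Lemma cluster_factor_setU C D : C `&` D = set0 ->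
  cluster_factor C * cluster_factor D <= 2 * cluster_factor (C `|` D).
Proof.
move=> CD; rewrite /cluster_factor; case: eqP => _.
  set S := endpoints _; rewrite setIUl.
  case: asboolP => [->|_]; case: asboolP => [->|_]; case: asboolP => // k; try lra.
  by exfalso; apply: k; rewrite setU0.
case: asboolP => [fC|nC]; last first.
  rewrite (asboolF (P := finite_set (C `|` D))) ; last by rewrite finite_setU => -[].
  case: asboolP => _; rewrite mul1r; last lra.
  rewrite mulr1 lerD2l /t -expRM expR_le1 mulNr oppr_le0 !mulr_ge0 //.
rewrite mulrC; case: asboolP => [fD|nD]; last first.
  rewrite (asboolF (P := finite_set (C `|` D))) ; last by rewrite finite_setU => -[].
  rewrite mul1r mulr1 lerD2l /t -expRM expR_le1 mulNr oppr_le0 !mulr_ge0 //.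
have fCD : finite_set (C `|` D) by rewrite finite_setU.
case: asboolP => // _.
have card : (#|` fset_set (C `|` D)| <= #|` fset_set C| + #|` fset_set D|)%N.
  by rewrite fset_setU // cardfsU leq_subr.
rewrite /t -!expRM; set c := #|` fset_set C|; set e := #|` fset_set D|.
set f := #|` _| in card *.
set u := expR _; set v := expR (- beta * (2 * `|h| * c%:R)); set z := expR _.
have uv : u * v <= z.
  rewrite -expRD ler_expR -mulrDr !mulNr lerN2; apply: ler_wpM2l => //.
  by rewrite -mulrDr; apply: ler_wpM2l; [rewrite mulr_ge0 | rewrite -natrD ler_nat addnC].
have u1 : u <= 1 by rewrite expR_le1 mulNr oppr_le0 !mulr_ge0.
have v1 : v <= 1 by rewrite expR_le1 mulNr oppr_le0 !mulr_ge0.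
have := mulr_ge0 (_ : 0 <= 1 - u) (_ : 0 <= 1 - v); rewrite !subr_ge0 => /(_ u1 v1).
by move: uv => /[swap] ? ?; nra.
Qed.

Lemma endpoints_finite (S : {fset (bond d)}) : finite_set (endpoints [set` S]).
Proof.
apply: (@sub_finite_set _ _ [set` \bigcup_(e <- S) e]%fset); last exact: finite_fset.
by move=> x [e eS xe] /=; apply/bigfcupP; exists e; rewrite ?eS.
Qed.

Lemma bond_weight_open_prob (w : {ffun B -> bool}) s :
  bond_weight (fk_p beta) w = open_prob B t (override w s).
Proof.
rewrite /bond_weight /open_prob big_seq_fsetE /=.
under eq_bigr do rewrite override_in.
have -> : 1 - fk_p beta = t by rewrite /fk_p opprB addrCA subrr addr0.
have -> : fk_p beta = 1 - t by [].
rewrite [RHS](bigID (fun e => w e)) /=.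
rewrite [X in _ = X * _](eq_bigr (fun=> 1 - t)) => [|e ->//].
rewrite [X in _ = _ * X](eq_bigr (fun=> t)) => [|e /negbTE->//].
rewrite !prodr_const; congr (_ * _ ^+ _).
by rewrite cardfE -(cardC [pred e | w e]) addKn; apply: eq_card => e.
Qed.

Lemma fk_wired_weightE (w : {ffun B -> bool}) :
  fk_wired_weight beta h w =
  open_prob B t (override w (fun=> false)) * wired_weight (override w (fun=> false)).
Proof.
have fX u : finite_set (fk_cluster u @` endpoints [set` B]).
  by apply: finite_image; exact: endpoints_finite.
rewrite /fk_wired_weight; have [h0|h0] := eqVneq h 0.
  rewrite (bond_weight_open_prob w (fun=> false)); congr (_ * _).
  rewrite /wired_weight /cluster_weight.
  have -> : wired_config (override w (fun=> false)) = override w (fun=> false).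
    apply/funext => e; rewrite /wired_config h0 eqxx.
    by case: ifPn => // eB; rewrite override_out.
  set J := [set C | C `&` endpoints (bonds (d := d) `\` [set` B]) = set0].
  transitivity (\big[*%R/(1 : R)]_(C \in fk_cluster (override w (fun=> false)) @` endpoints [set` B])
      if C \in J then 2 else 1).
    rewrite -fsbig_mkcondr fsbig_finite /=; last by apply: finite_setIl.
    rewrite big_const_seq count_predT iter_mulr_1; congr (_ ^+ #|` fset_set _|).
    apply/seteqP; split=> C.
      by move=> [[x Ex ->] CJ]; split=> //; exists x.
    by move=> [[x Ex <-] CJ]; split=> //; exists x.
  apply: eq_fsbigr => C _; rewrite /cluster_factor h0 eqxx.
  by case: asboolP => k; [rewrite mem_set | rewrite memNset].
rewrite /fk_weight (bond_weight_open_prob w (fun=> false)); congr (_ * _).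
rewrite fsbig_mkcondr /wired_weight /cluster_weight.
have -> : wired_config (override w (fun=> false)) = override w (fun=> true).
  apply/funext => e; rewrite /wired_config h0.
  case: ifPn => eB; last by rewrite override_out.
  by rewrite -[e]/(val [` eB]%fset) !override_in.
apply: eq_fsbigr => C _; rewrite /cluster_factor (negbTE h0).
rewrite /fk_p opprB addrCA subrr addr0.
by case: asboolP => k; [rewrite mem_set | rewrite memNset].
Qed.

Lemma open_rel_bond w x y : (forall e, e \notin B -> w e = false) ->
  open_rel B (@bond_ends d) w x y = bond_rel (open_bonds w) x y.
Proof.
move=> w0; apply/hasP/asboolP => [[e eB /andP[we ee]]|[exy we]].
  have /mem_inner_bonds[be _] := eB; have [_ eE] := bond_endsP be.
  have -> : [fset x; y]%fset = e; last by [].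
  by rewrite eE; case/orP: ee => /eqP ->; rewrite // fsetUC.
exists [fset x; y]%fset; first by apply: contraT => /w0; rewrite we.
rewrite we /=; have [_] := bond_endsP exy.
set p := bond_ends _ => /fset2_eq[][hx hy]; apply/orP; [left|right];
  by apply/eqP; rewrite [LHS]surjective_pairing -hx -hy.
Qed.

Theorem correlation_le_wired x y : x \in N ->
  correlation (edge_list B (@bond_ends d) t) N x y <= fk_wired_connection beta h B x y.
Proof.
move=> xN.
pose w0 : bond d -> bool := fun=> false.
pose V := wired_weight.
have V0 w : 0 < V w by apply: cluster_weight_gt0 => C; apply: lt_le_trans (cluster_factor_ge1 C).
have Vloc w w' : (forall e, e \in B -> w e = w' e) -> V w = V w'.
  move=> ww'; congr cluster_weight; apply/funext => e; rewrite /wired_config.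
  by case: ifPn => // /ww'.
have Bl e : e \in B -> ((bond_ends e).1 \in N) && ((bond_ends e).2 \in N).
  exact: inner_bonds_ends.
have Vadd w e : e \in B -> ~~ w e ->
    V w * compatible_count R B (@bond_ends d) N (upd w e true) <=
    V (upd w e true) * compatible_count R B (@bond_ends d) N w.
  move=> eB we; have /mem_inner_bonds[be _] := eB.
  have [_ ee] := bond_endsP be.
  have cE : wired_config (upd w e true) = upd (wired_config w) e true.
    apply/funext => f; rewrite /wired_config /upd; case: eqP => [->|//].
    by rewrite eB.
  rewrite /V /wired_weight cE; move: ee be.
  set a := (bond_ends e).1; set b := (bond_ends e).2 => ee be.
  (* If the ends are already joined in the wired configuration, the cluster weight does not change
     and the count cannot grow. Otherwise the weight loses at most a factor 2, while the count is
     exactly halved. *)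
  have [jab|nab] := pselect (fk_cluster (wired_config w) a b).
    rewrite {1 2}ee cluster_weight_joined -?ee //; apply: ler_wpM2l; first exact/ltW/V0.
    exact: compatible_count_upd_le.
  rewrite (@compatible_count_halve _ _ _ B _ N Bl w e eB we); last first.
    apply: contra_not nab; apply: joined_sub => u v /hasP[f fB /andP[wf fe]].
    have /mem_inner_bonds[bf _] := fB; have [_ ff] := bond_endsP bf.
    have -> : [fset u; v]%fset = f.
      by rewrite ff; case/orP: fe => /eqP -> //=; rewrite fsetUC.
    by apply/asboolP; split=> //; rewrite /wired_config fB.
  rewrite mulrA [X in _ <= X * _]mulrC; apply: ler_wpM2r; first exact/ltW/compatible_count_gt0.
  rewrite ee; apply: cluster_weight_merge => //; rewrite -?ee //.
  - exact: endpoints_finite.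
  - by move=> C; apply: lt_le_trans (cluster_factor_ge1 C).
  - by exists e => //; rewrite ee fset21.
  - by exists e => //; rewrite ee fset22.
  - exact: cluster_factor_setU.
apply: le_trans (correlation_le_connection (fset_uniq B) expRN_itv Bl V0 Vloc Vadd y xN) _.
apply: eq_ler; congr (_ / _).
  rewrite -sum_override [RHS]big_mkcond; apply: eq_bigr => w _.
  rewrite fk_wired_weightE; case: asboolP => j.
    rewrite asboolT ?mulr1 //; apply: joined_sub j => u v.
    rewrite open_rel_bond // => e eB; exact: override_out.
  rewrite asboolF ?mulr0 // => k; apply: j; apply: joined_sub k => u v.
  rewrite open_rel_bond // => e eB; exact: override_out.
by rewrite -sum_override; apply: eq_bigr => w _; rewrite fk_wired_weightE.
Qed.

End WiredWeight.

(** * Walks and distances *)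

Section Walks.
Variables (R : realType) (d : nat).
Implicit Types (x y z : site d) (S : set (bond d)) (a : R).

Lemma walk_cat S x y z p q : walk S x p y -> walk S y q z -> walk S x (p ++ q) z.
Proof. by move=> [pp <-] [pq <-]; split; rewrite ?cat_path ?pp ?last_cat. Qed.

Lemma walk_sub S S' x y p : S `<=` S' -> walk S x p y -> walk S' x p y.
Proof.
move=> SS' [pp <-]; split=> //; apply: sub_path pp => u v /asboolP h.
by apply/asboolP; exact: SS'.
Qed.

Lemma walk_sym S x y p : walk S x p y -> exists2 q, walk S y q x & size q = size p.
Proof.
elim: p x => [|z p IH] x [/=]; first by move=> _ <-; exists [::].
move=> /andP[xz pz] e; have [q qw qs] := IH z (conj pz e).
exists (q ++ [:: x]); last by rewrite size_cat addn1 qs.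
by apply: walk_cat qw _; split=> //=; rewrite fsetUC xz.
Qed.

Lemma inner_bonds_sub (A A' : set (site d)) : A `<=` A' -> inner_bonds A `<=` inner_bonds A'.
Proof. by move=> AA' e [be h]; split=> // x /h /AA'. Qed.

Lemma bdist_ge S x y a :
  (a%:E <= bdist R S x y)%E <-> forall p, walk S x p y -> a <= (size p)%:R.
Proof.
split=> [h p pw|h].
  by rewrite -lee_fin; apply: le_trans h _; apply: ereal_inf_lbound; exists p.
by apply: le_ereal_inf_tmp => _ [p pw <-]; rewrite lee_fin; exact: h.
Qed.

(** Lengths are natural numbers, so a finite infimum is attained by a walk. *)
Lemma bdist_le S x y a :
  (bdist R S x y <= a%:E)%E <-> exists2 p, walk S x p y & (size p)%:R <= a.
Proof.
split=> [h|[p pw pa]]; last first.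
  by apply: le_trans (_ : (size p)%:R%:E <= _)%E => //; apply: ereal_inf_lbound; exists p.
apply: contrapT => nex.
have [[p pw]|nw] := pselect (exists p, walk S x p y); last first.
  have e : ((a + 1)%:E <= bdist R S x y)%E.
    by apply/bdist_ge => p pw; exfalso; apply: nw; exists p.
  by have := le_trans e h; rewrite lee_fin; lra.
have ex : exists n, `[< exists2 q, walk S x q y & size q = n >].
  by exists (size p); apply/asboolP; exists p.
have [m /asboolP[q qw qs] qmin] := ex_minnP ex.
have am : a < m%:R.
  rewrite ltNge; apply/negP => ma; apply: nex; exists q => //; by rewrite qs.
have e : (m%:R%:E <= bdist R S x y)%E.
  apply/bdist_ge => p' pw'; rewrite ler_nat; apply: qmin; apply/asboolP; by exists p'.
by have := le_trans e h; rewrite lee_fin leNgt am.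
Qed.

Lemma set_bdist_ge S (E F : set (site d)) a :
  (a%:E <= set_bdist R S E F)%E <->
  forall x y p, E x -> F y -> walk S x p y -> a <= (size p)%:R.
Proof.
split=> [h x y p Ex Fy|h].
  move: p; apply/bdist_ge; apply: le_trans h _; apply: ereal_inf_lbound.
  by exists (x, y).
apply: le_ereal_inf_tmp => _ [[x y] [/= Ex Fy] <-]; apply/bdist_ge => p; exact: h.
Qed.

Lemma nbhd_in_walk (D A : set (site d)) x y p a : A x -> D y ->
  walk (inner_bonds A) x p y -> (size p)%:R <= a -> nbhd_in D A a x.
Proof.
move=> Ax Dy pw pa; split=> //; apply: le_trans (_ : bdist R (inner_bonds A) x y <= _)%E.
  by apply: ereal_inf_lbound; exists (x, y).
by apply/bdist_le; exists p.
Qed.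

End Walks.

Section Degree.
Variable d : nat.
Implicit Types (x y : site d) (N : {fset (site d)}).

(** All vectors with entries -1, 0, 1, a convenient superset of the unit vectors; its size serves as
    a bound on the degree. *)
Definition offsets : seq (site d) :=
  [seq \row_i ((k 0 i : nat)%:Z - 1) | k : 'rV['I_3]_d <- enum {: 'rV['I_3]_d}].

Lemma nearest_neighbors_offset x y : nearest_neighbors x y -> exists2 o, o \in offsets & y = x + o.
Proof.
move=> xy; exists (y - x); last by rewrite addrC subrK.
have b i : (x 0 i - y 0 i) ^+ 2 <= 1.
  rewrite -xy (bigD1 i) //= lerDl; apply: sumr_ge0 => j _; exact: sqr_ge0.
apply/mapP; exists (\row_(i < d) inord (absz (y 0 i - x 0 i + 1))); first by rewrite mem_enum.
apply/rowP => i; rewrite !mxE.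
have /andP[bi1 bi2] : -1 <= x 0 i - y 0 i <= 1.
  by rewrite -ler_norml -(@expr_le1 _ 2) // -normrX ger0_norm ?sqr_ge0.
by move: (x 0 i) (y 0 i) bi1 bi2 => u v bi1 bi2; rewrite inordK; lia.
Qed.

Definition bonds_at N : seq (bond d) := [seq [fset x; (x + o)%R]%fset | x <- N, o <- offsets].

Lemma touching_bonds_at N : touching_bonds [set` N] `<=` [set` bonds_at N].
Proof.
move=> e [[x [y [xy ->]]] [z ze zN]]; apply/allpairsP.
case/fset2P: ze zN => -> zN.
  by have [k kin ->] := nearest_neighbors_offset xy; exists (x, k); split.
have [k kin xE] := nearest_neighbors_offset (nearest_neighbors_sym xy).
by exists (y, k); split=> //=; rewrite fsetUC {1}xE.
Qed.

Lemma touching_bonds_finite N : finite_set (touching_bonds [set` N]).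
Proof. apply: sub_finite_set (@touching_bonds_at N) _; exact: finite_seq. Qed.

Definition touching_fset N : {fset (bond d)} := fset_set (touching_bonds [set` N]).

Lemma mem_touching N e : e \in touching_fset N <-> touching_bonds [set` N] e.
Proof. by rewrite /touching_fset in_fset_set ?inE //; exact: touching_bonds_finite. Qed.

Lemma size_touching N : (size (touching_fset N) <= size N * size offsets)%N.
Proof.
rewrite -(size_allpairs (fun x o => [fset x; (x + o)%R]%fset)).
apply: uniq_leq_size; first exact: fset_uniq.
by move=> e /mem_touching; exact: touching_bonds_at.
Qed.

Lemma mem_inner_touching N e : e \in inner_bonds_fset N -> e \in touching_fset N.
Proof.
move=> /mem_inner_bonds[be h]; apply/mem_touching; split=> //.
have [_ eE] := bond_endsP be; exists (bond_ends e).1; last apply: h; by rewrite [in X in _ \in X]eE fset21.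
Qed.

Definition boundary_bonds N := [seq e <- touching_fset N | e \notin inner_bonds_fset N].

Definition inner_end N (e : bond d) :=
  if (bond_ends e).1 \in N then (bond_ends e).1 else (bond_ends e).2.
Definition outer_end N (e : bond d) :=
  if (bond_ends e).1 \in N then (bond_ends e).2 else (bond_ends e).1.

Lemma boundary_bondsP N e : e \in boundary_bonds N ->
  [/\ bonds e, inner_end N e \in N, outer_end N e \notin N &
      e = [fset inner_end N e; outer_end N e]%fset].
Proof.
rewrite mem_filter => /andP[/negP ein /mem_touching[be [x xe xN]]].
have [_ eE] := bond_endsP be.
have nin : ~ ((bond_ends e).1 \in N /\ (bond_ends e).2 \in N).
  move=> [h1 h2]; apply: ein; apply/mem_inner_bonds; split=> // y; rewrite eE.
  by case/fset2P => ->.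
rewrite /inner_end /outer_end; split=> //.
- have xe' : x \in [fset (bond_ends e).1; (bond_ends e).2]%fset by rewrite -eE.
  by case: ifPn => // h1; case/fset2P: xe' xN => -> //= h; rewrite h in h1.
- case: ifPn => // h1; apply/negP => h2; exact: nin.
- by case: ifPn; rewrite // fsetUC.
Qed.

Lemma size_boundary_bonds N : (size (boundary_bonds N) <= size N * size offsets)%N.
Proof. by apply: leq_trans (size_touching N); rewrite size_filter count_size. Qed.

End Degree.

(** * The Ising weight and its boundary fields *)

Section Fields.
Variables (R : rcfType) (T : eqType).
Implicit Types (el : seq (T * T * R)) (gl : seq (T * R)) (l : seq T) (s : T -> bool).

Lemma fields_weight_cat gl gl' s : fields_weight (gl ++ gl') s = fields_weight gl s * fields_weight gl' s.
Proof. by rewrite /fields_weight big_cat. Qed.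

Lemma edges_weight_cat el el' s : edges_weight (el ++ el') s = edges_weight el s * edges_weight el' s.
Proof. by rewrite /edges_weight big_cat. Qed.

Lemma weight_perm_fields el gl gl' s : perm_eq gl gl' -> weight el gl s = weight el gl' s.
Proof. by move=> p; rewrite /weight /fields_weight (perm_big _ p). Qed.

(** The fields are changed one by one; a field already changed joins [gl], which is why the
    induction lets [gl] vary. *)
Lemma fields_influence (I : eqType) el gl l x (r : seq I) (pos : I -> T) (a a' : I -> R) s :
  uniq l -> edges_in l el -> fields_in l gl -> ferromagnetic el -> pos_fields gl -> x \in l ->
  (forall i, i \in r -> [/\ pos i \in l, 0 < a i & 0 < a' i]) ->
  mean l (weight el ([seq (pos i, a i) | i <- r] ++ gl)) (fun t => (t x)%:R) s -
  mean l (weight el ([seq (pos i, a' i) | i <- r] ++ gl)) (fun t => (t x)%:R) s <=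
  \sum_(i <- r | a i != a' i) correlation el l x (pos i).
Proof.
move=> ul ein + h + xl; elim: r gl => [|i r IH] gl fin hg hr /=; first by rewrite big_nil subrr.
have [pil ai ai'] := hr i (mem_head _ _).
have {}hr j : j \in r -> [/\ pos j \in l, 0 < a j & 0 < a' j].
  by move=> jr; apply: hr; rewrite inE jr orbT.
pose m f b := mean l (weight el ((pos i, b) :: [seq (pos i, f i) | i <- r] ++ gl))
  (fun t => (t x)%:R) s.
rewrite -!/(m _ _).
have h1 : m a (a i) - m a (a' i) <= if a i != a' i then correlation el l x (pos i) else 0.
  case: eqP => [->|_] /=; first by rewrite subrr.
  apply: field_influence => //.
    rewrite /fields_in all_cat -/(fields_in l gl) fin andbT all_map.
    by apply/allP => j /hr[].
  rewrite /pos_fields all_cat -/(pos_fields gl) hg andbT all_map.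
  by apply/allP => j /hr[].
have h2 : m a (a' i) - m a' (a' i) <= \sum_(i <- r | a i != a' i) correlation el l x (pos i).
  have mE f : m f (a' i) = mean l (weight el ([seq (pos i, f i) | i <- r] ++ (pos i, a' i) :: gl))
      (fun t => (t x)%:R) s.
    apply: (@eq_mean_weight _ _ _ _ _ _ _ 1) => [|t _]; first exact: oner_neq0.
    rewrite mul1r; apply: weight_perm_fields.
    by rewrite -[in X in perm_eq X _]cat1s -[X in perm_eq _ (_ ++ X)]cat1s perm_catCA.
  rewrite !mE; apply: IH => //=; by rewrite ?pil ?ai'.
rewrite big_cons; move: h1 h2; case: ifP => _; lra.
Qed.

End Fields.

Section SpinWeight.
Variables (R : realType) (d : nat) (beta : R) (gl : seq (site d * R)).
Implicit Types (N Tht : {fset (site d)}) (s t : config d).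
Let t0 : R := expR (- beta).

Definition fields_at N := [seq f <- gl | f.1 \in N].

(** The Ising weight normalized so that an agreeing bond has weight 1. The list [gl] is left free so
    that a change of boundary spins can be expressed by additional fields. *)
Definition spin_weight N s : R :=
  weight (edge_list (touching_fset N) (@bond_ends d) t0) (fields_at N) s.

Definition inner_edges N := edge_list (inner_bonds_fset N) (@bond_ends d) t0.

(** A bond to a frozen plus spin acts on its inner end as the constant [t0] times a field [t0^-1]; a
    bond to a frozen minus spin acts as a field [t0]. *)
Definition boundary_field (b : bool) : R := if b then t0^-1 else t0.

Definition boundary_fields N s : seq (site d * R) :=
  [seq (inner_end N e, boundary_field (s (outer_end N e))) | e <- boundary_bonds N] ++
  fields_at N.

Hypotheses (beta_ge0 : 0 <= beta) (gl_pos : pos_fields gl).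

Let t0_gt0 : 0 < t0. Proof. exact: expR_gt0. Qed.
Let t0_itv : 0 < t0 <= 1. Proof. exact: expRN_itv. Qed.

Lemma ferromagnetic_edge_list (r : seq (bond d)) : ferromagnetic (edge_list r (@bond_ends d) t0).
Proof. by apply/allP => _ /mapP[e _ ->]. Qed.

Lemma pos_fields_filter (P : pred (site d * R)) : pos_fields [seq f <- gl | P f].
Proof. by apply/allP => f; rewrite mem_filter => /andP[_ fgl]; exact: (allP gl_pos). Qed.

Lemma boundary_field_gt0 b : 0 < boundary_field b.
Proof. by case: b; rewrite /boundary_field ?invr_gt0. Qed.

Lemma fields_in_boundary N s : fields_in N (boundary_fields N s).
Proof.
rewrite /fields_in all_cat; apply/andP; split; last exact: filter_all.
by apply/allP => _ /mapP[e eN ->] /=; case: (boundary_bondsP eN).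
Qed.

Lemma edges_in_inner N : edges_in N (inner_edges N).
Proof. by apply/allP => _ /mapP[e /inner_bonds_ends eN ->]. Qed.

Lemma spin_weight_gt0 N s : 0 < spin_weight N s.
Proof. by apply: weight_gt0; [exact: ferromagnetic_edge_list | exact: pos_fields_filter]. Qed.

Lemma edges_weight_edge_list (r : seq (bond d)) s :
  edges_weight (edge_list r (@bond_ends d) t0) s =
  \prod_(e <- r) (if s (bond_ends e).1 == s (bond_ends e).2 then 1 else t0).
Proof. by rewrite /edges_weight big_map. Qed.

(** The spatial Markov property: bonds not touching [N] and fields off [N] see frozen spins only and
    contribute a constant. *)
Lemma spin_weight_restrict N Tht s : (N `<=` Tht)%fset ->
  exists2 c, c != 0 & forall t, agree_off N s t -> spin_weight Tht t = c * spin_weight N t.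
Proof.
move=> /fsubsetP NT.
pose r := [seq e <- touching_fset Tht | e \notin touching_fset N].
have pr : perm_eq (touching_fset Tht) (touching_fset N ++ r).
  rewrite perm_sym perm_catC perm_sym; apply: perm_filter_cat; rewrite ?fset_uniq // => e.
  by move=> /mem_touching[be [x xe xN]]; apply/mem_touching; split=> //; exists x => //; exact: NT.
pose q := [seq f <- fields_at Tht | f.1 \notin N].
have pq : perm_eq (fields_at Tht) (fields_at N ++ q).
  rewrite -(perm_filterC (fun f => f.1 \in N) (fields_at Tht)) perm_cat2r.
  rewrite /fields_at -filter_predI; apply/permPl; rewrite (@eq_filter _ _ (fun f => f.1 \in N)) //.
  by move=> f /=; apply: andb_idr; exact: NT.
exists (weight (edge_list r (@bond_ends d) t0) q s).
  rewrite gt_eqF // weight_gt0 // ?ferromagnetic_edge_list //.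
  by apply/allP => f; rewrite !mem_filter => /and3P[_ _ fgl]; exact: (allP gl_pos).
move=> t st; rewrite /spin_weight (weight_perm_fields _ _ pq).
rewrite [LHS](weight_perm (el' := edge_list (touching_fset N ++ r) (@bond_ends d) t0)); last first.
  exact: (perm_map (fun e => (bond_ends e, t0)) pr).
rewrite /edge_list map_cat /weight edges_weight_cat fields_weight_cat -!/(edge_list _ _ _).
rewrite mulrACA [LHS]mulrC; congr (_ * _ * _).
  rewrite !edges_weight_edge_list; apply: eq_big_seq => e; rewrite mem_filter => /andP[/negP eN eT].
  have /mem_touching[be _] := eT; have [_ eE] := bond_endsP be.
  have out x : x \in [fset (bond_ends e).1; (bond_ends e).2]%fset -> t x = s x.
    rewrite -eE => xe; apply: st; apply/negP => xN; apply: eN; apply/mem_touching; split=> //.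
    by exists x.
  by rewrite !out ?fset21 ?fset22.
apply: eq_big_seq => f; rewrite mem_filter => /andP[xN _].
by rewrite /field_weight /= st.
Qed.

Lemma spin_weight_boundary N s :
  exists2 c, c != 0 & forall t, agree_off N s t ->
    spin_weight N t = c * weight (inner_edges N) (boundary_fields N s) t.
Proof.
exists (\prod_(e <- boundary_bonds N) if s (outer_end N e) then t0 else 1).
  rewrite gt_eqF // prodr_gt0 // => e _; by case: (s _).
move=> t st; rewrite /spin_weight /weight /boundary_fields fields_weight_cat !mulrA; congr (_ * _).
have p : perm_eq (touching_fset N) (boundary_bonds N ++ inner_bonds_fset N).
  by apply: perm_filter_cat; rewrite ?fset_uniq //; exact: mem_inner_touching.
rewrite !edges_weight_edge_list (perm_big _ p) big_cat /= mulrAC; congr (_ * _).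
rewrite /fields_weight big_map -big_split; apply: eq_big_seq => e eb.
have [be iN oN eE] := boundary_bondsP eb.
rewrite /field_weight /boundary_field /= -(st _ oN).
have -> : (t (bond_ends e).1 == t (bond_ends e).2) = (t (inner_end N e) == t (outer_end N e)).
  by rewrite /inner_end /outer_end; case: ifP => // _; rewrite eq_sym.
by case: (t _) (t _) => [] []; rewrite /= ?mulr1 ?mul1r ?mulfV ?gt_eqF.
Qed.

Lemma mean_restrict N Tht F s : (N `<=` Tht)%fset ->
  mean N (spin_weight Tht) F s = mean N (weight (inner_edges N) (boundary_fields N s)) F s.
Proof.
move=> NT; have [c c0 hc] := spin_weight_restrict s NT.
have [c' c'0 hc'] := spin_weight_boundary N s.
by rewrite (eq_mean_weight _ c0 hc) (eq_mean_weight _ c'0 hc').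
Qed.

Lemma mean_local el fl (l : seq (site d)) (F : config d -> R) s t : edges_in l el -> fields_in l fl ->
  (forall s t, (forall x, x \in l -> s x = t x) -> F s = F t) ->
  mean l (weight el fl) F s = mean l (weight el fl) F t.
Proof.
move=> he hg hF; rewrite /mean; congr (_ / _); apply: sumc_local => u v uv.
  by rewrite (weight_local he hg uv) (hF _ _ uv).
exact: weight_local uv.
Qed.

(** Inside [N] the two boundary configurations differ only by the fields of the bonds whose outer
    spins differ, and [fields_influence] sums their effects. *)
Lemma boundary_influence N Tht y s s' (eps : R) : (N `<=` Tht)%fset -> y \in N -> 0 <= eps ->
  (forall e, e \in boundary_bonds N -> s (outer_end N e) != s' (outer_end N e) ->
     correlation (inner_edges N) N y (inner_end N e) <= eps) ->
  mean N (spin_weight Tht) (fun t => (t y)%:R) s - mean N (spin_weight Tht) (fun t => (t y)%:R) s' <=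
  (size (boundary_bonds N))%:R * eps.
Proof.
move=> NT yN eps0 hcor; rewrite !mean_restrict //.
rewrite (@mean_local _ _ _ _ s' s) ?edges_in_inner ?fields_in_boundary //; last by move=> u v ->.
apply: le_trans (fields_influence _ _ _ _ _ _ yN _) _.
- exact: fset_uniq.
- exact: edges_in_inner.
- exact: filter_all.
- exact: ferromagnetic_edge_list.
- exact: pos_fields_filter.
- by move=> e /boundary_bondsP[_ ? _ _]; split=> //; exact: boundary_field_gt0.
rewrite -sum1_size natr_sum mulr_suml big_mkcond [leLHS]big_seq [leRHS]big_seq; apply: ler_sum => e eN.
rewrite mul1r; case: ifP => // ne; apply: hcor => //.
by apply: contraTneq ne => ->; rewrite eqxx.
Qed.

End SpinWeight.

(** * Decay of field-free spin correlations in the class *)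

Section Decay.
Variables (R : realType) (d : nat) (beta h : R).
Hypothesis beta_ge0 : 0 <= beta.
Implicit Types N : {fset (site d)}.

(** The decay hypothesis speaks of endpoints of bonds only. A site of [N] without a bond inside [N]
    is joined to no other site. *)
Lemma wired_connection_isolated N x u :
  x != u -> ~ (endpoints [set` inner_bonds_fset N] x /\ endpoints [set` inner_bonds_fset N] u) ->
  fk_wired_connection beta h (inner_bonds_fset N) x u = 0.
Proof.
move=> xu nend; rewrite /fk_wired_connection big_pred0 ?mul0r // => w; apply/asboolPn => xw.
have first a b : a != b -> fk_cluster (override w xpred0) a b ->
    endpoints [set` inner_bonds_fset N] a.
  move=> ab [[|c p] [/=]]; first by move=> _ ca; rewrite ca eqxx in ab.
  move=> /andP[/asboolP[_ we] _ _]; exists [fset a; c]%fset; last exact: fset21.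
  by apply/negPn/negP => eB; move: we; rewrite override_out.
apply: nend; split; first exact: first xw.
by apply: first (fk_cluster_sym xw); rewrite eq_sym.
Qed.

Lemma correlation_decay (L : set {fset (site d)}) (C lam : R) : 0 < C -> 0 < lam ->
  (forall (B : {fset (bond d)}) (x y : site d),
    [set fset_set (inner_bonds [set` Lam]) | Lam in L] B ->
    endpoints [set` B] x -> endpoints [set` B] y ->
    ((fk_wired_connection beta h B x y)%:E <=
       C%:E * expeR (- (lam%:E * bdist R [set` B] x y)))%E) ->
  forall N x u a, L N -> x \in N -> u \in N ->
  (forall p, walk (inner_bonds [set` N]) x p u -> a <= (size p)%:R) ->
  correlation (inner_edges beta N) N x u <= Num.max C 1 * expR (- (lam * a)).
Proof.
move=> C0 lam0 dec N x u a LN xN uN gap.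
have max0 : 0 <= Num.max C 1 by rewrite le_max ler01 orbT.
(* Coinciding sites may be isolated in [N], beyond the reach of the hypothesis. Their correlation is
   1 and the empty walk forces [a <= 0]; this is the reason for the maximum with 1. *)
have [xu|xu] := eqVneq x u.
  rewrite -xu correlation_id; last exact: ferromagnetic_edge_list.
  have a0 : a <= 0 by have := gap [::]; apply; rewrite xu.
  rewrite -[leLHS]mulr1; apply: ler_pM => //; first by rewrite le_max lexx orbT.
  by rewrite -expR0 ler_expR oppr_ge0 pmulr_rle0.
apply: le_trans (correlation_le_wired h beta_ge0 u xN) _.
have [[ex eu]|nend] := pselect (endpoints [set` inner_bonds_fset N] x /\
    endpoints [set` inner_bonds_fset N] u); last first.
  by rewrite wired_connection_isolated // mulr_ge0 ?expR_ge0.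
have BE : [set` inner_bonds_fset N] = inner_bonds [set` N].
  by rewrite fset_setK //; exact: inner_bonds_finite.
have := dec _ _ _ (ex_intro2 _ _ N LN erefl) ex eu; rewrite BE => h1.
rewrite -lee_fin; apply: le_trans h1 _; rewrite EFinM.
apply: lee_pmul; rewrite ?lee_fin ?(ltW C0) ?expeR_ge0 //; first by rewrite le_max lexx.
rewrite -[X in (_ <= X)%E]/(expeR (- (lam * a))%:E) lee_expeR EFinN leeN2 EFinM.
by apply: lee_wpmul2l; [rewrite lee_fin ltW | apply/bdist_ge].
Qed.

End Decay.

(** * Exponential decay: disjoint occurrence and mixing *)

Section Occurrence.
Variable d : nat.
Implicit Types (s t : config d) (A B : set (config d)) (E F : set (site d)).

Lemma occurs_on_in A E s : occurs_on A E s -> A s.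
Proof. by move=> h; exact: h. Qed.

Lemma occurs_on_agree A E s t : (forall y, E y -> t y = s y) -> occurs_on A E s -> occurs_on A E t.
Proof. by move=> st h u ut; apply: h => y Ey; rewrite ut // st. Qed.

Lemma le_conf_le s t : le_conf s t <-> forall x, (s x <= t x)%O.
Proof.
split=> h x; have := h x; first by case: (s x) => // /(_ isT) ->.
by case: (s x) (t x) => [] [].
Qed.

Lemma occurs_on_increasing A E s t : increasing_event A -> le_conf s t ->
  occurs_on A E s -> occurs_on A E t.
Proof.
move=> iA st h u ut.
pose v : config d := fun x => if `[< E x >] then s x else u x.
apply: (iA v); last by apply: h => x Ex; rewrite /v asboolT.
apply/le_conf_le => x; rewrite /v; case: asboolP => // Ex; rewrite ut //; exact: st.
Qed.

Lemma occurs_on_decreasing A E s t : decreasing_event A -> le_conf s t ->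
  occurs_on A E t -> occurs_on A E s.
Proof.
move=> iA st h u us.
pose v : config d := fun x => if `[< E x >] then t x else u x.
apply: (iA u v); last by apply: h => x Ex; rewrite /v asboolT.
apply/le_conf_le => x; rewrite /v; case: asboolP => // Ex; rewrite us //; exact: st.
Qed.

Lemma occurs_apart_sub (R : realType) (Lam : set (site d)) (r : R) A B :
  occurs_apart Lam r A B `<=` A `&` B.
Proof. by move=> s [E [F [_ _ _ hA hB]]]; split; [exact: occurs_on_in hA | exact: occurs_on_in hB]. Qed.

End Occurrence.

Definition indicp (R : realType) (P : Prop) : R := (`[< P >])%:R.

Lemma indicp_ge0 (R : realType) (P : Prop) : 0 <= indicp R P. Proof. exact: ler0n. Qed.
Lemma indicp_le1 (R : realType) (P : Prop) : indicp R P <= 1.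
Proof. by rewrite /indicp; case: asboolP. Qed.
Lemma indicp_le (R : realType) (P Q : Prop) : (P -> Q) -> indicp R P <= indicp R Q.
Proof. by rewrite /indicp => h; case: asboolP => [/h q|_]; [rewrite asboolT | exact: ler0n]. Qed.

Lemma mem_seq_fset (T : choiceType) (s : seq T) z : (z \in [fset y in s]%fset) = (z \in s).
Proof. by rewrite in_fset. Qed.

Lemma mean_fkg (R : realFieldType) (T : eqType) (W F G : (T -> bool) -> R) l s :
  (forall u, 0 < W u) -> (forall u, 0 <= F u) -> (forall u, 0 <= G u) ->
  lattice_weight W -> isotone F -> isotone G ->
  mean l W F s * mean l W G s <= mean l W (fun t => F t * G t) s.
Proof.
move=> W0 F0 G0 lat iF iG; have S0 := sumc_gt0 l s W0.
have := fkg l s (fun u => ltW (W0 u)) F0 G0 lat iF iG.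
rewrite (@eq_sumc _ _ l (fun u => W u * F u * G u) (fun u => W u * (F u * G u))) => [h|t _]; last first.
  by rewrite mulrA.
rewrite /mean mulrACA -invfM ler_pdivrMr ?mulr_gt0 // mulrA divfK //.
by rewrite gt_eqF.
Qed.

Section NearIndependence.
Variables (R : realFieldType) (T : eqType) (W : (T -> bool) -> R).
Hypothesis W0 : forall t, 0 < W t.
Implicit Types (l : seq T) (F H : (T -> bool) -> R).

Lemma mean_near l1 l2 F s t dl :
  (forall u v, agree_off (l1 ++ l2) s u -> agree_off (l1 ++ l2) s v ->
     mean l2 W F u - mean l2 W F v <= dl) -> agree_off (l1 ++ l2) s t ->
  mean l2 W F t <= mean (l1 ++ l2) W F s + dl /\ mean (l1 ++ l2) W F s <= mean l2 W F t + dl.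
Proof.
move=> h st; rewrite [mean (l1 ++ l2) W F s]mean_tower //; split.
  rewrite -[leLHS](mean_cst W0 (l1 ++ l2) _ s) -[dl in leRHS](mean_cst W0 (l1 ++ l2) _ s).
  by rewrite -meanD //; apply: ler_mean => // u su; rewrite -lerBlDl; exact: h.
rewrite -[leRHS](mean_cst W0 (l1 ++ l2) _ s).
by apply: ler_mean => // u su; rewrite -lerBlDl; exact: h.
Qed.

(** [H] is a function of the spins off [l2], so [F] can be replaced by its conditional mean given
    these, which stays within [dl] of [p]. *)
Lemma mean_near_independent l1 l2 F H s dl :
  (forall u v, agree_off (l1 ++ l2) s u -> agree_off (l1 ++ l2) s v ->
     mean l2 W F u - mean l2 W F v <= dl) ->
  (forall t u, agree_off l2 t u -> H u = H t) -> (forall t, 0 <= H t) ->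
  let p := mean (l1 ++ l2) W F s in let q := mean (l1 ++ l2) W H s in
  mean (l1 ++ l2) W (fun t => F t * H t) s <= (p + dl) * q /\
  (p - dl) * q <= mean (l1 ++ l2) W (fun t => F t * H t) s.
Proof.
move=> h HH H0 p q.
have tower : mean (l1 ++ l2) W (fun t => F t * H t) s =
   mean (l1 ++ l2) W (fun t => mean l2 W F t * H t) s.
  rewrite mean_tower //; apply: eq_mean => t _; rewrite mulrC -meanZ //.
  by apply: eq_mean => u tu; rewrite (HH _ _ tu) mulrC.
rewrite tower -!meanZ //; split; apply: ler_mean => // t st; apply: ler_wpM2r => //.
  by case: (mean_near h st).
by rewrite lerBlDr; case: (mean_near h st).
Qed.

End NearIndependence.

(** [p], [q] and [b] stand for the probabilities that a spin is plus, that an event occurs, and that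
    both hold; the quotient is the probability of the event once the plus spin gets an extra weight
    [g]. The upper bound on [b] serves for [g >= 1], the lower one for [g < 1]. *)
Lemma tilt_ratio (R : realFieldType) (k g dl p q b : R) :
  0 <= p <= 1 -> 0 <= q -> 0 <= dl -> 1 <= k -> k^-1 <= g -> g <= k ->
  b <= (p + dl) * q -> (p - dl) * q <= b -> b <= q ->
  (g * b + (q - b)) / (g * p + (1 - p)) <= (1 + k * dl) * q.
Proof.
move=> /andP[p0 p1] q0 dl0 k1 gk1 gk hb hb' bq.
have k0 : 0 < k by lra.
have g0 : 0 < g by apply: lt_le_trans gk1; rewrite invr_gt0.
have den : 0 < g * p + (1 - p) by nra.
rewrite ler_pdivrMr //.
have dq : 0 <= dl * q by rewrite mulr_ge0.
have gkk : 1 <= g * k by rewrite -ler_pdivrMr // mul1r.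
have [g1|g1] := leP 1 g.
  have e1 : g * b + (q - b) <= q * (g * p + (1 - p)) + (g - 1) * (dl * q).
    have := ler_wpM2l (_ : 0 <= g - 1) hb; rewrite subr_ge0 => /(_ g1); nra.
  apply: le_trans e1 _.
  have d1 : 1 <= g * p + (1 - p) by nra.
  have : (g - 1) * (dl * q) <= k * (dl * q) * (g * p + (1 - p)).
    apply: le_trans (_ : k * (dl * q) <= _); first by apply: ler_wpM2r => //; lra.
    by rewrite ler_peMr // mulr_ge0 // ltW.
  by nra.
have e1 : g * b + (q - b) <= q * (g * p + (1 - p)) + (1 - g) * (dl * q).
  have := ler_wpM2l (_ : 0 <= 1 - g) hb'; rewrite subr_ge0 => /(_ (ltW g1)); nra.
apply: le_trans e1 _.
have d1 : g <= g * p + (1 - p) by nra.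
have : (1 - g) * (dl * q) <= k * (dl * q) * (g * p + (1 - p)).
  apply: le_trans (_ : 1 * (dl * q) <= _); first by apply: ler_wpM2r => //; lra.
  apply: le_trans (_ : k * g * (dl * q) <= _); first by apply: ler_wpM2r => //; rewrite mulrC.
  by rewrite mulrAC; apply: ler_wpM2l => //; rewrite mulr_ge0 // ltW.
by nra.
Qed.

Section ExponentialDecay.
Variables (R : realType) (d : nat) (beta : R).
Hypothesis beta_ge0 : 0 <= beta.
Variables (L : set {fset (site d)}) (c0 M lam : R).
Hypotheses (c0_gt1 : 1 < c0) (M_ge1 : 1 <= M) (lam_gt0 : 0 < lam).
Hypothesis approx : forall (Lam : {fset (site d)}) (x : site d) (r : R),
  L Lam -> x \in Lam -> 1 <= r -> exists2 N, L N & approx_nbhd c0 r Lam x N.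
Hypothesis decay : forall N x u a, L N -> x \in N -> u \in N ->
  (forall p, walk (inner_bonds [set` N]) x p u -> a <= (size p)%:R) ->
  correlation (inner_edges beta N) N x u <= M * expR (- (lam * a)).

Lemma size_offsets_gt0 : (0 < size (offsets d))%N.
Proof. by rewrite size_map -cardE card_mx expn_gt0 card_ord. Qed.

(** A bound on the number of boundary bonds in a volume of [n] sites, times the correlation over a
    distance [a / c0 - 1]; the lost step produces [expR lam]. *)
Definition site_error (n : nat) (a : R) : R :=
  (n * size (offsets d))%:R * (M * expR lam) * expR (- (lam / c0 * a)).

Lemma site_error_ge0 n a : 0 <= site_error n a.
Proof. by rewrite /site_error !mulr_ge0 ?expR_ge0 ?(le_trans ler01 M_ge1). Qed.

(** Approximate neighborhoods exist only for radius at least 1. Below, the error is at least 1 and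
    hence bounds any difference of probabilities. *)
Lemma site_error_ge1 n a : (0 < n)%N -> a < 1 -> 1 <= site_error n a.
Proof.
move=> n0 a1; have c00 : 0 < c0 by exact: lt_trans ltr01 c0_gt1.
rewrite /site_error -mulrA -[leLHS]mul1r; apply: ler_pM => //.
  by rewrite -[1]/(1%:R) ler_nat muln_gt0 size_offsets_gt0 andbT.
rewrite -mulrA -[leLHS]mul1r; apply: ler_pM => //.
rewrite -expRD -expR0 ler_expR subr_ge0 mulrAC ler_pdivrMr //.
by rewrite ler_pM2l //; exact: ltW (lt_trans a1 c0_gt1).
Qed.

(* Given the spins outside an approximate neighborhood N of y, the spins far from y act on N
   only through fields at the ends of its boundary bonds, which are far from y as well. *)
Lemma single_site (gl : seq (site d * R)) (Tp Tht : {fset (site d)}) (I : seq (site d)) y a s s' :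
  pos_fields gl -> L Tp -> (Tp `<=` Tht)%fset -> uniq I -> {subset I <= Tp} -> y \in I ->
  (forall z p, z \in Tp -> z \notin I -> walk (inner_bonds [set` Tp]) y p z -> a < (size p)%:R) ->
  agree_off Tp s s' ->
  mean I (spin_weight beta gl Tht) (fun t => (t y)%:R) s -
  mean I (spin_weight beta gl Tht) (fun t => (t y)%:R) s' <= site_error #|` Tht| a.
Proof.
move=> gl0 LTp TpT uI ITp yI far ss'.
have cc := c0_gt1.
have W0 t : 0 < spin_weight beta gl Tht t by exact: spin_weight_gt0.
have yTp := ITp _ yI.
have yTht : y \in Tht by apply: (fsubsetP TpT).
have M0 : 0 <= M by exact: le_trans ler01 M_ge1.
have c00 : 0 < c0 by exact: lt_trans ltr01 c0_gt1.
have [a1|a1] := ltP a 1.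
  apply: le_trans (_ : 1 <= _).
    apply: le_trans (_ : 1 - 0 <= _); last by rewrite subr0.
    apply: lerB; last by apply: mean_ge0 => // t; exact: ler0n.
    rewrite -[leRHS](mean_cst W0 I 1 s); apply: ler_mean => // t _; by case: (t y).
  by apply: site_error_ge1 => //; rewrite cardfs_gt0; apply/fset0Pn; exists y.
have [N LN [Nsub Nsup]] := approx LTp yTp a1.
have yN : y \in N.
  apply: Nsub; split=> //; apply/bdist_le; exists [::] => //.
  by rewrite divr_ge0 // ?ltW //; lra.
have NTp : {subset N <= Tp} by move=> z /Nsup[].
(* Sites of [Tp] off [I] are farther than [a] from [y], whereas [N] has radius at most [a]. *)
have NI : {subset N <= I}.
  move=> z /Nsup[zTp /bdist_le[p pw pa]]; apply/negPn/negP => zI.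
  by have := far z p zTp zI pw; rewrite ltNge pa.
pose I' := [seq z <- I | z \notin N].
have pI : perm_eq I (I' ++ N).
  by apply: perm_filter_cat; rewrite ?fset_uniq.
rewrite !(mean_perm _ _ _ pI).
apply: (mean_cat_dist W0 (l := Tp)) => //.
  by move=> z; rewrite mem_filter => /andP[_ /ITp].
move=> t t' st st'; have NTht : (N `<=` Tht)%fset.
  by apply: fsubset_trans TpT; apply/fsubsetP.
have eps0 : 0 <= M * expR (- (lam * (a / c0 - 1))) by rewrite mulr_ge0 ?expR_ge0.
apply: le_trans (boundary_influence beta_ge0 gl0 NTht yN eps0 _) _; last first.
  rewrite /site_error -mulrA; apply: ler_pM => //.
    rewrite ler_nat; apply: leq_trans (size_boundary_bonds N) _.
    by rewrite leq_mul2r orbC; apply/orP; left; exact: fsubset_leq_card.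
  rewrite -mulrA; apply: ler_wpM2l => //; rewrite -expRD ler_expR.
  by apply: eq_ler; field; rewrite gt_eqF.
move=> e eN tt'; have [be iN oN eE] := boundary_bondsP eN.
have oTp : outer_end N e \in Tp.
  by apply: contraNT tt' => oTp; rewrite (st _ oTp) (st' _ oTp).
(* A short walk to the inner end, prolonged by the boundary bond, would place the outer end in
   [N]. *)
apply: decay => // p pw; rewrite leNgt; apply/negP => short.
move/negP: oN; apply; apply: Nsub; split=> //; apply/bdist_le.
exists (p ++ [:: outer_end N e]); last by rewrite size_cat natrD /=; lra.
apply: walk_cat (_ : walk _ _ p (inner_end N e)) _.
  by apply: walk_sub pw; apply: inner_bonds_sub => z; exact: NTp.
split=> //=; rewrite andbT -eE; apply/asboolP; split=> // z.
by rewrite eE => /fset2P[] -> //; exact: NTp.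
Qed.


(** * Recoupling along a filling order *)

Section Chain.
Variables (gl : seq (site d * R)) (Tht : {fset (site d)}) (Lam : set (site d)) (Gam r : R).
Hypotheses (gl_pos : pos_fields gl) (ThtLam : [set` Tht] `<=` Lam).

Let W := spin_weight beta gl Tht.

Hypothesis flip : forall x t b, x \in Tht -> W (upd t x b) <= Gam * W (upd t x (~~ b)).

Let W0 t : 0 < W t. Proof. exact: spin_weight_gt0. Qed.
Let W_lat : lattice_weight W.
Proof. by apply: weight_lattice; [exact: ferromagnetic_edge_list | exact: pos_fields_filter]. Qed.

(** The [- 1] turns a distance of at least [r / 2] into the strict inequality required by
    [single_site]. *)
Definition step_error : R := site_error #|` Tht| (r / 2 - 1).
(** [1 + Gam] is the inverse of the lower bound on the conditional probability of a spin value, and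
    the square is that of [odds_close]. *)
Definition step_factor : R := (1 + step_error * (1 + Gam)) ^+ 2.

Let err0 : 0 <= step_error. Proof. exact: site_error_ge0. Qed.

Lemma flip_sumc x l t b : x \in Tht -> x \notin l ->
  sumc l W (upd t x b) <= Gam * sumc l W (upd t x (~~ b)).
Proof.
move=> xT xl; rewrite !sumc_upd_out // -sumcZ; apply: ler_sumc => u _; exact: flip.
Qed.

Section SameDirection.
Variables (A B : set (config d)).

Definition apart (s t : config d) : Prop := exists E F : set (site d),
  [/\ E `<=` Lam, F `<=` Lam, (r%:E <= set_bdist R (inner_bonds Lam) E F)%E,
      occurs_on A E s & occurs_on B F t].

Definition apart_ind s t : R := indicp R (apart s t).

Hypothesis same_direction : (increasing_event A /\ increasing_event B) \/
  (decreasing_event A /\ decreasing_event B).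

(* Of two sets at distance r, at most one comes within r/2 of x. *)
Lemma apart_factor x (J : seq (site d)) u v :
  (forall y, y \in J -> exists2 p, walk (inner_bonds Lam) x p y & (size p)%:R < r / 2) ->
  exists U V : config d -> R, [/\ forall t, 0 <= U t <= 1, forall t, 0 <= V t <= 1,
    (isotone U /\ isotone V) \/ (isotone (fun t => 1 - U t) /\ isotone (fun t => 1 - V t)) &
    forall t t', agree_off J u t -> agree_off J v t' -> apart_ind t t' = 1 - U t * V t'].
Proof.
move=> near.
(* When the set for B avoids [J], B can be read in the fixed far configuration [v], and only the
   first sample matters; [PV] is the symmetric alternative. The event is the disjunction of the two,
   so its indicator is 1 minus the product of the complementary indicators. *)
pose PU t := exists E F : set (site d),
  [/\ E `<=` Lam /\ F `<=` Lam, (r%:E <= set_bdist R (inner_bonds Lam) E F)%E,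
      occurs_on A E t, occurs_on B F v & forall y, F y -> y \notin J].
pose PV t := exists E F : set (site d),
  [/\ E `<=` Lam /\ F `<=` Lam, (r%:E <= set_bdist R (inner_bonds Lam) E F)%E,
      occurs_on A E u, occurs_on B F t & forall y, E y -> y \notin J].
have compl P : 1 - indicp R (~ P) = indicp R P.
  by rewrite /indicp asbool_neg; case: asboolP => _; rewrite /= ?subr0 ?subrr.
exists (fun t => indicp R (~ PU t)), (fun t => indicp R (~ PV t)); split.
- by move=> t; rewrite indicp_ge0 indicp_le1.
- by move=> t; rewrite indicp_ge0 indicp_le1.
- case: same_direction => -[mA mB].
    right; split=> s t st; rewrite !compl; apply: indicp_le => -[E [F [EF g oA oB h]]];
      exists E, F; split=> //; exact: occurs_on_increasing st _.
  left; split=> s t st; apply: indicp_le; apply: contra_not => -[E [F [EF g oA oB h]]];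
    exists E, F; split=> //; exact: occurs_on_decreasing st _.
move=> t t' ut vt'.
have eqv : apart t t' <-> PU t \/ PV t'.
  split=> [[E [F [EL FL g oA oB]]]|].
    have [FJ|/existsNP[f /not_implyP[Ff /negP/negPn fJ]]] := pselect (forall y, F y -> y \notin J).
      left; exists E, F; split=> //; apply: occurs_on_agree oB => y /FJ yJ.
      by rewrite vt'.
    have EJ y : E y -> y \notin J.
      move=> Ey; apply/negP => yJ.
      have [p pw ps] := near _ yJ; have [q qw qs] := near _ fJ.
      have [p' pw' ps'] := walk_sym pw.
      have := (set_bdist_ge _ _ _ _).1 g _ _ _ Ey Ff (walk_cat pw' qw).
      by rewrite size_cat natrD ps'; lra.
    by right; exists E, F; split=> //; apply: occurs_on_agree oA => y /EJ yJ; rewrite ut.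
  case=> -[E [F [[EL FL] g oA oB h]]]; exists E, F; split=> //.
    by apply: occurs_on_agree oB => y /h yJ; rewrite vt'.
  by apply: occurs_on_agree oA => y /h yJ; rewrite ut.
rewrite /apart_ind /indicp; move: eqv.
case: asboolP => [h e|h e]; case: asboolP => a; case: asboolP => b; rewrite ?mulr0 ?mul0r ?mulr1 ?subr0 ?subrr //.
- by case: (e.1 h).
- by exfalso; apply: h; apply/e; right; exact: contrapT.
- by exfalso; apply: h; apply/e; left; exact: contrapT.
- by exfalso; apply: h; apply/e; left; exact: contrapT.
Qed.

Lemma rate_ge0 x : x \in Tht -> 0 <= Gam.
Proof.
move=> xT; have := flip (fun=> false) true xT; rewrite leNgt => /negP h.
rewrite leNgt; apply/negP => g; apply: h.
by apply: lt_trans (W0 _); rewrite nmulr_rlt0.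
Qed.

Lemma step_factor_ge1 : (0 < #|` Tht|)%N -> 1 <= step_factor.
Proof.
rewrite cardfs_gt0 => /fset0Pn[x xT]; rewrite /step_factor exprn_ege1 // lerDl mulr_ge0 // addr_ge0 //.
exact: rate_ge0 xT.
Qed.

Let site_odds x l t b : x \in Tht -> x \notin l ->
  (1 + Gam)^-1 <= sumc l W (upd t x b) / (sumc l W (upd t x true) + sumc l W (upd t x false)).
Proof.
move=> xT xl; have g0 := rate_ge0 xT.
have f := flip_sumc t (~~ b) xT xl; rewrite negbK in f.
have S c : 0 < sumc l W (upd t x c) by exact: sumc_gt0.
rewrite ler_pdivlMr ?addr_gt0 // mulrC ler_pdivrMr ?ltr_wpDr // mulrDr mulr1 [X in _ <= _ + X]mulrC.
by case: b f => /= f; rewrite ?lerD2l // addrC lerD2l.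
Qed.

Lemma chain_step x l s : L [fset z in x :: l]%fset -> uniq (x :: l) -> {subset x :: l <= Tht} ->
  mean (x :: l) W (fun t => pair_mean W apart_ind l t t) s <=
  step_factor ^+ 4 * pair_mean W apart_ind (x :: l) s s.
Proof.
move=> Lxl uxl sub; have /andP[xl ul] := uxl.
have xT : x \in Tht by apply: sub; rewrite mem_head.
have g0 := rate_ge0 xT.
have n0 : (0 < #|` Tht|)%N by rewrite cardfs_gt0; apply/fset0Pn; exists x.
have sf1 := step_factor_ge1 n0.
have G0 u v : 0 <= apart_ind u v by exact: indicp_ge0.
(* For [r <= 0] not even [x] counts as close to itself. The error is then at least 1 and the crude
   step suffices. *)
have [r0|r0] := ltP 0 r; last first.
  have e1 : 1 <= step_error by apply: site_error_ge1 => //; lra.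
  have big : 1 + Gam <= step_factor ^+ 4.
    apply: le_trans (_ : step_factor <= _); last by rewrite ler_eXnr.
    have h : 1 + Gam <= step_error * (1 + Gam) by rewrite ler_peMl //; lra.
    apply: le_trans h _; rewrite /step_factor expr2; nra.
  have g1 : 0 < (1 + Gam)^-1 by rewrite invr_gt0; lra.
  apply: le_trans (@coupling_step_crude _ _ W W0 apart_ind l x s _ G0 g1 _) _.
    by move=> b /=; exact: site_odds.
  rewrite invrK; apply: ler_wpM2r => //.
  by apply: mean_ge0 => // t; apply: mean_ge0.
(* Closeness is measured in [Lam], as in the event. Walks in the prefix are walks in [Lam], so the
   sites of [K] are also far from [x] within the prefix. *)
pose close z := `[< exists2 p, walk (inner_bonds Lam) x p z & (size p)%:R < r / 2 >].
pose I := [seq z <- l | close z]; pose K := [seq z <- l | ~~ close z].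
have pl : perm_eq l (I ++ K) by rewrite perm_sym; apply/permPl; exact: perm_filterC.
have xI : x \notin I by rewrite mem_filter (negbTE xl) andbF.
have xK : x \notin K by rewrite mem_filter (negbTE xl) andbF.
apply: (coupling_step W0 W_lat (I := I) (K := K)) => //.
  move=> u v su sv; apply: apart_factor => y; rewrite inE => /predU1P[->|].
    by exists [::]; [split | rewrite mulr0n divr_gt0].
  by rewrite mem_filter => /andP[/asboolP].
have TL : [set` [fset z in x :: l]%fset] `<=` Lam.
  by move=> z /=; rewrite mem_seq_fset => zl; apply: ThtLam; exact: sub.
have single u v : agree_off K s u -> agree_off K s v ->
   mean (x :: I) W (fun t => (t x)%:R) u - mean (x :: I) W (fun t => (t x)%:R) v <= step_error.
  move=> su sv; apply: (single_site gl_pos Lxl) => //.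
  - by apply/fsubsetP => z; rewrite mem_seq_fset; exact: sub.
  - by rewrite /= xI filter_uniq.
  - by move=> z; rewrite mem_seq_fset !inE mem_filter => /orP[->//|/andP[_ ->]]; rewrite orbT.
  - exact: mem_head.
  - move=> z p; rewrite mem_seq_fset => zl zI pw.
    have : z \in K.
      move: zl zI; rewrite /K !inE !mem_filter; case: (z == x) => //= zl; rewrite zl !andbT.
      by [].
    rewrite mem_filter => /andP[/asboolPn far _]; rewrite ltNge; apply/negP => h.
    apply: far; exists p; last by lra.
    by apply: walk_sub pw; exact: inner_bonds_sub.
  have KT : {subset K <= [fset z in x :: l]%fset}.
    by move=> z; rewrite mem_filter mem_seq_fset !inE => /andP[_ ->]; rewrite orbT.
  apply: agree_offS KT _; apply: agree_off_trans sv; exact: agree_off_sym.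
move=> u v su sv.
have meanE w : mean (x :: I) W (fun t => (t x)%:R) w =
    sumc I W (upd w x true) / (sumc I W (upd w x true) + sumc I W (upd w x false)).
  rewrite /mean /=; congr (_ / _).
  pose F (t : config d) := W t * (t x)%:R; rewrite (@eq_sumc _ _ I F W (upd w x true)) => [|t wt]; last first.
    by rewrite /F (wt _ xI) updxx mulr1.
  rewrite (@eq_sumc _ _ I F (fun=> 0) (upd w x false)) ?sumc0 ?addr0 // => t wt.
  by rewrite /F (wt _ xI) updxx mulr0.
have g1 : 0 < (1 + Gam)^-1 by rewrite invr_gt0; lra.
have S b w : 0 < sumc I W (upd w x b) by exact: sumc_gt0.
have := odds_close g1 err0 (S true u) (S false u) (S true v) (S false v).
rewrite invrK -!meanE; apply; rewrite ?single //.
- by rewrite meanE; exact: site_odds.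
- exact: site_odds.
Qed.

(** The outer mean carries the sites that are still shared. By the tower property it suffices to add
    one site for fixed spins off the longer prefix. *)
Lemma chain_prefix xs s k : uniq xs -> xs =i Tht ->
  (forall k, (1 <= k <= size xs)%N -> L [fset x in take k xs]%fset) -> (k <= size xs)%N ->
  mean xs W (fun t => apart_ind t t) s <=
  (step_factor ^+ 4) ^+ k * mean xs W (fun t => pair_mean W apart_ind (take k xs) t t) s.
Proof.
move=> uxs xsT Lxs; elim: k => [|k IH] kn.
  rewrite take0 expr0 mul1r; apply: ler_mean => // t _.
  have id a : W t * a / W t = a by rewrite mulrAC mulfV ?mul1r // gt_eqF.
  by rewrite /pair_mean /mean /= !id.
have {}IH := IH (ltnW kn); apply: le_trans IH _; rewrite [_ ^+ k.+1]exprSr -[leRHS]mulrA.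
have [x0 xs0] : exists x0, x0 \in xs by move: kn; case: (xs) => // a q _; exists a; exact: mem_head.
set x := nth x0 xs k; set l := take k xs.
have tE : take k.+1 xs = rcons l x by rewrite (take_nth x0).
have pxl : perm_eq (take k.+1 xs) (x :: l) by rewrite tE perm_rcons.
have sub : {subset x :: l <= Tht}.
  by move=> z; rewrite -(perm_mem pxl) -xsT; exact: mem_take.
have uxl : uniq (x :: l) by rewrite -(perm_uniq pxl) take_uniq.
have n0 : (0 < #|` Tht|)%N by rewrite cardfs_gt0; apply/fset0Pn; exists x; apply: sub; exact: mem_head.
have sf1 := step_factor_ge1 n0.
apply: ler_wpM2l; first by do 2 apply: exprn_ge0; exact: le_trans ler01 sf1.
have px : perm_eq xs (drop k.+1 xs ++ (x :: l)).
  by rewrite -[X in perm_eq X _](cat_take_drop k.+1) perm_catC perm_cat2l.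
rewrite !(mean_perm _ _ _ px) mean_tower // -meanZ //; apply: ler_mean => // t _.
have -> : pair_mean W apart_ind (take k.+1 xs) t t = pair_mean W apart_ind (x :: l) t t.
  by rewrite !pair_meanE // (pair_total_perm _ _ _ _ pxl) !(sumc_perm _ _ pxl).
apply: chain_step => //.
have -> : [fset z in x :: l]%fset = [fset z in take k.+1 xs]%fset.
  by apply/fsetP => z; rewrite !mem_seq_fset (perm_mem pxl).
by apply: Lxs; rewrite /= kn.
Qed.

End SameDirection.

Hypotheses (fill : fillable L) (LTht : L Tht).
Local Notation prob A s := (mean Tht W (fun t => indicp R (A t)) s).

Let factor := (step_factor ^+ 4) ^+ #|` Tht|.

Lemma occurs_apart_same_direction A B s :
  (increasing_event A /\ increasing_event B) \/ (decreasing_event A /\ decreasing_event B) ->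
  prob (occurs_apart Lam r A B) s <=
  factor * (prob A s * prob B s).
Proof.
move=> mono; have [xs [uxs xsT Lxs]] := fill LTht.
have px : perm_eq Tht xs by apply: uniq_perm => // x; rewrite xsT.
have szE : size xs = #|` Tht| by rewrite -(perm_size px).
rewrite !(mean_perm _ _ _ px).
have h := chain_prefix mono s
  uxs xsT Lxs (leqnn _).
apply: le_trans h _.
rewrite take_size szE; apply: ler_wpM2l.
  apply: exprn_ge0; apply: exprn_ge0; exact: sqr_ge0.
rewrite (@mean_id _ _ W W0) => [|t st]; last exact: pair_mean_agree.
rewrite /pair_mean [leRHS]mulrC -meanZ //; apply: ler_mean => // u _.
rewrite mulrC -meanZ //; apply: ler_mean => // v _.
rewrite /apart_ind /indicp; case: asboolP => [[E [F [_ _ _ oA oB]]]|_]; last by rewrite -natrM ler0n.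
by rewrite !asboolT ?mulr1 //; [exact: occurs_on_in oB | exact: occurs_on_in oA].
Qed.

(** FKG for A and the complement of B, both increasing. *)
Lemma opposite_direction A B s : increasing_event A -> decreasing_event B ->
  prob (A `&` B) s <=
  prob A s * prob B s.
Proof.
move=> iA dB.
have A0 (u : config d) : 0 <= indicp R (A u) by exact: indicp_ge0.
have B0 (u : config d) : 0 <= 1 - indicp R (B u) by rewrite subr_ge0 indicp_le1.
have Ai : isotone (fun u : config d => indicp R (A u)).
  by move=> u v uv; apply: indicp_le; apply: iA; exact/le_conf_le.
have Bi : isotone (fun u : config d => 1 - indicp R (B u)).
  by move=> u v uv; rewrite lerD2l lerN2; apply: indicp_le; apply: dB; exact/le_conf_le.
have := mean_fkg Tht s W0 A0 B0 W_lat Ai Bi.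
rewrite (@eq_mean _ _ _ _ (fun t => 1 - indicp R (B t)) (fun t => 1 + (-1) * indicp R (B t))) => [|t _]; last first.
  by rewrite mulN1r.
rewrite meanD // mean_cst // meanZ // mulN1r.
rewrite (@eq_mean _ _ _ _ (fun t => _ * _) (fun t => indicp R (A t) + (-1) * indicp R ((A `&` B) t))) => [|t _]; last first.
  rewrite /indicp asbool_and mulrBr mulr1 mulN1r -natrM mulnb.
  by congr (_ - _); congr ((_ : bool)%:R).
rewrite meanD // meanZ // mulN1r mulrBr mulr1; lra.
Qed.

Theorem occurs_apart_bound A B s : monotone_event A -> monotone_event B ->
  prob (occurs_apart Lam r A B) s <=
  factor * (prob A s * prob B s).
Proof.
have f1 : 1 <= factor.
  rewrite /factor; have [n0|n0] := posnP #|` Tht|; first by rewrite n0 expr0.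
  do 2 (apply: exprn_ege1); exact: step_factor_ge1.
have m0 (C : set (config d)) : 0 <= prob C s.
  by apply: mean_ge0 => // t; exact: indicp_ge0.
have weak : prob (A `&` B) s <=
    prob A s * prob B s ->
  prob (occurs_apart Lam r A B) s <=
  factor * (prob A s * prob B s).
  move=> h; apply: le_trans (_ : prob (A `&` B) s <= _).
    by apply: ler_mean => // t _; apply: indicp_le; exact: occurs_apart_sub.
  by apply: le_trans h _; rewrite ler_peMl // mulr_ge0.
move=> [iA|dA] [iB|dB].
- by apply: occurs_apart_same_direction; left.
- by apply: weak; exact: opposite_direction.
- by apply: weak; rewrite setIC mulrC; exact: opposite_direction.
- by apply: occurs_apart_same_direction; right.
Qed.

End Chain.

(** * Ratio mixing: changing the boundary spins of [Tht] *)

Section Mixing.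
Variables (Tht Del : {fset (site d)}) (a : R) (B : set (config d)).
Hypotheses (LTht : L Tht) (DelTht : (Del `<=` Tht)%fset).
Hypothesis B_local : forall s t : config d, (forall x, x \in Del -> t x = s x) -> B s -> B t.

Let dl := site_error #|` Tht| a.
Let k : R := expR (2 * beta).

Lemma indicp_local (s t : config d) : (forall x, x \in Del -> t x = s x) -> indicp R (B t) = indicp R (B s).
Proof.
move=> st; rewrite /indicp; congr ((_ : bool)%:R); apply/asboolP/asboolP; apply: B_local => // x xD.
by rewrite st.
Qed.

(** The extra field acts through the spin at [y] alone, and [tilt_ratio] measures its effect once
    that spin is shown to be nearly independent of B. *)
Lemma one_field (gl : seq (site d * R)) y g s : pos_fields gl -> y \in Tht -> k^-1 <= g -> g <= k ->
  (forall z p, z \in Del -> walk (inner_bonds [set` Tht]) y p z -> a < (size p)%:R) ->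
  mean Tht (spin_weight beta ((y, g) :: gl) Tht) (fun t => indicp R (B t)) s <=
  (1 + k * dl) * mean Tht (spin_weight beta gl Tht) (fun t => indicp R (B t)) s.
Proof.
move=> gl0 yT gk gk' far; set W := spin_weight beta gl Tht.
have W0 t : 0 < W t by exact: spin_weight_gt0.
have S0 : 0 < sumc Tht W s by exact: sumc_gt0.
have g0 : 0 < g by apply: lt_le_trans gk; rewrite invr_gt0 expR_gt0.
pose F (t : config d) : R := (t y)%:R; pose H (t : config d) := indicp R (B t).
pose p := mean Tht W F s; pose q := mean Tht W H s; pose b := mean Tht W (fun t => F t * H t) s.
have F01 t : 0 <= F t <= 1 by rewrite /F; case: (t y); rewrite /= ?ler01 ?lexx.
have p01 : 0 <= p <= 1.
  apply/andP; split; first by apply: mean_ge0 => // t; case/andP: (F01 t).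
  by rewrite -[leRHS](mean_cst W0 Tht _ s); apply: ler_mean => // t _; case/andP: (F01 t).
have H0 t : 0 <= H t by exact: indicp_ge0.
have q0 : 0 <= q by exact: mean_ge0.
have bq : b <= q.
  by apply: ler_mean => // t _; rewrite ler_piMl //; case/andP: (F01 t).
have b0 : 0 <= b by apply: mean_ge0 => // t; rewrite mulr_ge0 //; case/andP: (F01 t).
have dl0 : 0 <= dl by exact: site_error_ge0.
have k1 : 1 <= k by rewrite -expR0 ler_expR mulr_ge0.
have WE t : spin_weight beta ((y, g) :: gl) Tht t = W t * (1 + (g - 1) * F t).
  rewrite /W /spin_weight /fields_at /= yT weight_cons_field /field_weight /F /= mulrC; congr (_ * _).
  by case: (t y); rewrite ?mulr1 ?mulr0 ?addr0 // addrC subrK.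
have -> : mean Tht (spin_weight beta ((y, g) :: gl) Tht) (fun t => indicp R (B t)) s =
   (g * b + (q - b)) / (g * p + (1 - p)).
  rewrite /mean (eq_sumc (fun t _ => WE t)).
  rewrite (@eq_sumc _ _ Tht _ (fun t => W t * (H t + (g - 1) * (F t * H t))) s) => [|t _]; last first.
    by rewrite WE -mulrA; congr (_ * _); rewrite /H; ring.
  rewrite !(sumc_mean W0) !meanD !meanZ (mean_cst W0) invfM mulrACA mulfV ?gt_eqF // mul1r.
  by congr (_ / _); rewrite -/p -/q -/b; ring.
suff [hb hb'] : b <= (p + dl) * q /\ (p - dl) * q <= b by exact: tilt_ratio.
have [a1|a1] := ltP a 1.
  have d1 : 1 <= dl by apply: site_error_ge1 => //; rewrite cardfs_gt0; apply/fset0Pn; exists y.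
  case/andP: p01 => p0 p1; split; first by apply: le_trans bq _; rewrite ler_peMl //; lra.
  by apply: le_trans b0; rewrite mulr_le0_ge0 //; lra.
have yD : y \notin Del.
  apply/negP => yD; have := far y [::] yD (conj erefl erefl) => /= h; lra.
(* B is read on [J]. Given these spins, [single_site] bounds the variation of the conditional mean
   of the spin at [y], since [y] is far from [Del]. *)
pose I := [seq z <- Tht | z \notin Del]; pose J := [seq z <- Tht | z \in Del].
have pT : perm_eq Tht (J ++ I) by rewrite perm_sym; apply/permPl; exact: perm_filterC.
rewrite /b /p /q !(mean_perm _ _ _ pT).
apply: (mean_near_independent W0) => //.
  have JI : {subset J ++ I <= Tht} by move=> z; rewrite -(perm_mem pT).
  move=> u v su sv.
  apply: (single_site gl0 LTht) => //.
  - by rewrite filter_uniq ?fset_uniq.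
  - by move=> z; rewrite mem_filter => /andP[].
  - by rewrite mem_filter yD.
  - by move=> z w zT; rewrite mem_filter zT andbT negbK => zD; exact: far.
  - by apply: agree_offS JI _; apply: agree_off_trans sv; exact: agree_off_sym.
move=> t u tu; apply: indicp_local => x xD; apply: tu; by rewrite mem_filter xD.
Qed.

(** The boundary bonds are changed one at a time, each as a field at its inner end with ratio
    between [k^-1] and [k]. A multiplicative bound is needed because it will be compared with a
    probability of B that may be tiny. *)
Theorem mixing (gl : seq (site d * R)) s s' : pos_fields gl ->
  (forall e, e \in boundary_bonds Tht -> s (outer_end Tht e) != s' (outer_end Tht e) ->
     forall z p, z \in Del -> walk (inner_bonds [set` Tht]) (inner_end Tht e) p z -> a < (size p)%:R) ->
  mean Tht (spin_weight beta gl Tht) (fun t => indicp R (B t)) s' <=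
  (1 + k * dl) ^+ size (boundary_bonds Tht) *
  mean Tht (spin_weight beta gl Tht) (fun t => indicp R (B t)) s.
Proof.
move=> gl0 far.
have k1 : 1 <= k by rewrite -expR0 ler_expR mulr_ge0.
have dl0 : 0 <= dl by exact: site_error_ge0.
have f1 : 1 <= 1 + k * dl by rewrite lerDl mulr_ge0 // (le_trans ler01).
pose g e := boundary_field beta (s' (outer_end Tht e)) / boundary_field beta (s (outer_end Tht e)).
pose corr r := [seq (inner_end Tht e, g e) | e <- r].
have g_gt0 e : 0 < g e by rewrite divr_gt0 // boundary_field_gt0.
have k0 : 0 < k by exact: expR_gt0.
have ik1 : k^-1 <= 1 by rewrite invf_le1.
have g_bound e : k^-1 <= g e <= k.
  have kE : k = (expR (- beta))^-1 * (expR (- beta))^-1.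
    by rewrite -expRN opprK -expRD /k; congr expR; ring.
  rewrite /g /boundary_field.
  case: (s' _) (s _) => [] [].
  - by rewrite mulfV ?gt_eqF ?invr_gt0 ?expR_gt0 // ik1.
  - by rewrite -kE lexx andbT; exact: le_trans k1.
  - have -> : expR (- beta) / (expR (- beta))^-1 = k^-1 by rewrite invrK kE invfM !invrK.
    by rewrite lexx; exact: le_trans k1.
  - by rewrite mulfV ?gt_eqF ?expR_gt0 // ik1.
have corr0 r : pos_fields (corr r ++ gl).
  rewrite /pos_fields all_cat -/(pos_fields gl) gl0 andbT; apply/allP => _ /mapP[e _ ->]; exact: g_gt0.
(* The new boundary spins are traded for correcting fields under the old boundary configuration,
   which turns the statement into one about lists of fields. *)
have -> : mean Tht (spin_weight beta gl Tht) (fun t => indicp R (B t)) s' =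
  mean Tht (spin_weight beta (corr (boundary_bonds Tht) ++ gl) Tht) (fun t => indicp R (B t)) s.
  rewrite !(mean_restrict beta_ge0 _ _ _ (fsubset_refl Tht)) //.
  rewrite (@mean_local _ _ _ _ Tht _ s' s).
  - apply: (@eq_mean_weight _ _ _ _ _ _ _ 1) => [|t _]; first exact: oner_neq0.
    rewrite mul1r /weight; congr (_ * _).
    rewrite /boundary_fields /fields_at filter_cat !fields_weight_cat mulrA; congr (_ * _).
    rewrite (_ : [seq f <- corr (boundary_bonds Tht) | f.1 \in Tht] = corr (boundary_bonds Tht)).
      rewrite /corr /fields_weight !big_map -big_split; apply: eq_bigr => e _ /=.
      rewrite /field_weight /=; case: (t _); rewrite ?mulr1 // /g mulrC divfK //.
      by rewrite gt_eqF // boundary_field_gt0.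
    by apply/all_filterP/allP => _ /mapP[e /boundary_bondsP[_ ? _ _] ->].
  - exact: edges_in_inner.
  - exact: fields_in_boundary.
  - move=> u v uv; apply: indicp_local => x xD; rewrite uv //; exact: (fsubsetP DelTht).
have := fun e (h : e \in boundary_bonds Tht) => h.
move: {-2}(boundary_bonds Tht) => r; elim: r => [|e r IH] sub; first by rewrite expr0 mul1r.
have eb : e \in boundary_bonds Tht by apply: sub; exact: mem_head.
have {}IH := IH (fun f fr => sub f (mem_behead (s := e :: r) fr)).
rewrite exprS -mulrA; apply: le_trans (ler_wpM2l (le_trans ler01 f1) IH).
have /andP[gk gk'] := g_bound e.
have [se|se] := eqVneq (s (outer_end Tht e)) (s' (outer_end Tht e)).
  rewrite /= (@eq_mean_weight _ _ _ _ (spin_weight beta (corr r ++ gl) Tht) _ _ 1) ?oner_neq0 //.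
    by rewrite ler_peMl // mean_ge0 // => t; first [exact: spin_weight_gt0 | exact: indicp_ge0].
  move=> t _; rewrite mul1r /spin_weight /fields_at /=; case: ifP => // _.
  rewrite weight_cons_field /field_weight /= /g se mulfV ?mul1r ?gt_eqF ?boundary_field_gt0 //.
  by case: (t _); rewrite mul1r.
apply: one_field => //; first by case: (boundary_bondsP eb).
exact: far.
Qed.

End Mixing.

End ExponentialDecay.

(** * The Ising model in finite volume *)

Section IsingMean.
Variables (R : realType) (d : nat) (beta h : R).
Hypothesis beta_ge0 : 0 <= beta.
Implicit Types (N Lam Tht : {fset (site d)}) (s t eta : config d) (A : set (config d)).
Let a0 : R := expR (2 * (beta * h)).

(** Only the ratio of the weights of plus and minus counts, hence the exponent [2 * (beta * h)]. *)
Definition site_fields N : seq (site d * R) := [seq (x, a0) | x <- N].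

Definition ising_mean Lam A eta : R :=
  mean Lam (spin_weight beta (site_fields Lam) Lam) (fun t => indicp R (A t)) eta.

Lemma site_fields_pos N : pos_fields (site_fields N).
Proof. by apply/allP => _ /mapP[x _ ->]; exact: expR_gt0. Qed.

Lemma fields_at_site_fields N : fields_at (site_fields N) N = site_fields N.
Proof. by apply/all_filterP/allP => _ /mapP[x xN ->]. Qed.

Lemma spins_agreeE t e : bonds e ->
  spins_agree R t e = (t (bond_ends e).1 == t (bond_ends e).2)%:R.
Proof.
move=> be; have [_ eE] := bond_endsP be; rewrite /spins_agree; congr ((_ : bool)%:R).
apply/asboolP/eqP => [|te x y]; first by apply; rewrite [in X in _ \in X]eE ?fset21 ?fset22.
by rewrite eE => /fset2P[] -> /fset2P[] ->.
Qed.

Lemma ising_weightE Lam : exists2 c : R, 0 < c & forall eta (s : {ffun Lam -> bool}),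
  ising_weight beta h eta s = c * spin_weight beta (site_fields Lam) Lam (override s eta).
Proof.
exists (\prod_(e <- touching_fset Lam) expR beta * \prod_(x <- Lam) expR (- (beta * h))).
  by rewrite mulr_gt0 // prodr_gt0 // => *; exact: expR_gt0.
move=> eta s; rewrite /ising_weight /hamiltonian; set t := override s eta.
rewrite fsbig_finite /=; last exact: touching_bonds_finite.
rewrite -/(touching_fset Lam).
have -> : - (beta * (- (\sum_(e <- touching_fset Lam) spins_agree R t e) -
      h * \sum_(x <- Lam) spin R (t x))) =
    \sum_(e <- touching_fset Lam) beta * spins_agree R t e +
    \sum_(x <- Lam) beta * h * spin R (t x).
  by rewrite -!mulr_sumr; ring.
rewrite expRD !expR_sum /spin_weight fields_at_site_fields /weight edges_weight_edge_list.
rewrite /fields_weight big_map mulrACA -!big_split; congr (_ * _).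
  apply: eq_big_seq => e /mem_touching[be _]; rewrite spins_agreeE //.
  by case: eqP => _ /=; rewrite ?mulr1 // mulr0 -expRD subrr.
apply: eq_bigr => x _; rewrite /field_weight /= /spin.
case: (t x); rewrite ?mulr1 ?mulrN1 //.
by rewrite -expRD; congr expR; rewrite /a0; ring.
Qed.

Lemma isingE Lam A eta : ising beta h Lam eta A = ising_mean Lam A eta.
Proof.
have [c c0 hc] := ising_weightE Lam.
rewrite /ising /ising_mean /mean -!sum_override big_mkcond /=.
under eq_bigr do rewrite hc.
under [X in _ / X]eq_bigr do rewrite hc.
rewrite -mulr_sumr.
rewrite (eq_bigr (fun w : {ffun Lam -> bool} => c * (spin_weight beta (site_fields Lam) Lam
  (override w eta) * indicp R (A (override w eta))))) => [|w _]; last first.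
  by rewrite /indicp; case: asboolP => _; rewrite ?mulr1 ?mulr0.
by rewrite -mulr_sumr invfM mulrACA mulfV ?gt_eqF // mul1r.
Qed.

Lemma spin_weight_site_fields Tht Lam t : (Tht `<=` Lam)%fset ->
  spin_weight beta (site_fields Lam) Tht t = spin_weight beta (site_fields Tht) Tht t.
Proof.
move=> /fsubsetP TL; rewrite /spin_weight; apply: weight_perm_fields.
rewrite fields_at_site_fields /fields_at filter_map; apply: perm_map.
apply: uniq_perm; rewrite ?filter_uniq ?fset_uniq // => x; rewrite mem_filter /=.
by apply/andP/idP => [[]//|xT]; split=> //; exact: TL.
Qed.

Lemma ising_mean_dlr Tht Lam A eta : (Tht `<=` Lam)%fset ->
  ising_mean Lam A eta =
  mean Lam (spin_weight beta (site_fields Lam) Lam) (ising_mean Tht A) eta.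
Proof.
move=> TL; pose J := [seq x <- Lam | x \notin Tht].
have p : perm_eq Lam (J ++ Tht).
  by apply: perm_filter_cat; rewrite ?fset_uniq //; exact: (fsubsetP TL).
have W0 t : 0 < spin_weight beta (site_fields Lam) Lam t.
  by apply: spin_weight_gt0 => //; exact: site_fields_pos.
rewrite /ising_mean !(mean_perm _ _ _ p) (mean_tower W0); apply: eq_mean => t _.
rewrite -/(ising_mean Tht A t) /ising_mean.
have [c c0 hc] := spin_weight_restrict beta_ge0 (site_fields_pos Lam) t TL.
apply: (eq_mean_weight _ c0) => u tu; rewrite hc //.
by rewrite spin_weight_site_fields.
Qed.

Definition flip_bound : R := expR (beta * (size (offsets d))%:R + 2 * (beta * `|h|)).

(** Finite energy: seen from [x] alone, each of the at most [size (offsets d)] touching bonds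
    changes its weight by a factor at most [expR beta], and the external field accounts for the
    rest. *)
Lemma ising_flip Tht x t b : x \in Tht ->
  spin_weight beta (site_fields Tht) Tht (upd t x b) <=
  flip_bound * spin_weight beta (site_fields Tht) Tht (upd t x (~~ b)).
Proof.
move=> xT; have xN : ([fset x] `<=` Tht)%fset by rewrite fsub1set.
have [c c0 hc] := spin_weight_restrict beta_ge0 (site_fields_pos Tht) t xN.
have off b' : agree_off [fset x]%fset t (upd t x b').
  by move=> y; rewrite inE /upd => /negbTE ->.
rewrite !hc //; set S := spin_weight _ _ [fset x]%fset.
have cp : 0 < c.
  have S0 u : 0 < S u by apply: spin_weight_gt0 => //; exact: site_fields_pos.
  have := spin_weight_gt0 beta_ge0 (site_fields_pos Tht) Tht (upd t x b).
  by rewrite hc // pmulr_lgt0.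
rewrite [leRHS]mulrCA; apply: ler_wpM2l; first exact: ltW.
have SE u : S u = edges_weight (edge_list (touching_fset [fset x]%fset) (@bond_ends d) (expR (- beta))) u *
    field_weight (x, a0) u.
  rewrite /S spin_weight_site_fields // /spin_weight fields_at_site_fields /weight.
  by rewrite /fields_weight big_map big_seq_fset1.
set w := upd t x b; set w' := upd t x (~~ b).
rewrite !SE /flip_bound expRD mulrACA.
have t0 : 0 < expR (- beta) <= 1 by exact: expRN_itv.
apply: ler_pM.
- by apply/ltW/edges_weight_gt0; exact: ferromagnetic_edge_list.
- by rewrite /field_weight /=; case: (w x); rewrite ?expR_ge0 ?ler01.
- apply: le_trans (_ : 1 <= _).
    rewrite edges_weight_edge_list; apply: Num.Theory.prodr_ile1 => e _.
    by case: eqP => _; rewrite ?ler01 ?lexx //; case/andP: t0 => /ltW -> ->.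
  apply: le_trans (_ : expR (beta * (size (offsets d))%:R) * expR (- beta) ^+ size (offsets d) <= _).
    rewrite -expRM_natr -expRD -mulrDl subrr mul0r expR0 //.
  apply: ler_wpM2l; first exact: expR_ge0.
  apply: le_trans (_ : expR (- beta) ^+ size (touching_fset [fset x]%fset) <= _).
    apply: ler_wiXn2l; [exact: expR_ge0 | by case/andP: t0 |].
    by apply: leq_trans (size_touching _) _; rewrite cardfs1 mul1n.
  rewrite edges_weight_edge_list -iter_mulr_1 -(count_predT (touching_fset _)) -big_const_seq.
  apply: ler_prod => e _.
  by case: eqP => _; case/andP: t0 => /ltW -> //; rewrite lexx.
rewrite /field_weight /= /w /w' !updxx /a0.
have hh := ler_norm h; have hh' : - h <= `|h| by rewrite -normrN ler_norm.
case: (b) => /=; rewrite ?mulr1.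
  by rewrite ler_expR; apply: ler_wpM2l => //; exact: ler_wpM2l.
rewrite -expRD -expR0 ler_expR -mulrDr mulr_ge0 // -mulrDr mulr_ge0 //; lra.
Qed.

End IsingMean.

Section SpinEvents.
Variable d : nat.

(** The sets determined by the spins in [S] form a sigma-algebra that contains the generators. *)
Lemma sigma_spins_local (S : {fset (site d)}) (A : set (config d)) : sigma_spins [set` S] A ->
  forall s t : config d, (forall x, x \in S -> t x = s x) -> A s -> A t.
Proof.
move=> mA.
pose G := [set A : set (config d) | forall s t : config d, (forall x, x \in S -> t x = s x) -> A s <-> A t].
suff : G A by move=> h s t st; case: (h s t st).
move: A mA; apply: smallest_sub; last first.
  move=> _ [x xS [b ->]] s t st /=; by rewrite st.
split.
- by [].
- move=> A GA s t st; rewrite /setD /=; have := GA s t st; tauto.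
- move=> F GF s t st; split=> -[n _ Fn]; exists n => //.
    by case: (GF n s t st) => h _; exact: h.
  by case: (GF n s t st) => _ h; exact: h.
Qed.

End SpinEvents.

(** * Elementary estimates for the constants *)

Section Numerics.
Variable R : realType.

Lemma expR_le_affine (K q : R) : 0 <= K -> 0 <= q <= 1 -> expR (K * q) <= 1 + K * expR K * q.
Proof.
move=> K0 /andP[q0 q1].
have h1 : expR (K * q) <= 1 + K * q * expR (K * q).
  have := expR_ge1Dx (- (K * q)); rewrite expRN => h.
  have e0 : 0 < expR (K * q) by exact: expR_gt0.
  have := ler_wpM2r (ltW e0) h; rewrite mulVf ?gt_eqF // mulrDl mul1r mulNr; lra.
apply: le_trans h1 _; rewrite lerD2l -!mulrA; apply: ler_wpM2l => //; rewrite mulrC.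
by apply: ler_wpM2r => //; rewrite ler_expR ler_piMr.
Qed.

Lemma expr1D_le_expR (x : R) n : 0 <= x -> (1 + x) ^+ n <= expR (n%:R * x).
Proof.
move=> x0; rewrite expRM_natl; apply: lerXn2r; rewrite ?nnegrE ?expR_ge0 ?addr_ge0 //.
exact: expR_ge1Dx.
Qed.

Lemma ln_nat_ge0 n : 0 <= ln (n%:R : R).
Proof. by case: n => [|n]; [rewrite ln0 | rewrite ln_ge0 // ler1n]. Qed.

Lemma sqr_nat_le_expR n (b : R) : 2 * ln (n%:R) <= b -> (n%:R : R) ^+ 2 <= expR b.
Proof.
case: n => [|n] h; first by rewrite expr0n expR_ge0.
rewrite -[n.+1%:R]lnK ?posrE ?ltr0n // -expRM_natl ler_expR; exact: h.
Qed.

End Numerics.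

(** * The two estimates combined *)

Section MainBound.
Variables (R : realType) (d : nat) (beta h : R).
Hypothesis beta_ge0 : 0 <= beta.
Variable L : set {fset (site d)}.
Hypotheses (L_fillable : fillable L) (L_approx : approx_nbhd_property R L).
Hypothesis fk_decay : uniform_exp_decay_wired beta h
  [set fset_set (inner_bonds [set` Lam]) | Lam in L].

Definition local_on (Del : {fset (site d)}) (B : set (config d)) : Prop :=
  forall s t : config d, (forall x, x \in Del -> t x = s x) -> B s -> B t.

(** [S] is the price of the chain and [Q] that of the mixing. [Lam] is an arbitrary set, so that a
    finite volume and the whole lattice are treated together. *)
Theorem local_bounds : exists c c' eps : R, [/\ 0 < c, 0 < c', 0 < eps &
  forall (Del Tht : {fset (site d)}) (Lam : set (site d)) (r : R) (A B : set (config d)),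
    L Tht -> [set` Tht] `<=` Lam -> [set` Del] `<=` Lam -> c * ln (#|` Tht|%:R) <= r ->
    nbhd_in [set` Del] Lam r `<=` [set` Tht] ->
    local_on Del B -> monotone_event A -> monotone_event B ->
  exists S Q : R, [/\ 0 <= S, 0 <= Q, S * Q <= 1 + c' * expR (- (eps * r)),
    forall t, ising_mean beta h Tht (occurs_apart Lam r A B) t <=
      S * (ising_mean beta h Tht A t * ising_mean beta h Tht B t) &
    forall t t' : config d, (forall x, ~ Lam x -> t' x = t x) ->
      ising_mean beta h Tht B t' <= Q * ising_mean beta h Tht B t]].
Proof.
have [c0 c0_gt1 approx] := L_approx.
have [C [lam [C0 lam0 dec]]] := fk_decay.
have decay := correlation_decay beta_ge0 C0 lam0 dec.
set M := Num.max C 1 in decay.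
have M1 : 1 <= M by rewrite le_max lexx orbT.
pose D : R := (size (offsets d))%:R.
have D0 : 0 < D by rewrite ltr0n; exact: size_offsets_gt0.
pose Gam := flip_bound d beta h; pose k : R := expR (2 * beta).
have Gam0 : 0 < Gam by exact: expR_gt0.
have k0 : 0 < k by exact: expR_gt0.
have c00 : 0 < c0 by exact: lt_trans ltr01 c0_gt1.
pose l1 := lam / c0; have l10 : 0 < l1 by rewrite divr_gt0.
(* Per site of [Tht], [S] has 8 factors (a square to the fourth power) with error [dl * (1 + Gam)],
   and [Q] at most [D] factors with error [k * dl]. [K3] is the prefactor in [dl], where [expR l1]
   stems from the [- 1] in [r / 2 - 1]. *)
pose K2 := 8 * (1 + Gam) + D * k.
pose K3 := D * (M * expR lam) * expR l1.
have M0 : 0 < M by lra.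
have K20 : 0 < K2 by rewrite /K2 addr_gt0 // mulr_gt0 //; lra.
have K30 : 0 < K3 by rewrite /K3 !mulr_gt0 // expR_gt0.
pose K := K2 * K3; have K0 : 0 < K by rewrite mulr_gt0.
(* The exponent bounding [S * Q] is [K * n ^+ 2 * expR (- (l1 * r / 2))]. With [c = 8 / l1] the
   square of [n] is at most [expR (l1 * r / 4)], which leaves the rate [l1 / 4]. *)
exists (8 / l1), (K * expR K), (l1 / 4); split; rewrite ?divr_gt0 ?mulr_gt0 ?expR_gt0 //.
move=> Del Tht Lam r A B LT TL DL cr nb locB mA mB.
set n := #|` Tht| in cr *.
have r0 : 0 <= r by apply: le_trans cr; rewrite mulr_ge0 ?ln_nat_ge0 // ltW // divr_gt0.
pose dl := site_error d c0 M lam n (r / 2 - 1).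
have dlE : dl = n%:R * K3 * expR (- (l1 * r / 2)).
  rewrite /dl /site_error /K3 natrM -!mulrA; do 4 congr (_ * _).
  by rewrite -expRD; congr expR; rewrite /l1; field; rewrite gt_eqF.
have dl0 : 0 <= dl by exact: site_error_ge0.
pose S := (step_factor c0 M lam Tht Gam r ^+ 4) ^+ n.
pose Q := (1 + k * dl) ^+ size (boundary_bonds Tht).
have DT : (Del `<=` Tht)%fset.
  apply/fsubsetP => x xD; apply: nb; apply: (@nbhd_in_walk _ _ _ _ x x [::]) => //.
  exact: DL.
exists S, Q; split.
- by rewrite /S !exprn_ge0 // addr_ge0 // mulr_ge0 //; lra.
- by rewrite /Q exprn_ge0 // addr_ge0 // mulr_ge0 //; lra.
- have SE : S <= expR ((8 * n)%:R * (dl * (1 + Gam))).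
    rewrite /S /step_factor -!exprM mulnA; apply: expr1D_le_expR; rewrite mulr_ge0 //; lra.
  have QE : Q <= expR ((n * size (offsets d))%:R * (k * dl)).
    apply: le_trans (expr1D_le_expR _ _) _; first by rewrite mulr_ge0 //; lra.
    rewrite ler_expR; apply: ler_wpM2r; first by rewrite mulr_ge0 //; lra.
    by rewrite ler_nat; exact: size_boundary_bonds.
  apply: le_trans (ler_pM _ _ SE QE) _.
  + by rewrite /S !exprn_ge0 // addr_ge0 // mulr_ge0 //; lra.
  + by rewrite /Q exprn_ge0 // addr_ge0 // mulr_ge0 //; lra.
  rewrite -expRD.
  have -> : (8 * n)%:R * (dl * (1 + Gam)) + (n * size (offsets d))%:R * (k * dl) = n%:R * dl * K2.
    by rewrite !natrM -/D /K2; ring.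
  pose q := expR (- (l1 / 4 * r)).
  have q01 : 0 <= q <= 1.
    by rewrite expR_ge0 /= expR_le1 oppr_le0 mulr_ge0 // ltW // divr_gt0.
  apply: le_trans (_ : expR (K * q) <= _); last by apply: expR_le_affine => //; exact: ltW.
  rewrite ler_expR dlE.
  have -> : n%:R * (n%:R * K3 * expR (- (l1 * r / 2))) * K2 = K * (n%:R ^+ 2 * expR (- (l1 * r / 2))).
    by rewrite /K; ring.
  apply: ler_wpM2l; first exact: ltW.
  have n2 : (n%:R : R) ^+ 2 <= expR (l1 * r / 4).
    apply: sqr_nat_le_expR; move: cr; rewrite mulrAC ler_pdivrMr //; lra.
  apply: le_trans (ler_wpM2r (expR_ge0 _) n2) _.
  by rewrite -expRD ler_expR; apply: eq_ler; field.
- move=> t; rewrite /ising_mean.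
  apply: (occurs_apart_bound beta_ge0 c0_gt1 M1 lam0 approx decay) => //.
    exact: site_fields_pos.
  by move=> x u b xT; exact: ising_flip.
move=> t t' tt'; rewrite /ising_mean.
apply: (mixing beta_ge0 c0_gt1 M1 lam0 approx decay LT DT locB) => //.
  exact: site_fields_pos.
(* The outer end is off [Tht], hence at distance more than [r] from [Del]; the inner end is farther
   than [r - 1], and [r - 1 >= r / 2 - 1] as [r >= 0]. *)
move=> e eb ne z p zD pw.
have [be iN oN eE] := boundary_bondsP eb.
have oL : Lam (outer_end Tht e) by apply: contrapT => nL; move: ne; rewrite tt' // eqxx.
rewrite ltNge; apply/negP => sp; move/negP: oN; apply.
apply: nb; apply: (@nbhd_in_walk _ _ _ _ _ z (inner_end Tht e :: p)) => //; last first.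
  by rewrite /= -natr1; lra.
have -> : inner_end Tht e :: p = [:: inner_end Tht e] ++ p by [].
apply: walk_cat (_ : walk _ _ _ (inner_end Tht e)) _; last first.
  by apply: walk_sub pw; exact: inner_bonds_sub.
split=> //=; rewrite andbT fsetUC -eE; apply/asboolP; split=> // y.
by rewrite eE => /fset2P[] -> //; exact: TL.
Qed.

Lemma ising_mean_ge0 (Lam : {fset (site d)}) A t : 0 <= ising_mean beta h Lam A t.
Proof.
apply: mean_ge0 => u; last exact: indicp_ge0.
by apply: spin_weight_gt0 => //; exact: site_fields_pos.
Qed.

(** Condition on the spins off [Tht]. However A and B depend on them, the conditional probability of
    B is at most [Q] times its own average and can be pulled out. *)
Lemma finite_volume_bound (Tht Lam : {fset (site d)}) (D A B : set (config d)) (S Q : R) eta :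
  (Tht `<=` Lam)%fset -> 0 <= S -> 0 <= Q ->
  (forall t, ising_mean beta h Tht D t <=
     S * (ising_mean beta h Tht A t * ising_mean beta h Tht B t)) ->
  (forall t t' : config d, (forall x, ~ x \in Lam -> t' x = t x) ->
     ising_mean beta h Tht B t' <= Q * ising_mean beta h Tht B t) ->
  ising beta h Lam eta D <= S * Q * ising beta h Lam eta A * ising beta h Lam eta B.
Proof.
move=> TL S0 Q0 hD hB; rewrite !isingE // ![ising_mean _ _ Lam _ _](ising_mean_dlr h beta_ge0 _ _ TL).
set W := spin_weight _ _ Lam.
have W0 t : 0 < W t by apply: spin_weight_gt0 => //; exact: site_fields_pos.
set a := mean Lam W (ising_mean _ _ Tht A) eta; set b := mean Lam W (ising_mean _ _ Tht B) eta.
have -> : S * Q * a * b = mean Lam W (fun t => S * Q * b * ising_mean beta h Tht A t) eta.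
  by rewrite meanZ -/a; ring.
apply: ler_mean => // t st; apply: le_trans (hD t) _.
have A0 := ising_mean_ge0 Tht A t.
suff Bb : ising_mean beta h Tht B t <= Q * b.
  have := ler_wpM2l S0 (ler_wpM2r A0 Bb); move: (ising_mean _ _ _ A _) (ising_mean _ _ _ B _) => u v.
  by rewrite mulrC [v * u]mulrC -mulrA mulrC !mulrA.
rewrite -meanZ -[leLHS](mean_cst W0 Lam _ eta); apply: ler_mean => // t' st'.
by apply: hB => x /negP xL; rewrite (st _ xL) (st' _ xL).
Qed.

End MainBound.

(** * Infinite volume *)

Section Cylinders.
Variable d : nat.
Implicit Types (S E F : {fset (site d)}) (A B : set (config d)).

Lemma measurable_coordinate x b : measurable ([set s : config d | s x = b] : set (spin_space d)).
Proof. by apply: sub_sigma_algebra; exists x => //; exists b. Qed.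

(** A finite union of cylinders, one for each admissible pattern on [S]. *)
Lemma local_measurable S (P : set (config d)) :
  local_on S P -> measurable (P : set (spin_space d)).
Proof.
move=> loc.
pose pats := [set w : {ffun S -> bool} | P (override w (fun=> false))].
have -> : P = \bigcup_(w in pats) \bigcap_(x in [set: S]) [set s : config d | s (val x) = w x].
  apply/seteqP; split=> s.
    move=> Ps; exists [ffun x : S => s (val x)]; last by move=> x _ /=; rewrite ffunE.
    apply: loc Ps => x xS; rewrite -[x]/(val [`xS]%fset) override_in ffunE //.
  move=> [w Pw ws]; apply: loc Pw => x xS.
  by rewrite -[x]/(val [`xS]%fset) override_in; exact: ws.
apply: (@fin_bigcup_measurable _ (spin_space d)); first exact: finite_finset.
move=> w _; apply: (@fin_bigcap_measurable _ (spin_space d)); first exact: finite_finset.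
by move=> x _; exact: measurable_coordinate.
Qed.

Lemma local_measurable_fun (R : realType) S (g : config d -> R) :
  (forall s t : config d, (forall x, x \in S -> t x = s x) -> g t = g s) ->
  measurable_fun setT (g : spin_space d -> R).
Proof.
move=> loc _ Y mY; rewrite setTI; apply: (@local_measurable S) => s t st /=.
by rewrite (loc s t st).
Qed.

Lemma override_measurable S (w : {ffun S -> bool}) A : measurable (A : set (spin_space d)) ->
  measurable ([set eta | A (override w eta)] : set (spin_space d)).
Proof.
move: A; apply: smallest_sub; last first.
  move=> _ [x _ [b ->]] /=; have [xS|xS] := boolP (x \in S).
    apply: (@local_measurable fset0) => s t _ /=.
    by rewrite -[x]/(val [`xS]%fset) !override_in.
  have -> : [set eta : config d | override w eta x = b] = [set eta : config d | eta x = b].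
    by apply/seteqP; split=> s /=; rewrite override_out.
  exact: measurable_coordinate.
split.
- by rewrite /= [X in measurable X](_ : _ = set0) //; exact: measurable0.
- move=> A mA /=.
  rewrite [X in measurable X](_ : _ = ~` [set eta | A (override w eta)]); first exact: measurableC.
  by apply/seteqP; split=> s /= => [[]|].
- move=> F mF /=.
  rewrite [X in measurable X](_ : _ = \bigcup_n [set eta | F n (override w eta)]) //.
  exact: bigcup_measurable.
Qed.

(** The weights depend on the finitely many spins of [V]; the event itself may depend on infinitely
    many, but enters as an indicator for each fixed inner configuration. *)
Lemma ising_measurable (R : realType) (beta h : R) S A : 0 <= beta ->
  measurable (A : set (spin_space d)) ->
  measurable_fun setT ((fun eta => ising beta h S eta A) : spin_space d -> R).
Proof.
move=> beta0 mA.
pose W := spin_weight beta (site_fields beta h S) S.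
pose V := (S `|` \bigcup_(e <- touching_fset S) e)%fset.
have Wloc (s t : config d) : (forall x, x \in V -> t x = s x) -> W t = W s.
  move=> st; rewrite /W /spin_weight fields_at_site_fields /weight; congr (_ * _).
    rewrite !edges_weight_edge_list; apply: eq_big_seq => e eS.
    have /mem_touching[be _] := eS; have [_ eE] := bond_endsP be.
    have eV x : x \in e -> x \in V.
      by move=> xe; rewrite inE; apply/orP; right; apply/bigfcupP; exists e; rewrite ?eS.
    by rewrite !st //; apply: eV; rewrite [in X in _ \in X]eE ?fset21 ?fset22.
  rewrite /fields_weight !big_map; apply: eq_big_seq => x xS.
  by rewrite /field_weight /= st // inE xS.
have over (w : {ffun S -> bool}) (s t : config d) : (forall x, x \in V -> t x = s x) ->
    forall x, x \in V -> override w t x = override w s x.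
  by move=> st x xV; rewrite /override; case: insubP => //= _; exact: st.
pose Z (eta : config d) := sumc S W eta.
pose g (w : {ffun S -> bool}) (eta : config d) := W (override w eta) / Z eta.
have ZE eta : Z eta = \sum_(w : {ffun S -> bool}) W (override w eta) by rewrite sum_override.
have gloc w (s t : config d) : (forall x, x \in V -> t x = s x) -> g w t = g w s.
  move=> st; rewrite /g (Wloc _ _ (over w _ _ st)) !ZE; congr (_ / _).
  by apply: eq_bigr => v _; exact: Wloc (over v _ _ st).
have -> : (fun eta => ising beta h S eta A) =
    fun eta => \sum_(w : {ffun S -> bool}) g w eta * indicp R (A (override w eta)).
  apply/funext => eta; rewrite isingE // /ising_mean /mean -sum_override mulr_suml.
  by apply: eq_bigr => w _; rewrite /g mulrAC.
apply: measurable_sum => w; apply: measurable_funM.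
  exact: local_measurable_fun (gloc w).
have -> : (fun eta : config d => indicp R (A (override w eta))) =
    \1_([set eta | A (override w eta)] : set (spin_space d)).
  by apply/funext => eta; rewrite indicE /indicp.
by apply: measurable_indic; exact: override_measurable.
Qed.

Lemma occurs_on_local A E : local_on E (occurs_on A [set` E]).
Proof. by move=> s t st; apply: occurs_on_agree. Qed.

(* Filling up outside E with the worst spins turns the finite set provided by local occurrence
   into one inside E. *)
Lemma occurs_on_finite A (E : set (site d)) s : locally_occurring A -> monotone_event A ->
  occurs_on A E s -> exists E' : {fset (site d)}, [set` E'] `<=` E /\ occurs_on A [set` E'] s.
Proof.
move=> [_ locA] mono oA.
have [b hb] : exists b : bool, forall u t : config d,
    (forall x, t x = u x \/ t x = b) -> A t -> A u.
  case: mono => [iA|dA].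
    by exists false => u t ut; apply: iA => x; case: (ut x) => ->; rewrite ?lexx // leEbool.
  by exists true => u t ut; apply: dA => x; case: (ut x) => ->; rewrite ?lexx // leEbool leq_b1.
pose v : config d := fun x => if `[< E x >] then s x else b.
have [E0 oE0] : exists E0 : {fset (site d)}, occurs_on A [set` E0] v.
  by apply: locA; apply: oA => x Ex; rewrite /v asboolT.
exists [fset x in E0 | `[< E x >]]%fset; split.
  by move=> x /=; rewrite !inE => /andP[_ /asboolP].
move=> t ts.
pose u : config d := fun x => if x \in E0 then v x else t x.
apply: (hb t u); last by apply: oE0 => x /= xE; rewrite /u xE.
move=> x; rewrite /u; case: ifPn => xE; last by left.
rewrite /v; case: asboolP => Ex; last by right.
by left; rewrite ts //= !inE xE; exact/asboolP.
Qed.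

Lemma occurs_on_restrict B (D : {fset (site d)}) (F : set (site d)) s : local_on D B ->
  occurs_on B F s -> occurs_on B (F `&` [set` D]) s.
Proof.
move=> loc oB t ts.
pose u : config d := fun x => if `[< F x >] then s x else t x.
have Bu : B u by apply: oB => x Fx; rewrite /u asboolT.
apply: loc Bu => x xD; rewrite /u; case: asboolP => // Fx.
by rewrite ts.
Qed.

(** The definition ranges over uncountably many pairs of sets. Both can be shrunk to finite ones,
    which keeps them apart, and finite pairs are enumerated by their codes. *)
Lemma occurs_apart_measurable (R : realType) (r : R) A B (D : {fset (site d)}) :
  locally_occurring A -> monotone_event A -> local_on D B ->
  measurable (occurs_apart setT r A B : set (spin_space d)).
Proof.
move=> locA mono locB.
pose P (EF : {fset (site d)} * {fset (site d)}) :=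
  (r%:E <= set_bdist R (inner_bonds setT) [set` EF.1] [set` EF.2])%E.
pose G (EF : {fset (site d)} * {fset (site d)}) : set (spin_space d) :=
  occurs_on A [set` EF.1] `&` occurs_on B [set` EF.2].
have -> : occurs_apart setT r A B =
    \bigcup_(n in [set n : nat | exists EF, choice.unpickle n = Some EF /\ P EF])
      (if choice.unpickle n is Some EF then G EF else set0).
  apply/seteqP; split=> s.
    move=> [E [F [_ _ EF oA oB]]].
    have [E' [E'E oE']] := occurs_on_finite locA mono oA.
    have oF' := occurs_on_restrict locB oB.
    pose F' := [fset x in D | `[< F x >]]%fset.
    have F'E : F `&` [set` D] = [set` F'].
      apply/seteqP; split=> x /=; rewrite !inE; first by move=> [Fx ->]; exact/asboolP.
      by move=> /andP[-> /asboolP].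
    rewrite F'E in oF'.
    exists (choice.pickle (E', F')) => /=; last by rewrite choice.pickleK.
    exists (E', F'); split; first exact: choice.pickleK.
    apply/set_bdist_ge => x y p xE yF; apply: (set_bdist_ge _ _ _ _).1 EF _ _ _ _ _.
      exact: E'E.
    by move: yF => /=; rewrite !inE => /andP[_ /asboolP].
  move=> [n [[E F] [-> PEF]]] [oA oB].
  by exists [set` E], [set` F]; split.
apply: (@bigcup_measurable _ (spin_space d)) => n [EF [-> _]].
by apply: measurableI; apply: local_measurable; exact: occurs_on_local.
Qed.

End Cylinders.

Section InfiniteVolume.
Variables (R : realType) (d : nat) (beta h : R).
Hypothesis beta_ge0 : 0 <= beta.
Variables (mu : probability (spin_space d) R).
Hypothesis mu_gibbs : gibbs beta h mu.

(** The argument of [finite_volume_bound], with the DLR equations in place of the tower property. *)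
Lemma infinite_volume_bound (Tht : {fset (site d)}) (D A B : set (spin_space d)) (S Q : R) :
  measurable D -> measurable A -> measurable B -> 0 <= S -> 0 <= Q ->
  (forall t, ising_mean beta h Tht D t <=
     S * (ising_mean beta h Tht A t * ising_mean beta h Tht B t)) ->
  (forall t t' : config d, ising_mean beta h Tht B t' <= Q * ising_mean beta h Tht B t) ->
  (mu D <= (S * Q)%:E * mu A * mu B)%E.
Proof.
move=> mD mA mB S0 Q0 hD hB.
have i0 E t : 0 <= ising beta h Tht t E by rewrite isingE //; exact: ising_mean_ge0.
have meas (E : set (spin_space d)) : measurable E -> measurable_fun setT (fun t : spin_space d => (ising beta h Tht t E)%:E).
  by move=> mE; apply/measurable_EFinP; exact: ising_measurable.
have fin (E : set (spin_space d)) : measurable E -> mu E = (fine (mu E))%:E.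
  by move=> mE; rewrite fineK // fin_num_measure.
have hb t : ising beta h Tht t B <= Q * fine (mu B).
  rewrite -lee_fin [X in (_ <= X)%E]EFinM -(fin B mB) (mu_gibbs Tht mB) -ge0_integralZl //; last first.
  - by move=> u _; rewrite lee_fin.
  - exact: meas.
  apply: le_trans (_ : \int[mu]_u (ising beta h Tht t B)%:E <= _)%E.
    by rewrite integral_cst //= probability_setT mule1.
  apply: ge0_le_integral => //.
  - by move=> u _; rewrite lee_fin.
  - apply: measurable_funeM; exact: meas.
  - by move=> u _; rewrite -EFinM lee_fin !isingE.
rewrite (mu_gibbs Tht mD) (mu_gibbs Tht mA) (fin B mB).
have -> : ((S * Q)%:E * \int[mu]_u (ising beta h Tht u A)%:E * (fine (mu B))%:E =
   \int[mu]_u ((S * Q * fine (mu B))%:E * (ising beta h Tht u A)%:E))%E.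
  rewrite ge0_integralZl //.
  - by rewrite EFinM muleAC.
  - exact: meas.
  - by move=> u _; rewrite lee_fin.
  - by rewrite lee_fin !mulr_ge0 // fine_ge0.
apply: ge0_le_integral => //.
- by move=> u _; rewrite lee_fin.
- exact: meas.
- apply: measurable_funeM; exact: meas.
move=> u _; rewrite -EFinM lee_fin.
have := hD u; rewrite -!isingE // => hu; apply: le_trans hu _.
move: (i0 A u) (hb u); move: (ising _ _ _ _ A) (ising _ _ _ _ B) (fine _) => a b m a_ge0 bm.
apply: le_trans (ler_wpM2l S0 (ler_wpM2l a_ge0 bm)) _.
by apply: eq_ler; ring.
Qed.

End InfiniteVolume.

Unset Implicit Arguments.

Theorem theorem3p7 (R : realType) (d : nat) (d_gt0 : (0 < d)%N)
    (beta h : R) (beta_ge0 : 0 <= beta)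
    (mu : probability (spin_space d) R) (mu_gibbs : gibbs beta h mu)
    (L : set {fset (site d)})
    (L_fillable : fillable L)
    (L_approx : approx_nbhd_property R L)
    (fk_decay : uniform_exp_decay_wired beta h
       [set fset_set (inner_bonds [set` Lam]) | Lam in L]) :
  exists c c' eps : R, [/\ 0 < c, 0 < c', 0 < eps &
    forall Del : {fset (site d)},
    (forall Tht Lam : {fset (site d)}, L Tht -> L Lam ->
       (Tht `<=` Lam)%fset -> (Del `<=` Lam)%fset -> (2 <= #|` Tht|)%N ->
     forall r : R, c * ln (#|` Tht|%:R) <= r ->
       nbhd_in [set` Del] [set` Lam] r `<=` [set` Tht] ->
     forall (eta : config d) (A B : set (config d)),
       sigma_spins [set` Lam] A -> sigma_spins [set` Del] B ->
       monotone_event A -> monotone_event B ->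
       ising beta h Lam eta (occurs_apart [set` Lam] r A B) <=
         (1 + c' * expR (- (eps * r))) *
         ising beta h Lam eta A * ising beta h Lam eta B)
    /\
    (contains_absorbing_sequence L ->
     forall Tht : {fset (site d)}, L Tht ->
     forall r : R, c * ln (#|` Tht|%:R) <= r ->
       nbhd_in [set` Del] setT r `<=` [set` Tht] ->
     forall A B : set (config d),
       sigma_spins [set` Del] B -> locally_occurring A ->
       monotone_event A -> monotone_event B ->
       (mu (occurs_apart setT r A B) <=
         (1 + c' * expR (- (eps * r)))%:E * mu A * mu B)%E)].
Proof.
have [c [c' [eps [c0 c'0 eps0 bounds]]]] := local_bounds beta_ge0 L_fillable L_approx fk_decay.
exists c, c', eps; split=> // Del; split.
  move=> Tht Lam LT LL TL DL n2 r cr nb eta A B mA mB monoA monoB.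
  have TL' : [set` Tht] `<=` [set` Lam] by move=> x; exact: (fsubsetP TL).
  have DL' : [set` Del] `<=` [set` Lam] by move=> x; exact: (fsubsetP DL).
  have locB := sigma_spins_local mB.
  have [S [Q [S0 Q0 SQ hAB hB]]] := bounds Del Tht _ r A B LT TL' DL' cr nb locB monoA monoB.
  apply: le_trans (finite_volume_bound beta_ge0 eta TL S0 Q0 hAB _) _.
    by move=> t t' tt'; apply: hB => x /= xL; exact: tt'.
  have i0 E : 0 <= ising beta h Lam eta E by rewrite isingE //; exact: ising_mean_ge0.
  by apply: ler_wpM2r => //; apply: ler_wpM2r.
move=> _ Tht LT r cr nb A B mB locA monoA monoB.
have locB := sigma_spins_local mB.
have [S [Q [S0 Q0 SQ hAB hB]]] :=
  bounds Del Tht setT r A B LT (@subsetT _ _) (@subsetT _ _) cr nb locB monoA monoB.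
have mA : measurable (A : set (spin_space d)) by case: locA.
have mB' : measurable (B : set (spin_space d)) by exact: local_measurable locB.
have mAB := occurs_apart_measurable r locA monoA locB.
apply: le_trans (infinite_volume_bound beta_ge0 mu_gibbs mAB mA mB' S0 Q0 hAB _) _.
  by move=> t t'; apply: hB => x nx; case: nx.
by apply: lee_wpmul2r => //; apply: lee_wpmul2r => //; rewrite lee_fin.
Qed.
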